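(* Let $d\ge 2$ be a constant and $\phi\ge1$. The expected number of steps performed by 2-Opt (a) is $O(n^{4-1/d}\cdot\log n\cdot\phi)$ on $\phi$-perturbed Manhattan instances with $n$ points when 2-Opt is initialized with a tour obtained by an arbitrary insertion heuristic; (b) is $O(n^{4+1/3-1/d}\cdot\log^2(n\phi)\cdot\phi^{8/3})$ on $\phi$-perturbed Euclidean instances with $n$ points when 2-Opt is initialized with a tour obtained by an arbitrary insertion heuristic.
   Context: A $\phi$-perturbed instance with $n$ points in dimension $d$: vertices $v_1,\ldots,v_n$ are placed independently in $[0,1]^d$, vertex $v_i$ according to a density $f_i\colon[0,1]^d\to[0,\phi]$. Manhattan instances use $L_1$ distances, Euclidean instances $L_2$ distances. 2-Opt starts from a tour and repeatedly performs improving 2-changes (replace tour edges $\{u_1,u_2\},\{v_1,v_2\}$, where $u_1,u_2,v_1,v_2$ are distinct and appear in this order on the tour, by $\{u_1,v_1\},\{u_2,v_2\}$, provided the tour length strictly decreases) until none exists; the bound holds regardless of which improving 2-change is chosen in each step. An insertion heuristic builds a tour by inserting the vertices one after another in some order: if $T_i$ is the current subtour on $i$ vertices and $v$ is the next vertex, an edge $(x,y)$ of $T_i$ minimizing $\mathrm{dist}(x,v)+\mathrm{dist}(v,y)-\mathrm{dist}(x,y)$ is replaced by $(x,v)$ and $(v,y)$; the order of insertion is arbitrary. $O$-notation hides constants depending on $d$. *)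

(* Defs.v *)
From HB Require Import structures.
From mathcomp Require Import all_boot all_order all_algebra.
From mathcomp Require Import all_classical all_reals all_analysis.

Set Implicit Arguments.
Unset Strict Implicit.
Unset Printing Implicit Defensive.

Import Order.TTheory GRing.Theory Num.Theory.
Import numFieldNormedType.Exports.

Local Open Scope classical_set_scope.
Local Open Scope ring_scope.

(* A point of R^d is a d-tuple of reals; d.-tuple (measurableTypeR R) carries
   the product of the Borel sigma-algebras. *)
Notation Rpoint R d := (d.-tuple (measurableTypeR R)).

Section lebesgue_tuple.
Context (R : realType).

Definition cons_pair d (p : measurableTypeR R * Rpoint R d) : Rpoint R d.+1 :=
  [tuple of p.1 :: p.2].

Definition lebesgue_cons d (mu : set (Rpoint R d) -> \bar R) :
    set (Rpoint R d.+1) -> \bar R :=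
  pushforward (@lebesgue_measure R \x mu)%E (@cons_pair d).

(* d-dimensional Lebesgue measure, as an iterated product measure; see
   lebesgue_tuple_box. *)
Fixpoint lebesgue_tuple d : set (Rpoint R d) -> \bar R :=
  match d with
  | 0 => \d_([tuple] : Rpoint R 0)
  | d'.+1 => lebesgue_cons (@lebesgue_tuple d')
  end.

Lemma measurable_cons_pair d : measurable_fun setT (@cons_pair d).
Proof. by apply: measurable_cons. Qed.

Section lebesgue_cons.
Context d (mu : {sigma_finite_measure set (Rpoint R d) -> \bar R}).

Let measurable_preimage A :
  measurable A -> measurable (@cons_pair d @^-1` A).
Proof.
by move=> mA; rewrite -[X in measurable X]setTI; exact: measurable_cons_pair.
Qed.

Let lebesgue_cons0 : lebesgue_cons mu set0 = 0%E.
Proof. by rewrite /lebesgue_cons /pushforward preimage_set0 measure0. Qed.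

Let lebesgue_cons_ge0 A : (0 <= lebesgue_cons mu A)%E.
Proof. exact: (@measure_ge0 _ _ _ (@lebesgue_measure R \x mu)%E). Qed.

Let lebesgue_cons_semi_sigma_additive : semi_sigma_additive (lebesgue_cons mu).
Proof.
move=> F mF tF mUF; rewrite /lebesgue_cons /pushforward preimage_bigcup.
apply: measure_semi_sigma_additive.
- by move=> n; exact: measurable_preimage.
- apply/trivIsetP => /= i j _ _ ij; rewrite -preimage_setI.
  by move/trivIsetP : tF => /(_ _ _ _ _ ij) ->//; rewrite preimage_set0.
- by rewrite -preimage_bigcup; exact: measurable_preimage.
Qed.

HB.instance Definition _ := isMeasure.Build _ _ _ (lebesgue_cons mu)
  lebesgue_cons0 lebesgue_cons_ge0 lebesgue_cons_semi_sigma_additive.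

Let uncons (t : Rpoint R d.+1) : measurableTypeR R * Rpoint R d :=
  (thead t, [tuple of behead t]).

Let measurable_uncons : measurable_fun setT uncons.
Proof.
apply: measurable_fun_pair; last exact: measurable_behead.
exact: measurable_tnth.
Qed.

Let lebesgue_cons_sigma_finite : sigma_finite setT (lebesgue_cons mu).
Proof.
have /sigma_finiteP[F [FT ndF Foo]] := sigma_finiteT (@lebesgue_measure R).
have /sigma_finiteP[G [GT ndG Goo]] := sigma_finiteT mu.
exists (fun n => uncons @^-1` (F n `*` G n)).
  apply/esym; rewrite -subTset => t _.
  have [n _ Fn] : (\bigcup_n F n) (thead t) by rewrite -FT.
  have [k _ Gk] : (\bigcup_n G n) [tuple of behead t] by rewrite -GT.
  exists (maxn n k) => //; split => /=.
    by move: Fn; exact/subsetPset/ndF/leq_maxl.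
  by move: Gk; exact/subsetPset/ndG/leq_maxr.
move=> n; have [mF Fn] := Foo n; have [mG Gn] := Goo n; split.
  by rewrite -[X in measurable X]setTI; apply: measurable_uncons => //;
     exact: measurableX.
rewrite /lebesgue_cons /pushforward -comp_preimage (_ : uncons \o _ = id).
  by rewrite preimage_id product_measure1E// lte_mul_pinfty// ge0_fin_numE.
by apply/funext => -[x t]; rewrite /uncons /=; congr pair; exact/val_inj.
Qed.

HB.instance Definition _ := Measure_isSigmaFinite.Build _ _ _ (lebesgue_cons mu)
  lebesgue_cons_sigma_finite.

End lebesgue_cons.

Lemma lebesgue_tuple_sigma_finite_measure d :
  exists mu : {sigma_finite_measure set (Rpoint R d) -> \bar R},
    @lebesgue_tuple d = mu :> (set _ -> \bar R).
Proof.
elim: d => [|d [mu IH]]; first by exists (\d_([tuple] : Rpoint R 0)).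
by exists (lebesgue_cons mu); rewrite /= IH.
Qed.

Let lebesgue_tuple0 d : @lebesgue_tuple d set0 = 0%E.
Proof. by have [mu ->] := lebesgue_tuple_sigma_finite_measure d. Qed.

Let lebesgue_tuple_ge0 d A : (0 <= @lebesgue_tuple d A)%E.
Proof. by have [mu ->] := lebesgue_tuple_sigma_finite_measure d. Qed.

Let lebesgue_tuple_semi_sigma_additive d :
  semi_sigma_additive (@lebesgue_tuple d).
Proof.
have [mu ->] := lebesgue_tuple_sigma_finite_measure d.
exact: measure_semi_sigma_additive.
Qed.

HB.instance Definition _ d := isMeasure.Build _ _ _ (@lebesgue_tuple d)
  (lebesgue_tuple0 d) (@lebesgue_tuple_ge0 d)
  (@lebesgue_tuple_semi_sigma_additive d).

Let lebesgue_tuple_sigma_finite d : sigma_finite setT (@lebesgue_tuple d).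
Proof.
have [mu ->] := lebesgue_tuple_sigma_finite_measure d.
exact: sigma_finiteT.
Qed.

HB.instance Definition _ d := Measure_isSigmaFinite.Build _ _ _
  (@lebesgue_tuple d) (lebesgue_tuple_sigma_finite d).

Lemma measurable_tuple_box d (B : 'I_d -> set (measurableTypeR R)) :
  (forall i, measurable (B i)) ->
  measurable [set t : Rpoint R d | forall i, B i (tnth t i)].
Proof.
move=> mB.
rewrite (_ : [set t | _] =
    \bigcap_(i in setT) ((fun t : Rpoint R d => tnth t i) @^-1` B i)).
  apply: fin_bigcap_measurable => // i _.
  by rewrite -[X in measurable X]setTI; exact: measurable_tnth.
by apply/seteqP; split => t /= h i; [move=> _; exact: h | exact: h].
Qed.

Lemma lebesgue_tuple_box d (B : 'I_d -> set (measurableTypeR R)) :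
  (forall i, measurable (B i)) ->
  lebesgue_tuple [set t | forall i, B i (tnth t i)] =
  (\prod_(i < d) lebesgue_measure (B i))%E.
Proof.
elim: d B => [|d IH] B mB.
  by rewrite big_ord0 /= diracE mem_set//= => -[].
rewrite big_ord_recl -IH//= /lebesgue_cons /pushforward.
rewrite (_ : _ @^-1` _ = B ord0 `*`
    [set t : Rpoint R d | forall i, B (lift ord0 i) (tnth t i)]); last first.
  apply/seteqP; split => -[x t] /=.
    move=> h; split; first exact: (h ord0).
    by move=> i; have := h (lift ord0 i); rewrite /cons_pair tnthS.
  by move=> [h0 h] i; case: (unliftP ord0 i) => [j|] ->;
     rewrite /cons_pair ?tnthS ?tnth0//; exact: h.
have := measurable_tuple_box (fun i => mB (lift ord0 i)).
exact: product_measure1E.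
Qed.

End lebesgue_tuple.

Section perturbed_instance.
Context (R : realType) (d : nat).

Definition unit_cube : set (Rpoint R d) :=
  [set x | forall k, 0 <= (tnth x k : R) <= 1].

Definition manhattan (x y : Rpoint R d) : R :=
  \sum_(k < d) `|(tnth x k : R) - tnth y k|.

Definition euclidean (x y : Rpoint R d) : R :=
  Num.sqrt (\sum_(k < d) ((tnth x k : R) - tnth y k) ^+ 2).

(* f : [0,1]^d -> [0, phi] is a density of the random point X; the values of f
   outside the cube are irrelevant. Taking A := setT shows that f has total
   mass 1, and taking A := unit_cube that X lies in the cube almost surely. *)
Definition has_density_on_cube (dOm : measure_display) (Om : measurableType dOm)
    (P : probability Om R) (X : Om -> Rpoint R d) (phi : R)
    (f : Rpoint R d -> R) : Prop :=
  [/\ measurable_fun unit_cube f,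
      (forall x, unit_cube x -> 0 <= f x <= phi) &
      forall A : set (Rpoint R d), measurable A ->
        P (X @^-1` A) = (\int[@lebesgue_tuple R d]_(x in A `&` unit_cube)
                           (f x)%:E)%E].

Record perturbed_instance (n : nat) (phi : R) (dOm : measure_display)
    (Om : measurableType dOm) (P : probability Om R)
    (X : 'I_n -> Om -> Rpoint R d) : Prop := PerturbedInstance {
  perturbed_measurable : forall i, measurable_fun setT (X i) ;
  perturbed_independent :
    forall (J : {set 'I_n}) (A : 'I_n -> set (Rpoint R d)),
      (forall i, measurable (A i)) ->
      P (\bigcap_(i in [set` J]) X i @^-1` A i) =
        (\prod_(i in J) P (X i @^-1` A i))%E ;
  perturbed_density :
    forall i, exists f, has_density_on_cube P (X i) phi f
}.

End perturbed_instance.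

(* A (sub)tour on vertices of V is a duplicate-free sequence read cyclically:
   its edges are (x, next T x) for x in T. A tour on one vertex has a single
   loop as edge, a tour on two vertices the same edge twice. *)
Section tours.
Context (R : realType) (V : finType) (dist : V -> V -> R).
Implicit Types (T : seq V) (x y u v : V).

Definition tour_length T : R := \sum_(x <- T) dist x (next T x).

Definition insertion_cost T v x : R :=
  dist x v + dist v (next T x) - dist x (next T x).

Inductive insertion_subtour : seq V -> Prop :=
| InsertionStart v : insertion_subtour [:: v]
| InsertionStep T1 x T2 v :
    insertion_subtour (T1 ++ x :: T2) ->
    v \notin T1 ++ x :: T2 ->
    (forall y, y \in T1 ++ x :: T2 ->
       insertion_cost (T1 ++ x :: T2) v x <=
       insertion_cost (T1 ++ x :: T2) v y) ->
    insertion_subtour (T1 ++ [:: x, v & T2]).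

Definition insertion_tour T : Prop :=
  insertion_subtour T /\ forall v, v \in T.

(* Replacing the edges {u1,u2}, {v1,v2} by {u1,v1}, {u2,v2} reverses the part
   of the tour from u2 to v1; the rotation lets u1 be any vertex. *)
Definition two_change T T' : Prop :=
  exists r u1 u2 v1 v2 S1 S2,
    [/\ uniq [:: u1; u2; v1; v2],
        rot r T = [:: u1, u2 & S1] ++ [:: v1, v2 & S2] &
        T' = [:: u1, v1 & rev S1] ++ [:: u2, v2 & S2]].

Definition improving_two_change T T' : Prop :=
  two_change T T' /\ tour_length T' < tour_length T.

(* two_opt_run T k: 2-Opt started at T can stop, in a local optimum, after
   exactly k steps. *)
Inductive two_opt_run : seq V -> nat -> Prop :=
| TwoOptStop T :
    (forall T', ~ improving_two_change T T') -> two_opt_run T 0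
| TwoOptStep T T' k :
    improving_two_change T T' -> two_opt_run T' k -> two_opt_run T k.+1.

(* The worst case over all insertion heuristics and all choices of the
   improving 2-changes. It is taken for fixed positions of the vertices, so
   insertion orders, ties and 2-changes may depend on these positions. *)
Definition two_opt_steps : \bar R :=
  ereal_sup [set k%:R%:E | k in
    [set k | exists2 T, insertion_tour T & two_opt_run T k]].

End tours.

Definition expected_two_opt_steps (R : realType) (d n : nat)
    (dist : Rpoint R d -> Rpoint R d -> R) (dOm : measure_display)
    (Om : measurableType dOm) (P : probability Om R)
    (X : 'I_n -> Om -> Rpoint R d) : \bar R :=
  (\int[P]_w two_opt_steps (fun i j : 'I_n => dist (X i w) (X j w)))%E.

(* Main.v *)
(* Call two 2-changes linked if one of them removes an edge that the other one
   adds and they do not have the same four vertices. If no two linked 2-changes have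
   gains in (0, delta], a potential argument on the tour edges shows that 2-Opt
   makes at most n + 3 L / delta steps from a tour of length L. An insertion tour
   has length L = O(n^(1-1/d)), since every cell of a dyadic subdivision of the
   cube is charged only once. Hence the expected number of steps is at most
   n + 3 L 4^N0 + sum_(N >= N0) 3 L 4^(N+1) p_N, where p_N is the probability that
   a linked pair with gains in (0, 4^-N] exists.

   For the Manhattan metric both gains are, for fixed signs, linear forms in the
   coordinates; if some 2x2 minor of their coefficients is nonzero, resampling
   two coordinates gives probability O(phi^2 16^-N), and if all minors vanish then
   the first gain is nonpositive. Thus p_N = O(n^6 phi^2 16^-N), and 4^N0 is chosen
   of order n^3 phi. For the Euclidean metric, the level sets of
   x |-> |x - p| +- |x - q| are controlled by slicing annuli around q, a dyadic
   decomposition of |p - q| and of triangle areas then yields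
   p_N = O(N^2 (n^5 phi^4 8^-N + n^6 phi^5 N 16^-N)), and 8^N0 is chosen of order
   n^5 phi^4. *)

Require Import Defs.
From HB Require Import structures.
From mathcomp Require Import all_boot all_order all_algebra.
From mathcomp Require Import all_classical all_reals all_analysis.
From mathcomp Require Import measurable_realfun measurable_fun_approximation.
From mathcomp Require Import ring lra zify.
Set Implicit Arguments.
Unset Strict Implicit.
Unset Printing Implicit Defensive.
Import Order.TTheory GRing.Theory Num.Theory.
Import numFieldNormedType.Exports.
Local Open Scope classical_set_scope.
Local Open Scope ring_scope.

(** * Runs of 2-Opt and linked pairs of small improvements *)

(** One small 2-change imposes a single constraint, for which slicing gives a probability of order
    [4^-N]; the terms [4^N p_N] would then not decay. A linked pair imposes two constraints, but the
    second factor is gained only if the two gains depend on different data. Pairs on the same four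
    vertices are therefore set apart: four vertices carry only three perfect matchings, so such
    changes form chains of length at most two, and three edge labels absorb them.

    The two gains always share vertices. Slicing is thus nested: points that occur in one change
    only are redrawn first, and what remains is an event on the other points, which is sliced again.
    In the Euclidean case each slice bound degenerates like the inverse distance of two fixed
    points. Both slices are arranged to refer to the same two points, and for [d >= 2] these are
    within [rho] with probability [O(phi rho^2)], which cancels both losses on every dyadic scale.

    [N0] balances the part [4^N0] that is paid deterministically against the tail of the series. *)

Section cyclic_sums.
Context (R : realType) (V : finType).
Implicit Types (g : V -> V -> R) (s T : seq V).

(** Unlike the cyclic sum in [tour_length], the sum along an open walk splits over concatenation and
    survives reversal for symmetric [g]; a 2-change needs nothing else. *)
Fixpoint path_sum g x s : R :=
  if s is y :: s' then g x y + path_sum g y s' else 0.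

Lemma path_sum_cat g x s1 s2 :
  path_sum g x (s1 ++ s2) = path_sum g x s1 + path_sum g (last x s1) s2.
Proof.
elim: s1 x => [|y s1 IH] x /=; first by rewrite add0r.
by rewrite IH addrA.
Qed.

Lemma path_sum_rcons g x s y :
  path_sum g x (rcons s y) = path_sum g x s + g (last x s) y.
Proof. by rewrite -cats1 path_sum_cat /= addr0. Qed.

Lemma path_sum_rev g x s y : (forall a b, g a b = g b a) ->
  path_sum g x (rcons s y) = path_sum g y (rcons (rev s) x).
Proof.
move=> gC; elim: s x y => [|z s IH] x y /=; first by rewrite gC.
by rewrite IH rev_cons [RHS]path_sum_rcons last_rcons addrC gC.
Qed.

Lemma path_sumE g x0 x s :
  path_sum g x s = \sum_(i < size s) g (nth x0 (x :: s) i) (nth x0 s i).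
Proof.
elim: s x => [|y s IH] x /=; first by rewrite big_ord0.
by rewrite big_ord_recl /= IH.
Qed.

Lemma tour_length_cons g x s : uniq (x :: s) ->
  tour_length g (x :: s) = path_sum g x (rcons s x).
Proof.
move=> us; rewrite (path_sumE _ x) size_rcons /tour_length (big_nth x) big_mkord.
apply: eq_bigr => i _; rewrite next_nth mem_nth ?ltn_ord// index_uniq ?ltn_ord//.
rewrite -rcons_cons !nth_rcons ltn_ord /=; congr (g _ _).
(* At the last vertex [next] falls back on the head [x], which is the entry that [rcons] appends. *)
case: ltnP => // si; rewrite if_same nth_default//.
Qed.

Lemma tour_length_rot g r T : uniq T -> tour_length g (rot r T) = tour_length g T.
Proof.
move=> uT; rewrite /tour_length (perm_big T) /= ?perm_rot//.
by apply: eq_bigr => x _; rewrite next_rot.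
Qed.

Definition gain g a b c d : R := g a b + g c d - g a c - g b d.

Lemma two_change_perm T T' : two_change T T' -> perm_eq T T'.
Proof.
move=> [r [u1 [u2 [v1 [v2 [S1 [S2 [_ rT ->]]]]]]]].
rewrite -(perm_rot r T) rT /= perm_cons -!cat_cons.
rewrite -[v1 :: v2 :: S2]cat1s -[u2 :: v2 :: S2]cat1s !catA perm_cat2r.
rewrite !cats1 perm_rcons perm_sym perm_rcons.
by rewrite (perm_catCA [:: u2] [:: v1] _) /= !perm_cons perm_rev.
Qed.

(** The vertices are chosen before [g], so the same four serve for the distance and for the edge
    labels of the potential. *)
Lemma two_change_gain T T' : uniq T -> two_change T T' ->
  exists a b c d, uniq [:: a; b; c; d] /\
    forall g, (forall x y, g x y = g y x) ->
      tour_length g T = tour_length g T' + gain g a b c d.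
Proof.
move=> uT tc; have pT := two_change_perm tc.
have uT' : uniq T' by rewrite -(perm_uniq pT).
case: tc pT => [r [a [b [c [d [S1 [S2 [u4 rT T'E]]]]]]]] pT.
exists a, b, c, d; split=> // g gC.
rewrite -(tour_length_rot g r uT) rT {1}T'E.
rewrite -(rot_uniq r) rT in uT; rewrite T'E in uT'.
rewrite !cat_cons in uT uT' *; rewrite !tour_length_cons//.
rewrite !rcons_cons !rcons_cat !rcons_cons /= !path_sum_cat /=.
have := path_sum_rev b S1 c gC; rewrite !path_sum_rcons => h.
have -> : g (last b S1) c = path_sum g c (rev S1) + g (last c (rev S1)) b
          - path_sum g b S1 by rewrite -h addrAC subrr add0r.
rewrite /gain; ring.
Qed.

End cyclic_sums.

Section linked_pairs.
Context (R : realType) (V : finType) (dist : V -> V -> R) (delta : R).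
Hypotheses (dist_sym : forall x y, dist x y = dist y x)
  (dist_ge0 : forall x y, 0 <= dist x y) (delta_gt0 : 0 < delta).

(* The improving 2-change that replaces the edges {a, b}, {c, d} by {a, c},
   {b, d}. *)
Definition small_change a b c d :=
  uniq [:: a; b; c; d] && (0 < gain dist a b c d <= delta).

(* The second 2-change removes the edge {a, c} added by the first one; the last
   two conditions say that the two changes share at most one further vertex. *)
Definition linked_small_changes := exists a b c d e f,
  [/\ small_change a b c d, small_change a c e f,
      ~ (e = b /\ f = d) & ~ (e = d /\ f = b)].

Let gain_flip a b c d : gain dist c d a b = gain dist a b c d.
Proof. by rewrite /gain (dist_sym c a) (dist_sym d b); ring. Qed.

Let gain_turn a b c d : gain dist b a d c = gain dist a b c d.
Proof. by rewrite /gain (dist_sym b a) (dist_sym d c); ring. Qed.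

Let small_flip a b c d : small_change a b c d -> small_change c d a b.
Proof.
rewrite /small_change gain_flip => /andP[u ->]; rewrite andbT.
by rewrite -(rot_uniq 2).
Qed.

Let small_turn a b c d : small_change a b c d -> small_change b a d c.
Proof.
rewrite /small_change gain_turn => /andP[u ->]; rewrite andbT.
move: u; rewrite /= !inE !negb_or.
by rewrite (eq_sym b a) (eq_sym d c) => /and4P[/and3P[-> -> ->] /andP[-> ->] -> _].
Qed.

(** Position of an edge in a chain of small changes: [smallS] marks the edges that some small change
    adds, [smallS2] those added by a small change that removes a marked edge. *)
Let smallS x y := [exists b, exists d, small_change x b y d].

Let smallSP x y : reflect (exists b d, small_change x b y d) (smallS x y).
Proof.
apply: (iffP existsP) => [[b /existsP[d h]]|[b [d h]]]; first by exists b, d.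
by exists b; apply/existsP; exists d.
Qed.

Let smallSC x y : smallS x y = smallS y x.
Proof.
by apply/smallSP/smallSP => -[b [d /small_flip h]]; exists d, b.
Qed.

Let smallS2 x y :=
  [exists b, exists d, small_change x b y d && (smallS x b || smallS y d)].

Let smallS2P x y :
  reflect (exists b d, small_change x b y d /\ (smallS x b || smallS y d)) (smallS2 x y).
Proof.
apply: (iffP existsP) => [[b /existsP[d /andP h]]|[b [d [h k]]]]; first by exists b, d.
by exists b; apply/existsP; exists d; rewrite h.
Qed.

Let smallS2C x y : smallS2 x y = smallS2 y x.
Proof.
apply/smallS2P/smallS2P => -[b [d [/small_flip h k]]]; exists d, b;
  by rewrite orbC.
Qed.

(* Without linked small changes, a small change whose removed edges are not both
   of label 2 adds two edges of label 0, and an edge of label 0 is never removed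
   by a small change; hence every small change lowers the sum of the labels of
   the tour by at least 2. *)
Let lab x y : R := if smallS2 x y then 0 else if smallS x y then 1 else 2.

Let labC x y : lab x y = lab y x.
Proof. by rewrite /lab smallS2C smallSC. Qed.

Let lab_ge0 x y : 0 <= lab x y.
Proof. by rewrite /lab; case: ifP => // _; case: ifP. Qed.

Let lab_le2 x y : lab x y <= 2.
Proof. by rewrite /lab; case: ifP => // _; case: ifP => // _; rewrite ler1n. Qed.

Hypothesis unlinked : ~ linked_small_changes.

(** Only the two exceptions of [linked_small_changes] are left. The first would undo the small
    change, giving opposite gains; the second leads to the third perfect matching of the same four
    vertices. *)
Let link a b c d e f : small_change a b c d -> small_change a c e f ->
  e = d /\ f = b.
Proof.
move=> h1 h2; case: (pselect (e = d /\ f = b)) => // k.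
case: (pselect (e = b /\ f = d)) => [[eb fd]|k']; last first.
  by case: unlinked; exists a, b, c, d, e, f.
move: h1 h2; rewrite eb fd /small_change => /andP[_ /andP[h1 _]] /andP[_ /andP[h2 _]].
by exfalso; move: h1 h2; rewrite /gain; lra.
Qed.

(** Otherwise [link] would confine three small changes to the same four vertices; they would run
    once around the three perfect matchings, and their gains would sum to 0. *)
Let small_notS2 a b c d : small_change a b c d -> ~~ smallS2 a b.
Proof.
move=> j; apply/negP => /smallS2P[x [y [q]]].
have [cE dE] := link q j; subst c d.
have := j; have := q; rewrite /small_change => /andP[_ /andP[q0 _]] /andP[_ /andP[j0 _]].
move=> /orP[] /smallSP[p [r s]]; have := s.
  have [? ?] := link s q; subst p r.
  rewrite /small_change => /andP[_ /andP[s0 _]]; move: q0 j0 s0.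
  rewrite /gain (dist_sym y b) (dist_sym y x) (dist_sym x b); lra.
have [? ?] := link s (small_flip q); subst p r.
rewrite /small_change => /andP[_ /andP[s0 _]]; move: q0 j0 s0.
rewrite /gain (dist_sym y x) (dist_sym y a) (dist_sym x a); lra.
Qed.

Let gain_lab a b c d : small_change a b c d -> 2 <= gain lab a b c d.
Proof.
move=> j; have nab := small_notS2 j; have ncd := small_notS2 (small_flip j).
have Sac : smallS a c by apply/smallSP; exists b, d.
have Sbd : smallS b d by apply/smallSP; exists a, c; exact: small_turn.
have h : smallS a b || smallS c d -> smallS2 a c && smallS2 b d.
  move=> h; apply/andP; split; apply/smallS2P; first by exists b, d.
  by exists a, c; rewrite (smallSC b) (smallSC d); split=> //; exact: small_turn.
rewrite /gain /lab (negbTE nab) (negbTE ncd) Sac Sbd.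
case: (boolP (smallS a b)) h => _; case: (boolP (smallS c d)) => _ /= h.
- by have /andP[-> ->] := h isT; lra.
- by have /andP[-> ->] := h isT; lra.
- by have /andP[-> ->] := h isT; lra.
- by case: ifP => _; case: ifP => _; lra.
Qed.

Let gain_lab_ge a b c d : -4 <= gain lab a b c d.
Proof.
rewrite /gain; have := lab_ge0 a b; have := lab_ge0 c d.
by have := lab_le2 a c; have := lab_le2 b d; lra.
Qed.

(** The potential [6 * tour_length / delta] plus the label sum drops by at least 2 per step: a small
    change lowers the labels by 2, and any other step lowers the length term by at least 6 while the
    labels rise by at most 4. Initially each edge contributes a label of at most 2. *)
Lemma two_opt_run_le T k : uniq T -> two_opt_run dist T k ->
  k%:R <= 3 * tour_length dist T / delta + (size T)%:R.
Proof.
move=> uT run.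
suff h : 2 * k%:R <= 6 * tour_length dist T / delta + tour_length lab T.
  have : tour_length lab T <= 2 * (size T)%:R.
    apply: (@le_trans _ _ (\sum_(x <- T) 2)); first exact: ler_sum.
    by rewrite big_const_seq count_predT iter_addr_0 mulr_natr.
  have := h; lra.
elim: run uT => {T k} [T _|T T' k [tc imp] _ IH] uT.
  rewrite mulr0 addr_ge0 ?mulr_ge0 ?invr_ge0 ?(ltW delta_gt0) ?sumr_ge0//.
have uT' : uniq T' by rewrite -(perm_uniq (two_change_perm tc)).
have [a [b [c [d [u4 E]]]]] := two_change_gain R uT tc.
have Ed := E _ dist_sym; have El := E _ labC; have {}IH := IH uT'.
have g0 : 0 < gain dist a b c d by move: imp; rewrite Ed; lra.
have -> : k.+1%:R = k%:R + 1 :> R by rewrite -addn1 natrD.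
rewrite Ed El.
have -> : 6 * (tour_length dist T' + gain dist a b c d) / delta =
  6 * tour_length dist T' / delta + 6 * gain dist a b c d / delta by ring.
have gd0 : 0 <= 6 * gain dist a b c d / delta.
  by rewrite mulr_ge0 ?invr_ge0 ?(ltW delta_gt0)// mulr_ge0// ltW.
have [small|big] := leP (gain dist a b c d) delta.
  have := @gain_lab a b c d; rewrite /small_change u4 g0 small => /(_ isT).
  move: IH gd0; lra.
have : 6 <= 6 * gain dist a b c d / delta.
  by rewrite ler_pdivlMr// ler_pM2l// ltW.
have := gain_lab_ge a b c d; move: IH; lra.
Qed.

End linked_pairs.

(** * Length of insertion tours *)

Section insertion.
Context (R : realType) (V : finType) (dist : V -> V -> R).
Hypotheses (dist_sym : forall x y, dist x y = dist y x)
  (dist_tri : forall x y z, dist x z <= dist x y + dist y z)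
  (dist_xx : forall x, dist x x = 0).
Context (C : nat -> finType) (cell : forall j, V -> C j) (D : R) (J : nat).
Hypotheses (dist_le : forall x y, dist x y <= D)
  (cell_dist : forall j x y, cell j x = cell j y -> dist x y <= D / 2 ^+ j).

Let occupied (T : seq V) j := #|(cell j @: T)%SET|.

Lemma insertion_subtour_uniq T : insertion_subtour dist T -> uniq T.
Proof.
elim=> [//|T1 x T2 v _ uT vT _].
have : perm_eq (v :: (T1 ++ x :: T2)) (T1 ++ [:: x, v & T2]).
  by rewrite -[v :: _]cat1s perm_catCA perm_cat2l -[_ :: T2]cat1s perm_catCA.
by move=> /perm_uniq <-; rewrite /= vT uT.
Qed.

Let insertion_cost_le T v y : insertion_cost dist T v y <= 2 * dist y v.
Proof.
rewrite /insertion_cost; have := dist_tri v y (next T y).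
by rewrite (dist_sym v y); lra.
Qed.

Lemma tour_length_insert T1 x T2 v : uniq (T1 ++ x :: T2) ->
  v \notin T1 ++ x :: T2 ->
  tour_length dist (T1 ++ [:: x, v & T2]) =
  tour_length dist (T1 ++ x :: T2) + insertion_cost dist (T1 ++ x :: T2) v x.
Proof.
move=> uT vT; have uT' : uniq (T1 ++ [:: x, v & T2]).
  have : perm_eq (v :: (T1 ++ x :: T2)) (T1 ++ [:: x, v & T2]).
    by rewrite -[v :: _]cat1s perm_catCA perm_cat2l -[_ :: T2]cat1s perm_catCA.
  by move=> /perm_uniq <-; rewrite /= vT uT.
rewrite /insertion_cost -(next_rot (size T1) uT).
rewrite -(tour_length_rot dist (size T1) uT) -(tour_length_rot dist (size T1) uT').
move: uT uT'; rewrite -(rot_uniq (size T1)) -[uniq (_ ++ [:: x, v & T2])](rot_uniq (size T1)).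
rewrite !rot_size_cat !cat_cons => uT uT'; rewrite !tour_length_cons//=.
(* A subtour on one vertex is a loop, whose length vanishes by [dist_xx]. *)
case: (T2 ++ T1) uT uT' => [|y s] uT uT' /=; rewrite ?eqxx ?dist_xx; ring.
Qed.

(* Inserting v costs at most twice its distance to the subtour, and for the
   least j such that the cell of v at level j is new, some vertex of the subtour
   is at distance at most 2 D / 2 ^ j; so each cell is charged at most once. *)
Lemma insertion_subtour_length T : insertion_subtour dist T ->
  tour_length dist T <= 2 * ((size T)%:R * (D / 2 ^+ J) +
    \sum_(j < J.+1) 2 * D / 2 ^+ j * (occupied T j)%:R).
Proof.
have D0 (x : V) : 0 <= D by rewrite -(dist_xx x).
elim=> {T} [v|T1 x T2 v iT IH vT vmin].
  rewrite tour_length_cons//= dist_xx addr0 mulr_ge0// addr_ge0 ?mulr_ge0 ?(D0 v)//.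
  by rewrite sumr_ge0// => j _; rewrite !mulr_ge0 ?(D0 v).
have uT := insertion_subtour_uniq iT.
rewrite tour_length_insert//; set T := T1 ++ x :: T2 in IH vT vmin uT *.
set T' := T1 ++ _.
have pT : perm_eq (v :: T) T'.
  by rewrite -[v :: _]cat1s perm_catCA perm_cat2l -[_ :: T2]cat1s perm_catCA.
have occT' j : occupied T' j = ((cell j v \notin (cell j @: T)%SET) + occupied T j)%N.
  rewrite /occupied -cardsU1; congr #|pred_of_set _|; apply/setP => c.
  rewrite !inE; apply/imsetP/orP => [[y]|].
    rewrite -(perm_mem pT) inE => /orP[/eqP -> ->|yT ->]; first by left.
    by right; apply/imsetP; exists y.
  move=> [/eqP ->|/imsetP[y yT ->]].
    by exists v => //; rewrite -(perm_mem pT) mem_head.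
  by exists y => //; rewrite -(perm_mem pT) inE yT orbT.
rewrite -(perm_size pT) /=.
under [in leRHS]eq_bigr do rewrite occT' natrD mulrDr.
have -> : (size T).+1%:R = (size T)%:R + 1 :> R by rewrite -addn1 natrD.
rewrite big_split /=.
suff : insertion_cost dist T v x <= 2 * (D / 2 ^+ J +
    \sum_(j < J.+1) 2 * D / 2 ^+ j * (cell j v \notin (cell j @: T)%SET)%:R).
  move=> /(lerD IH) /le_trans; apply; rewrite -mulrDr ler_pM2l// addrACA.
  by rewrite [X in _ <= X + _]mulrDl mul1r lerD2l addrC.
have xT : x \in T by rewrite mem_cat mem_head orbT.
have near y (b : R) : y \in T -> dist y v <= b -> insertion_cost dist T v x <= 2 * b.
  move=> yT yb; apply: (le_trans (vmin _ yT)).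
  by rewrite (le_trans (insertion_cost_le _ _ _))// ler_pM2l.
have old j : cell j v \in (cell j @: T)%SET ->
    exists2 y, y \in T & dist y v <= D / 2 ^+ j.
  by move=> /imsetP[y yT h]; exists y => //; exact: cell_dist.
set S := \sum_(_ < _) _.
have S0 : 0 <= S by rewrite sumr_ge0// => j _; rewrite !mulr_ge0 ?(D0 v).
have [new|] := boolP [exists j : 'I_J.+1, cell j v \notin (cell j @: T)%SET]; last first.
  (* No new cell at any level: the finest cell of [v] is occupied, and the insertion is paid by the
     term [D / 2 ^+ J] that each vertex contributes. *)
  rewrite negb_exists => /forallP /(_ ord_max); rewrite negbK => /old[y yT yd].
  by apply: (near y) => //; rewrite (le_trans yd)// lerDl.
have exnew : exists j, (j <= J)%N && (cell j v \notin (cell j @: T)%SET).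
  by case/existsP: new => j nj; exists j; rewrite nj andbT -ltnS.
case: (ex_minnP exnew) => j /andP[jJ nj] jmin.
have Sj : 2 * D / 2 ^+ j <= S.
  rewrite /S (bigD1 (Ordinal (jJ : (j < J.+1)%N)))//= nj mulr1 lerDl.
  by rewrite sumr_ge0// => i _; rewrite !mulr_ge0 ?(D0 v).
have DJ : 0 <= D / 2 ^+ J by rewrite mulr_ge0 ?(D0 v).
suff [y yT yd] : exists2 y, y \in T & dist y v <= 2 * D / 2 ^+ j.
  by apply: (near y _ yT); apply/(le_trans yd)/(le_trans Sj); rewrite lerDr.
(* At level 0 there is no coarser cell, and the diameter bound [dist_le] takes its place. *)
case: j jJ nj jmin {Sj} => [|j] jJ nj jmin.
  by exists x => //; rewrite expr0 divr1 (le_trans (dist_le _ _))// mulr_natl mulr2n lerDl (D0 v).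
have [//|y yT yd] := old j.
  apply/negPn/negP => nj'; have := jmin j; rewrite nj' (ltnW jJ) ltnn.
  by move=> /(_ isT).
by exists y => //; rewrite exprS invfM mulrACA divff// mul1r.
Qed.

End insertion.

(** * Resampling of random configurations *)

Section tuple_measures.
Context (R : realType) (d : measure_display) (T : measurableType d) (n : nat).

Definition tupd (z : n.-tuple T) (i : 'I_n) (x : T) : n.-tuple T :=
  [tuple if j == i then x else tnth z j | j < n].

Lemma tnth_tupd z i x j : tnth (tupd z i x) j = if j == i then x else tnth z j.
Proof. by rewrite tnth_mktuple. Qed.

Lemma measurable_tupd i :
  measurable_fun [set: n.-tuple T * T] (fun p => tupd p.1 i p.2).
Proof.
apply/measurable_fun_tnthP => j.
rewrite (_ : _ \o _ = fun p => if j == i then p.2 else tnth p.1 j); last first.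
  by apply/funext => p /=; rewrite tnth_tupd.
case: (j == i); first exact: measurable_snd.
apply: (@measurableT_comp _ _ _ _ _ _ (fun z : n.-tuple T => tnth z j)) => //.
exact: measurable_tnth.
Qed.

Lemma measurable_tupd1 z i : measurable_fun [set: T] (tupd z i).
Proof.
apply/measurable_fun_tnthP => j.
rewrite (_ : _ \o _ = fun x => if j == i then x else tnth z j); last first.
  by apply/funext => x /=; rewrite tnth_tupd.
by case: (j == i).
Qed.

Definition tuple_box (B : 'I_n -> set T) : set (n.-tuple T) :=
  [set t | forall i, B i (tnth t i)].

Lemma measurable_box B : (forall i, measurable (B i)) -> measurable (tuple_box B).
Proof.
move=> mB; rewrite (_ : tuple_box B =
    \bigcap_(i in setT) ((fun t : n.-tuple T => tnth t i) @^-1` B i)).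
  apply: fin_bigcap_measurable => // i _.
  by rewrite -[X in measurable X]setTI; exact: measurable_tnth.
by apply/seteqP; split => t /= h i; [move=> _; exact: h | exact: h].
Qed.

(** Boxes are stable under intersection and generate the product sigma-algebra, since each generator
    is a box with [setT] in all other coordinates. *)
Lemma tuple_measure_unique (m1 m2 : {measure set (n.-tuple T) -> \bar R}) :
  (m1 setT < +oo)%E ->
  (forall B, (forall i, measurable (B i)) -> m1 (tuple_box B) = m2 (tuple_box B)) ->
  forall A, measurable A -> m1 A = m2 A.
Proof.
move=> fin m12 A mA.
pose G : set (set (n.-tuple T)) :=
  [set X | exists2 B, (forall i, measurable (B i)) & X = tuple_box B].
have GT : G setT.
  by exists (fun=> setT) => //; apply/seteqP; split.
apply: (measure_unique G (fun=> setT)) => //.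
- rewrite eqEsubset; split; last first.
    by apply: smallest_sub; [exact: sigma_algebra_measurable|move=> X [B mB ->]; exact: measurable_box].
  apply: smallest_sub; first exact: smallest_sigma_algebra.
  move=> X; rewrite -bigcup_seq => -[i /= _ [B mB <-]]; rewrite setTI.
  apply: sub_sigma_algebra.
  exists (fun j => if j == i then B else setT); first by move=> j; case: ifP.
  apply/seteqP; split => t /=; first by move=> Bt j; case: ifPn => // /eqP ->.
  by move=> /(_ i); rewrite eqxx.
- move=> X Y [B mB ->] [C mC ->]; exists (fun i => B i `&` C i).
    by move=> i; exact: measurableI.
  apply/seteqP; split => t /=; first by move=> [h k] i; split.
  by move=> h; split=> i; have [] := h i.
- by rewrite bigcup_const//; exists 0%N.
- by move=> X [B mB ->]; exact: m12.
Qed.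

End tuple_measures.
Arguments measurable_tupd {d} T {n} i.

Section resampling.
Local Open Scope ereal_scope.
Context (R : realType) (d : measure_display) (T : measurableType d) (n : nat).
Variables (M : probability (n.-tuple T) R) (m : 'I_n -> probability T R).
Hypothesis M_box : forall B, (forall i, measurable (B i)) ->
  M (tuple_box B) = \prod_(i < n) m i (B i).

(** Fubini for one coordinate without splitting the tuple: an independent copy is appended and
    overwrites coordinate [i]. On a box the old factor becomes [setT] and the copy contributes
    [m i (B i)]. *)
Lemma resample_measure i A : measurable A ->
  M A = (M \x m i) [set p | A (tupd p.1 i p.2)].
Proof.
move=> mA.
pose M' := pushforward (M \x m i) (fun p : n.-tuple T * T => tupd p.1 i p.2).
pose mf := measurable_tupd T i.
pose f : {mfun (n.-tuple T * T)%type >-> n.-tuple T} :=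
  HB.pack (fun p : n.-tuple T * T => tupd p.1 i p.2)
    (isMeasurableFun.Build _ _ _ _ _ mf).
apply: (tuple_measure_unique (m2 := pushforward (M \x m i) f)) => //.
  by rewrite /= probability_setT ltry.
move=> B mB; transitivity (\prod_(j < n) m j (B j)); first exact: M_box.
rewrite -[RHS]/((M \x m i) ((fun p => tupd p.1 i p.2) @^-1` tuple_box B)).
rewrite (_ : _ @^-1` _ = tuple_box (fun j => if j == i then setT else B j) `*` B i); last first.
  apply/seteqP; split => -[z x] /=.
    move=> h; split; last by have := h i; rewrite tnth_tupd eqxx.
    by move=> j; case: ifPn => // ji; have := h j; rewrite tnth_tupd (negbTE ji).
  by move=> [h1 h2] j; rewrite tnth_tupd; case: ifPn => [/eqP ->//|ji]; have := h1 j; rewrite (negbTE ji).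
have mB' j : measurable (if j == i then setT else B j) by case: ifP.
have mbox := measurable_box mB'.
transitivity (M (tuple_box (fun j => if j == i then setT else B j)) * m i (B i)); last first.
  by apply/esym; exact: product_measure1E.
rewrite M_box// (bigD1 i)//= [in RHS](bigD1 i)//= eqxx probability_setT mul1e.
rewrite muleC; congr (_ * _).
by apply: eq_bigr => j ji; rewrite (negbTE ji).
Qed.

Lemma resample_integral i (f : n.-tuple T -> \bar R) :
  measurable_fun [set: n.-tuple T] f -> (forall z, 0 <= f z) ->
  \int[M]_z f z = \int[M]_z \int[m i]_x f (tupd z i x).
Proof.
move=> mf f0; pose mu := measurable_tupd T i.
rewrite -(fubini_tonelli1 (m1 := M) (m2 := m i) (fun p => f (tupd p.1 i p.2)))//=; last first.
  exact: measurableT_comp.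
transitivity (\int[pushforward (M \x m i) (fun p => tupd p.1 i p.2)]_z f z); last first.
  by rewrite (ge0_integral_pushforward mu).
pose g : {mfun (n.-tuple T * T)%type >-> n.-tuple T} :=
  HB.pack (fun p : n.-tuple T * T => tupd p.1 i p.2)
    (isMeasurableFun.Build _ _ _ _ _ mu).
apply: (eq_measure_integral (pushforward (M \x m i) g)) => A mA _.
exact: resample_measure.
Qed.

Lemma resampleE i A : measurable A ->
  M A = \int[M]_z m i [set x | A (tupd z i x)].
Proof.
move=> mA; rewrite (resample_measure i mA) /product_measure1 /=.
by apply: eq_integral => z _ /=; congr (m i _); apply/seteqP; split => x;
  rewrite /xsection /= inE.
Qed.

Lemma measurable_slice (z : n.-tuple T) i A : measurable A -> measurable [set x | A (tupd z i x)].
Proof.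
by move=> mA; rewrite -[X in measurable X]setTI; exact: measurable_tupd1.
Qed.

Lemma measurable_slice2 (z : n.-tuple T) i j A : measurable A ->
  measurable [set p : T * T | A (tupd (tupd z i p.1) j p.2)].
Proof.
move=> mA; have mf : measurable_fun [set: T * T] (fun p => tupd (tupd z i p.1) j p.2).
  apply: (measurableT_comp (measurable_tupd T j) (g := fun p : T * T => (tupd z i p.1, p.2))).
  apply/measurable_fun_pairP; split; last exact: measurable_snd.
  by apply: (measurableT_comp (measurable_tupd1 z i)); exact: measurable_fst.
by have := mf measurableT _ mA; rewrite setTI.
Qed.

Lemma measurable_slice_fun (k : probability T R) i A : measurable A ->
  measurable_fun [set: n.-tuple T] (fun z => k [set x | A (tupd z i x)]).
Proof.
move=> mA; have mC : measurable [set p : n.-tuple T * T | A (tupd p.1 i p.2)].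
  by have := measurable_tupd T i measurableT _ mA; rewrite setTI.
have := measurable_fun_xsection k mC.
apply: eq_measurable_fun => z _ /=; congr (k _); apply/seteqP; split => x;
  by rewrite /xsection /= inE.
Qed.

Lemma le_integral_indic (Q B : set (n.-tuple T)) (h : n.-tuple T -> \bar R) (eta : R) :
  (0 <= eta)%R -> measurable Q -> measurable B -> M (~` Q) = 0 ->
  measurable_fun [set: n.-tuple T] h -> (forall z, 0 <= h z) ->
  (forall z, Q z -> h z <= (eta * \1_B z)%:E) ->
  \int[M]_z h z <= eta%:E * M B.
Proof.
move=> eta0 mQ mB Q0 mh h0 hQ.
apply: (@le_trans _ _ (\int[M]_z (eta%:E * (\1_B z)%:E))); last first.
  rewrite ge0_integralZl//; last exact/measurable_EFinP/measurable_indic.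
  by rewrite integral_indic// setIT.
apply: ae_ge0_le_integral => //.
- by move=> z _; rewrite -EFinM lee_fin mulr_ge0.
- by apply: measurable_funeM; exact/measurable_EFinP/measurable_indic.
- exists (~` Q); split => //; first exact: measurableC.
  move=> z /= /not_implyP[_ nle] Qz; apply: nle; rewrite -EFinM; exact: hQ.
Qed.

(** [B] keeps what [A] says about the coordinates other than [i], so it can be sliced in turn and
    the bounds multiply. [Q] is an almost sure event; typically it says that the points held fixed
    lie in the cube. *)
Lemma slice_le i (Q A B : set (n.-tuple T)) (eta : R) :
  (0 <= eta)%R -> measurable Q -> measurable A -> measurable B -> M (~` Q) = 0 ->
  (forall z x, A (tupd z i x) -> B z) ->
  (forall z, Q z -> B z -> m i [set x | A (tupd z i x)] <= eta%:E) ->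
  M A <= eta%:E * M B.
Proof.
move=> eta0 mQ mA mB Q0 AB le; rewrite (resampleE i mA).
apply: (le_integral_indic (Q := Q)) => //.
  exact: measurable_slice_fun.
move=> z Qz; rewrite indicE; case: (boolP (z \in B)); rewrite (inE, notin_setE) => Bz.
  by rewrite mulr1; exact: le.
rewrite mulr0 (_ : [set x | _] = set0) ?measure0//.
by rewrite -subset0 => x /AB.
Qed.

End resampling.

Section uniform_measures.
Context (R : realType).

(** Restricted to the unit interval, Lebesgue measure is a probability, so the resampling lemmas
    apply also to the single coordinates of one uniform point. *)
Definition unif : set (measurableTypeR R) -> \bar R :=
  mrestr (@lebesgue_measure R) (measurable_itv `[0, 1]).

HB.instance Definition _ := Measure.on unif.

Let unif_setT : unif setT = 1%:E.
Proof.
by rewrite /unif /mrestr setTI lebesgue_measure_itv /= lte_fin ltr01 -EFinB subr0.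
Qed.

HB.instance Definition _ := Measure_isProbability.Build _ _ _ unif unif_setT.

Lemma unif_le A : measurable A -> (unif A <= lebesgue_measure A)%E.
Proof. by move=> mA; rewrite /unif /mrestr le_measure ?inE//; exact: measurableI. Qed.

Context (d : nat).

Lemma unit_cubeE : @unit_cube R d = tuple_box (fun=> (`[(0 : R), 1]%classic : set (measurableTypeR R))).
Proof. by apply/seteqP; split => x h k; have := h k; rewrite /= in_itv. Qed.

Lemma measurable_unit_cube : measurable (@unit_cube R d).
Proof. by rewrite unit_cubeE; apply: measurable_box => i; exact: measurable_itv. Qed.

Definition unif_cube : set (Rpoint R d) -> \bar R :=
  mrestr (@lebesgue_tuple R d) measurable_unit_cube.

HB.instance Definition _ := Measure.on unif_cube.

Lemma unif_cube_box (B : 'I_d -> set (measurableTypeR R)) :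
  (forall i, measurable (B i)) ->
  unif_cube (tuple_box B) = (\prod_(i < d) unif (B i))%E.
Proof.
move=> mB; rewrite /unif_cube /mrestr unit_cubeE.
rewrite (_ : _ `&` _ = [set t | forall i, (B i `&` `[0, 1]%classic) (tnth t i)]).
  apply: (lebesgue_tuple_box (B := fun i => B i `&` `[(0 : R), 1]%classic)) => i.
  by apply: measurableI => //; exact: measurable_itv.
apply/seteqP; split => t /=; first by move=> [h k] i; split; [exact: h|exact: k].
by move=> h; split=> i; have [] := h i.
Qed.

Let unif_cube_setT : unif_cube setT = 1%:E.
Proof.
rewrite (_ : setT = tuple_box (fun=> setT)); last by apply/seteqP; split.
rewrite unif_cube_box// big1// => i _; exact: probability_setT.
Qed.

HB.instance Definition _ := Measure_isProbability.Build _ _ _ unif_cube unif_cube_setT.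

Lemma unif_cubeC : unif_cube (~` @unit_cube R d) = 0%E.
Proof. by rewrite /unif_cube /mrestr setICl measure0. Qed.

End uniform_measures.

Section domination.
Local Open Scope ereal_scope.
Context (R : realType) (d : measure_display) (T : measurableType d).
Variables (lam : probability T R) (phi : R).
Hypothesis phi_ge0 : (0 <= phi)%R.

Lemma dominated_integral (m : probability T R) (f : T -> \bar R) :
  (forall A, measurable A -> m A <= phi%:E * lam A) ->
  measurable_fun [set: T] f -> (forall x, 0 <= f x) ->
  \int[m]_x f x <= phi%:E * \int[lam]_x f x.
Proof.
move=> dom mf f0; rewrite -(ge0_integral_mscale lam measurableT (NngNum phi_ge0))//.
by apply: ge0_le_measure_integral => // S mS; rewrite /mscale /=; exact: dom.
Qed.

Lemma dominated_product (m1 m2 : probability T R) S :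
  (forall A, measurable A -> m1 A <= phi%:E * lam A) ->
  (forall A, measurable A -> m2 A <= phi%:E * lam A) ->
  measurable S -> (m1 \x m2) S <= (phi ^+ 2)%:E * (lam \x lam) S.
Proof.
move=> d1 d2 mS; rewrite /product_measure1 /=.
have mlam : measurable_fun [set: T] (lam \o xsection S) by exact: measurable_fun_xsection.
apply: (@le_trans _ _ (\int[m1]_x (phi%:E * lam (xsection S x)))).
  apply: ge0_le_integral => //.
  - exact: measurable_fun_xsection.
  - exact: measurable_funeM.
  - by move=> x _; apply: d2; exact: measurable_xsection.
rewrite ge0_integralZl// expr2 EFinM -muleA; apply: lee_pmul => //.
  by rewrite integral_ge0.
exact: dominated_integral.
Qed.

Context (n : nat).
Variables (M : probability (n.-tuple T) R) (m : 'I_n -> probability T R).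
Hypothesis M_box : forall B, (forall i, measurable (B i)) ->
  M (tuple_box B) = \prod_(i < n) m i (B i).
Hypothesis dom : forall i A, measurable A -> m i A <= phi%:E * lam A.

Lemma slice1_le i (Q A B : set (n.-tuple T)) (eta : R) :
  (0 <= eta)%R -> measurable Q -> measurable A -> measurable B -> M (~` Q) = 0 ->
  (forall z x, A (tupd z i x) -> B z) ->
  (forall z, Q z -> B z -> lam [set x | A (tupd z i x)] <= eta%:E) ->
  M A <= (phi * eta)%:E * M B.
Proof.
move=> eta0 mQ mA mB Q0 AB le; apply: (slice_le (i := i) M_box _ mQ) => //.
  by rewrite mulr_ge0.
move=> z Qz Bz; apply: (le_trans (dom _ _)); first exact: measurable_slice.
by rewrite EFinM lee_wpmul2l ?lee_fin//; exact: le.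
Qed.

(** Redrawing two points together is needed where the bound comes from averaging over one point the
    slice bound for the other, as in [edge_le] and [diagonal_le]. *)
Lemma slice2_le i j (Q A B : set (n.-tuple T)) (eta : R) :
  (0 <= eta)%R -> measurable Q -> measurable A -> measurable B -> M (~` Q) = 0 ->
  (forall z x y, A (tupd (tupd z i x) j y) -> B z) ->
  (forall z, Q z -> B z ->
    (lam \x lam) [set p | A (tupd (tupd z i p.1) j p.2)] <= eta%:E) ->
  M A <= (phi ^+ 2 * eta)%:E * M B.
Proof.
move=> eta0 mQ mA mB Q0 AB le; rewrite (resampleE M_box j mA).
have mh := measurable_slice_fun (m j) j mA.
rewrite (resample_integral M_box i)//=.
have mslice z := measurable_slice2 z i j mA.
apply: (le_integral_indic (Q := Q)) => //.
- by rewrite mulr_ge0// exprn_ge0.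
- apply: (measurable_fun_fubini_tonelli_F (fun p => m j [set y | A (tupd (tupd p.1 i p.2) j y)])) => //.
  exact: (measurableT_comp mh (measurable_tupd T i)).
- by move=> z; rewrite integral_ge0.
move=> z Qz; rewrite indicE; case: (boolP (z \in B)); rewrite (inE, notin_setE) => Bz; last first.
  rewrite mulr0 integral0_eq// => x _.
  by rewrite (_ : [set y | _] = set0) ?measure0// -subset0 => y /AB.
rewrite mulr1 EFinM; apply: (@le_trans _ _ ((phi ^+ 2)%:E * (lam \x lam) [set p | A (tupd (tupd z i p.1) j p.2)])); last first.
  by rewrite lee_wpmul2l ?lee_fin ?exprn_ge0//; exact: le.
apply: le_trans (dominated_product (dom i) (dom j) (mslice z)).
rewrite /product_measure1 /= le_eqVlt; apply/orP; left; apply/eqP.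
apply: eq_integral => x _ /=; congr (m j _); apply/seteqP; split => y;
  by rewrite /xsection /= inE.
Qed.

End domination.

Section law.
Local Open Scope ereal_scope.
Context (R : realType) (d n : nat) (phi : R) (dOm : measure_display)
  (Om : measurableType dOm) (P : probability Om R) (X : 'I_n -> Om -> Rpoint R d).
Hypothesis pX : perturbed_instance phi P X.

Definition config w : n.-tuple (Rpoint R d) := [tuple X i w | i < n].

Lemma measurable_config : measurable_fun setT config.
Proof.
apply/measurable_fun_tnthP => i; rewrite (_ : _ \o _ = X i).
  exact: perturbed_measurable pX i.
by apply/funext => w /=; rewrite tnth_mktuple.
Qed.

(** Reduces the instance to a law on configurations: independence becomes the product formula on
    boxes, and a density bounded by [phi] becomes domination by [phi] times the uniform law. *)
Lemma perturbed_law : exists (M : probability (n.-tuple (Rpoint R d)) R)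
    (m : 'I_n -> probability (Rpoint R d) R),
  [/\ forall A, M A = P (config @^-1` A),
      forall B, (forall i, measurable (B i)) ->
        M (tuple_box B) = \prod_(i < n) m i (B i),
      forall i A, measurable A -> m i A <= phi%:E * unif_cube A &
      forall i, m i (~` @unit_cube R d) = 0].
Proof.
pose c : {mfun Om >-> n.-tuple (Rpoint R d)} :=
  HB.pack config (isMeasurableFun.Build _ _ _ _ _ measurable_config).
pose x i : {mfun Om >-> Rpoint R d} :=
  HB.pack (X i) (isMeasurableFun.Build _ _ _ _ _ (perturbed_measurable pX i)).
exists (distribution P c), (fun i => distribution P (x i)); split => //.
- move=> B mB; transitivity (P (config @^-1` tuple_box B)) => //.
  have := perturbed_independent pX [set: 'I_n]%SET mB.
  under [in X in _ = X -> _]eq_bigl do rewrite inE.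
  move=> <-; congr (P _); apply/seteqP; split => w /=.
    by move=> h i _; have := h i; rewrite tnth_mktuple.
  by move=> h i; rewrite tnth_mktuple; apply: h; rewrite /= inE.
- move=> i A mA; have [f [mf fphi fE]] := perturbed_density pX i.
  rewrite [leLHS](fE _ mA) /unif_cube /mrestr.
  have mAC := measurableI _ _ mA (@measurable_unit_cube R d).
  rewrite -integral_cst//; apply: ge0_le_integral => //.
  - by move=> z [_ /fphi /andP[]]; rewrite lee_fin.
  - by apply/measurable_EFinP; apply: measurable_funS mf; first exact: measurable_unit_cube.
  - by move=> z [_ /fphi /andP[? ?]]; rewrite lee_fin (le_trans _ (y := f z)).
- move=> i; have [f [mf fphi fE]] := perturbed_density pX i.
  rewrite [LHS](fE _ (measurableC (@measurable_unit_cube R d))).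
  by rewrite setICl integral_set0.
Qed.

Lemma config_cube_ae (M : probability (n.-tuple (Rpoint R d)) R)
    (m : 'I_n -> probability (Rpoint R d) R) :
  (forall B, (forall i, measurable (B i)) ->
        M (tuple_box B) = \prod_(i < n) m i (B i)) ->
  (forall i, m i (~` @unit_cube R d) = 0) ->
  M (~` (tuple_box (fun=> @unit_cube R d))) = 0.
Proof.
move=> M_box m0; have mC := @measurable_unit_cube R d.
rewrite probability_setC; last exact: measurable_box.
rewrite M_box// big1 ?subee// => i _.
by rewrite -[X in m i X]setCK probability_setC ?m0 ?sube0//; exact: measurableC.
Qed.

End law.

(** * Slices of the unit cube *)

Section line.
Context (R : realType).
Local Notation rl := (measurableTypeR R).
Local Notation leb := (@lebesgue_measure R).

Lemma lebesgue_translate (c : R) (A : set rl) : measurable A ->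
  leb [set t | A (t + c)] = leb A.
Proof.
move=> mA.
have mf : measurable_fun [set: rl] (fun t : rl => t + c : rl).
  by apply: measurable_funD => //; exact: measurable_id.
pose f : {mfun rl >-> rl} := HB.pack (fun t : rl => t + c : rl)
  (isMeasurableFun.Build _ _ _ _ _ mf).
apply/esym; apply: (@lebesgue_measure_unique R (pushforward leb f)) => // X.
case=> -[a b] _ <-.
rewrite -[RHS]/(leb ((fun t => t + c) @^-1` `]a, b]%classic)).
rewrite (_ : _ @^-1` _ = `]a - c, b - c]%classic); last first.
  by apply/seteqP; split => t /=; rewrite !in_itv /= ltrBlDr lerBrDr.
rewrite !lebesgue_measure_itv /= !lte_fin ltrD2r; case: ifP => // _.
by rewrite -!EFinB; congr (_%:E); ring.
Qed.

Lemma lebesgue_ball_le (c eta : R) : 0 <= eta ->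
  (leb `[(c - eta)%R, (c + eta)%R]%classic <= (2 * eta)%:E)%E.
Proof.
move=> eta0; rewrite lebesgue_measure_itv /= lte_fin; case: ifP => _.
  by rewrite -EFinB lee_fin; lra.
by rewrite lee_fin mulr_ge0.
Qed.

Lemma lebesgue_diam_le (S : set rl) (eta : R) : measurable S ->
  0 <= eta -> (forall s s', S s -> S s' -> `|s - s'| <= eta) ->
  (leb S <= (2 * eta)%:E)%E.
Proof.
move=> mS eta0 diam; have [->|/set0P[s0 Ss0]] := eqVneq S set0.
  by rewrite measure0 lee_fin mulr_ge0.
apply: (@le_trans _ _ (leb `[s0 - eta, s0 + eta]%classic)).
  apply: le_measure; rewrite ?inE//.
  by move=> s Ss /=; rewrite in_itv /=; have := diam _ _ Ss Ss0; rewrite ler_norml; lra.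
exact: lebesgue_ball_le.
Qed.

(** In [annulus_strip_le0] the two classes of [b] are the signs of a derivative: a quadratic
    function comes close to a given value in at most two places. *)
Lemma lebesgue_two_diam_le (S : set rl) (b : rl -> bool) (eta : R) : measurable S ->
  0 <= eta -> (forall s s', S s -> S s' -> b s = b s' -> `|s - s'| <= eta) ->
  (leb S <= (4 * eta)%:E)%E.
Proof.
move=> mS eta0 diam.
have cover c : exists2 B : set rl, measurable B /\ (leb B <= (2 * eta)%:E)%E &
    forall s, S s -> b s = c -> B s.
  have [[s0 [Ss0 bs0]]|no] := pselect (exists s0, S s0 /\ b s0 = c).
    exists `[s0 - eta, s0 + eta]%classic.
      by split; [exact: measurable_itv|exact: lebesgue_ball_le].
    move=> s Ss bs /=; have := diam s s0 Ss Ss0; rewrite bs bs0 => /(_ erefl).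
    by rewrite in_itv /= ler_norml; lra.
  exists set0; first by split => //; rewrite measure0 lee_fin mulr_ge0.
  by move=> s Ss bs; apply: no; exists s.
have [B [mB Bl] SB] := cover true; have [C [mC Cl] SC] := cover false.
apply: (@le_trans _ _ (leb (B `|` C))).
  apply: le_measure; rewrite ?inE//; first exact: measurableU.
  by move=> s Ss; case E : (b s); [left; exact: SB|right; exact: SC].
apply: (le_trans (measureU2 _ mB mC)); apply: (le_trans (leeD Bl Cl)).
by rewrite -EFinD lee_fin; lra.
Qed.

Lemma unif_diam_le (S : set rl) (eta : R) : measurable S ->
  0 <= eta -> (forall s s', S s -> S s' -> `|s - s'| <= eta) ->
  (unif S <= (2 * eta)%:E)%E.
Proof. by move=> mS e0 h; apply: (le_trans (unif_le mS)); exact: lebesgue_diam_le. Qed.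

(** The shear [(s, t) -> (s, t + mu * s)] preserves Lebesgue measure. Afterwards the second
    coordinate is confined to an interval of length [2 * eta], and each horizontal slice has measure
    at most [kappa]. Lebesgue measure replaces the uniform one because the sheared set may leave the
    unit square. *)
Lemma unif_shear_le (S : set (rl * rl)) (mu eta kappa : R) : measurable S ->
  0 <= eta -> 0 <= kappa ->
  (forall p p', S p -> S p' -> `|(p.2 + mu * p.1) - (p'.2 + mu * p'.1)| <= eta) ->
  (forall t : R, (leb [set s | S (s, (t - mu * s)%R)] <= kappa%:E)%E) ->
  ((@unif R \x @unif R)%E S <= (2 * eta * kappa)%:E)%E.
Proof.
move=> mS eta0 kappa0 diam slice.
pose S' : set (rl * rl) := [set p | S (p.1, p.2 - mu * p.1)].
have mS' : measurable S'.
  have mf : measurable_fun [set: rl * rl]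
      (fun p => (p.1, p.2 - mu * p.1) : rl * rl).
    apply/measurable_fun_pairP; split; first exact: measurable_fst.
    apply: measurable_funB; first exact: measurable_snd.
    by apply: measurable_funM => //; exact: measurable_fst.
  by have := mf measurableT _ mS; rewrite setTI.
have xs x : leb (xsection S x) = leb (xsection S' x).
  rewrite -[RHS](lebesgue_translate (mu * x)); last exact: measurable_xsection.
  congr (leb _); apply/seteqP; split => t; rewrite /xsection /S' /= !inE /= addrK//.
apply: (@le_trans _ _ ((leb \x leb)%E S')).
  rewrite /product_measure1 /=.
  apply: (@le_trans _ _ (\int[@unif R]_x leb (xsection S x))%E).
    apply: ge0_le_integral => //.
    - exact: measurable_fun_xsection.
    - exact: measurable_fun_xsection.
    - by move=> x _; apply: unif_le; exact: measurable_xsection.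
  under [leRHS]eq_integral do rewrite -xs.
  apply: ge0_le_measure_integral => //.
    by move=> A mA; exact: unif_le.
  exact: measurable_fun_xsection.
(* The order of integration is exchanged: the shear acts on slices at fixed [s], the hypothesis
   [slice] concerns those at fixed [t]. *)
rewrite (product_measure_unique (m' := (leb \x^ leb)%E))//; last first.
  by move=> A B mA mB; exact: product_measure2E.
have [->|/set0P[[s0 t0] St0]] := eqVneq S' set0.
  by rewrite measure0 lee_fin !mulr_ge0.
pose I : set rl := `[t0 - eta, t0 + eta]%classic.
have mI : measurable I by exact: measurable_itv.
rewrite -[leLHS]/(\int[leb]_y leb (ysection S' y))%E.
apply: (@le_trans _ _ (\int[leb]_y (kappa%:E * (\1_I y)%:E))%E).
  apply: ge0_le_integral => //.
  - exact: measurable_fun_ysection.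
  - by apply: measurable_funeM; exact/measurable_EFinP/measurable_indic.
  - move=> y _; rewrite /= -EFinM indicE; case: (boolP (y \in I)) => yI.
      rewrite mulr1; apply: le_trans (slice y); rewrite le_measure ?inE//=.
      + exact: measurable_ysection.
      + have -> : [set s | S (s, y - mu * s)] = ysection S' y.
          by apply/seteqP; split => s; rewrite /ysection /= inE.
        exact: measurable_ysection.
      + by move=> s; rewrite /ysection /= inE.
    rewrite mulr0 (_ : ysection S' y = set0) ?measure0// -subset0 => s.
    rewrite /ysection /= inE => S's; move: yI => /negP; apply.
    have := diam _ _ S's St0; rewrite /= !subrK ler_norml inE /I /= in_itv /=; lra.
rewrite ge0_integralZl//; last exact/measurable_EFinP/measurable_indic.
rewrite integral_indic// setIT mulrC EFinM lee_wpmul2l ?lee_fin//.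
exact: lebesgue_ball_le.
Qed.

End line.

Section cube_slices.
Context (R : realType) (d : nat).
Local Notation lam := (@unif_cube R d).
Local Notation cube := (@unit_cube R d).
Implicit Types A B : set (Rpoint R d).

Lemma cube_slice1 (k : 'I_d) A B (eta : R) : 0 <= eta ->
  measurable A -> measurable B -> (forall z x, A (tupd z k x) -> B z) ->
  (forall z, cube z -> B z -> (unif [set t | A (tupd z k t)] <= eta%:E)%E) ->
  (lam A <= eta%:E * lam B)%E.
Proof.
move=> eta0 mA mB AB le.
apply: (slice_le (i := k) (m := fun=> @unif R) (@unif_cube_box R d) _
  (@measurable_unit_cube R d)) => //.
exact: unif_cubeC.
Qed.

Lemma cube_slice2 (k l : 'I_d) A (eta : R) : 0 <= eta -> measurable A ->
  (forall z, cube z ->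
    ((@unif R \x @unif R)%E [set p | A (tupd (tupd z k p.1) l p.2)] <= eta%:E)%E) ->
  (lam A <= eta%:E)%E.
Proof.
move=> eta0 mA le.
have := @slice2_le R _ _ (@unif R) 1 ler01 _ lam (fun=> @unif R)
  (@unif_cube_box R d) _ k l cube A setT eta eta0 (@measurable_unit_cube R d) mA
  measurableT (@unif_cubeC R d).
rewrite expr1n mul1r probability_setT mule1; apply => //.
  by move=> _ B mB; rewrite mul1e.
by move=> z cz _; exact: le.
Qed.

Lemma unif_cube_diam (k : 'I_d) A (eta : R) : 0 <= eta -> measurable A ->
  (forall z s s', A (tupd z k s) -> A (tupd z k s') -> `|s - s'| <= eta) ->
  (lam A <= (2 * eta)%:E)%E.
Proof.
move=> eta0 mA diam; have e20 : 0 <= 2 * eta by rewrite mulr_ge0.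
have := @cube_slice1 k A setT (2 * eta) e20 mA measurableT.
rewrite probability_setT mule1; apply => // z _ _.
by apply: unif_diam_le => //; [exact: measurable_slice|exact: diam].
Qed.

End cube_slices.

Section finite_unions.
Context (R : realType) (d : measure_display) (T : measurableType d).
Variable m : {measure set T -> \bar R}.

Lemma measure_fin_union_le (I : finType) (A : I -> set T) (S : set T) :
  measurable S -> (forall i, measurable (A i)) ->
  (forall x, S x -> exists i, A i x) -> (m S <= \sum_i m (A i))%E.
Proof.
move=> mS mA SA.
suff h (r : seq I) S' : measurable S' -> (forall x, S' x -> exists2 i, i \in r & A i x) ->
    (m S' <= \sum_(i <- r) m (A i))%E.
  by apply: h => // x /SA[i Ax]; exists i => //; rewrite mem_index_enum.
elim: r S' => [|i r IH] S' mS' h.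
  rewrite big_nil (_ : S' = set0) ?measure0// -subset0 => x /h[i].
  by rewrite in_nil.
rewrite big_cons (le_trans _ (y := m (A i `|` (S' `\` A i)))%E)//.
  apply: le_measure; rewrite ?inE//; first by apply: measurableU => //; exact: measurableD.
  by move=> x S'x; case: (pselect (A i x)) => ?; [left|right].
apply: (le_trans (measureU2 _ (mA i) (measurableD mS' (mA i)))).
rewrite leeD2l//; apply: IH; first exact: measurableD.
move=> x [/h[j]]; rewrite in_cons => /orP[/eqP ->//|jr] Aj _.
by exists j.
Qed.

Lemma measure_fin_union_le_cst (I : finType) (A : I -> set T) (S : set T) (c : R) :
  measurable S -> (forall i, measurable (A i)) ->
  (forall x, S x -> exists i, A i x) -> (forall i, (m (A i) <= c%:E)%E) ->
  (m S <= (#|I|%:R * c)%:E)%E.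
Proof.
move=> mS mA SA Ac; apply: (le_trans (measure_fin_union_le mS mA SA)).
apply: (@le_trans _ _ (\sum_(i : I) c%:E)%E); first exact: lee_sum.
by rewrite sumEFin sumr_const mulr_natl.
Qed.

Lemma measurable_le_set (f g : T -> R) : measurable_fun [set: T] f ->
  measurable_fun [set: T] g -> measurable [set x | f x <= g x].
Proof.
move=> mf mg; rewrite -[X in measurable X]setTI; exact: measurable_fun_le.
Qed.

Lemma measurable_lt_set (f g : T -> R) : measurable_fun [set: T] f ->
  measurable_fun [set: T] g -> measurable [set x | f x < g x].
Proof.
move=> mf mg; rewrite (_ : mkset _ = ~` [set x | g x <= f x]).
  by apply: measurableC; exact: measurable_le_set.
by apply/seteqP; split => x /=; rewrite ltNge => /negP.
Qed.

End finite_unions.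

(** * Triangles, annuli and hyperbolas *)

Section points.
Context (R : realType) (d : nat).
Local Notation pt := (Rpoint R d).
Implicit Types (p q x y : pt) (k l : 'I_d).

Definition crd x k : R := tnth x k.

Lemma crd_tupd x k (t : R) l : crd (tupd x k t) l = if l == k then t else crd x l.
Proof. by rewrite /crd tnth_tupd. Qed.

(** The 2x2 minors of the vectors [x - q] and [p - q]. One large minor singles out two coordinates
    in which slicing works. *)
Definition wedge x p q k l : R :=
  (crd x k - crd q k) * (crd p l - crd q l) - (crd x l - crd q l) * (crd p k - crd q k).

(* Up to a factor depending on d, twice the area of the triangle x, p, q. *)
Definition area x p q : R := \sum_k \sum_l `|wedge x p q k l|.

Lemma area_swap x p q : area x p q = area p x q.
Proof.
apply: eq_bigr => k _; apply: eq_bigr => l _; rewrite -normrN; congr (`|_|).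
by rewrite /wedge; ring.
Qed.

Lemma area_rot x p q : area x p q = area p q x.
Proof.
apply: eq_bigr => k _; apply: eq_bigr => l _; congr (`|_|).
by rewrite /wedge; ring.
Qed.

Lemma wedge_le_area x p q k l : `|wedge x p q k l| <= area x p q.
Proof.
rewrite /area (bigD1 k)//= (bigD1 l)//= -addrA lerDl addr_ge0 ?sumr_ge0// => j _.
by rewrite sumr_ge0.
Qed.

Lemma manhattanE p q : manhattan p q = \sum_k `|crd p k - crd q k|.
Proof. by []. Qed.

Lemma manhattan_sym p q : manhattan p q = manhattan q p.
Proof. by apply: eq_bigr => k _; rewrite distrC. Qed.

Lemma manhattan_ge0 p q : 0 <= manhattan p q.
Proof. by rewrite sumr_ge0. Qed.

Lemma euclidean_sym p q : euclidean p q = euclidean q p.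
Proof.
by congr Num.sqrt; apply: eq_bigr => k _; rewrite -sqrrN opprB.
Qed.

Lemma euclidean_ge0 p q : 0 <= euclidean p q.
Proof. exact: sqrtr_ge0. Qed.

Lemma sqr_euclidean p q : euclidean p q ^+ 2 = \sum_k (crd p k - crd q k) ^+ 2.
Proof. by rewrite sqr_sqrtr// sumr_ge0// => k _; rewrite sqr_ge0. Qed.

Lemma crd_le_euclidean p q k : `|crd p k - crd q k| <= euclidean p q.
Proof.
rewrite -(ler_pXn2r (n := 2))// ?nnegrE ?euclidean_ge0// sqr_euclidean.
rewrite real_normK ?num_real// (bigD1 k)//= lerDl sumr_ge0// => j _.
by rewrite sqr_ge0.
Qed.

Lemma euclidean_le_manhattan p q : euclidean p q <= manhattan p q.
Proof.
rewrite -(ler_pXn2r (n := 2))// ?nnegrE ?euclidean_ge0 ?manhattan_ge0//.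
rewrite sqr_euclidean expr2 {1}/manhattan mulr_suml ler_sum// => k _.
rewrite -[leLHS]real_normK ?num_real// expr2 ler_wpM2l//.
by rewrite /manhattan (bigD1 k)//= lerDl sumr_ge0.
Qed.

Lemma crd_cube p q k : unit_cube p -> unit_cube q -> `|crd p k - crd q k| <= 1.
Proof.
move=> /(_ k) /andP[p0 p1] /(_ k) /andP[q0 q1].
by rewrite ler_norml /crd; lra.
Qed.

Lemma manhattan_cube p q : unit_cube p -> unit_cube q -> manhattan p q <= d%:R.
Proof.
move=> cp cq; apply: (@le_trans _ _ (\sum_(k < d) 1)).
  by apply: ler_sum => k _; exact: crd_cube.
by rewrite sumr_const card_ord.
Qed.

Lemma euclidean_cube p q : unit_cube p -> unit_cube q -> euclidean p q <= d%:R.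
Proof. by move=> cp cq; rewrite (le_trans (euclidean_le_manhattan _ _))// manhattan_cube. Qed.

Lemma manhattan_attained p q : 0 < manhattan p q ->
  exists k, manhattan p q / d%:R <= `|crd p k - crd q k|.
Proof.
move=> r0; apply/not_existsP => h.
have : manhattan p q < manhattan p q; last by rewrite ltxx.
have d0 : (0 < d)%N.
  by move: r0; rewrite /manhattan; case: (d) p q {h} => [|//] p q; rewrite big_ord0 ltxx.
rewrite {1}manhattanE (@lt_le_trans _ _ (\sum_(k < d) manhattan p q / d%:R))//.
  apply: ltr_sum; first by apply/hasP; exists (Ordinal d0) => //; rewrite mem_index_enum.
  by move=> k _; rewrite ltNge; apply/negP; exact: h.
rewrite sumr_const card_ord -[_ *+ d]mulr_natr -mulrA mulVf ?mulr1//.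
by rewrite pnatr_eq0 -lt0n.
Qed.

Lemma area_attained x p q (c : R) : 0 < c -> c <= area x p q ->
  exists k l, c / (d%:R ^+ 2) <= `|wedge x p q k l|.
Proof.
move=> c0 ca; apply/not_existsP => h.
have h' k l : `|wedge x p q k l| < c / d%:R ^+ 2.
  by rewrite ltNge; apply/negP => ?; apply: (h k); exists l.
have d0 : (0 < d)%N.
  rewrite lt0n; apply/eqP => d0; have := lt_le_trans c0 ca.
  by rewrite /area big1 ?ltxx// => k; have := ltn_ord k; rewrite [X in (_ < X)%N]d0.
have : area x p q < c; last by rewrite ltNge ca.
have dn0 : d%:R != 0 :> R by rewrite pnatr_eq0 -lt0n.
have ho : has xpredT (index_enum 'I_d).
  by apply/hasP; exists (Ordinal d0) => //; rewrite mem_index_enum.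
apply: (@lt_le_trans _ _ (\sum_(k < d) \sum_(l < d) c / d%:R ^+ 2)).
  by apply: ltr_sum => // k _; apply: ltr_sum => // l _.
rewrite !sumr_const card_ord -mulrnA -[leLHS]mulr_natr natrM -expr2.
by rewrite divfK ?lexx// expf_neq0.
Qed.

Lemma sum_tupd2 (F : 'I_d -> R -> R) x k l (s t : R) : k != l ->
  \sum_j F j (crd (tupd (tupd x k s) l t) j) =
  F k s + (F l t + \sum_(j | (j != k) && (j != l)) F j (crd x j)).
Proof.
move=> kl; rewrite (bigD1 k)//= (bigD1 l)//=; last by rewrite eq_sym.
rewrite !crd_tupd !eqxx (negbTE kl); congr (_ + (_ + _)).
by apply: eq_bigr => j /andP[jk jl]; rewrite !crd_tupd (negbTE jk) (negbTE jl).
Qed.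

(* The triangle p, q, y is controlled by the triangles x, p, y and x, q, y that
   share the side x y: if both are flat then p and q are close to that line. *)
Lemma area_le p q x y : unit_cube p -> unit_cube q -> unit_cube x -> unit_cube y ->
  manhattan x y * area p q y <= d%:R * (area x p y + 2 * area x q y).
Proof.
move=> cp cq cx cy.
have key m k l : `|crd x m - crd y m| * `|wedge p q y k l| <=
    `|wedge x p y k l| + `|wedge x q y m l| + `|wedge x q y m k|.
  rewrite -normrM.
  (* Polynomial exchange identity. Its coefficients are coordinate differences of points of the
     cube, hence at most 1, and every wedge on the right contains [x]. *)
  have -> : (crd x m - crd y m) * wedge p q y k l =
    - (crd q m - crd y m) * wedge x p y k l + (crd p k - crd y k) * wedge x q y m l
    - (crd p l - crd y l) * wedge x q y m k by rewrite /wedge; ring.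
  have tr (u v w : R) : `|u + v - w| <= `|u| + `|v| + `|w|.
    by rewrite (le_trans (ler_normB _ _))// lerD2r ler_normD.
  apply: (le_trans (tr _ _ _)); rewrite !normrM normrN.
  by rewrite !lerD// ler_piMl// crd_cube.
rewrite manhattanE /area.
have -> : (\sum_k `|crd x k - crd y k|) * (\sum_k \sum_l `|wedge p q y k l|) =
    \sum_m \sum_k \sum_l `|crd x m - crd y m| * `|wedge p q y k l|.
  rewrite mulr_suml; apply: eq_bigr => m _; rewrite mulr_sumr.
  by apply: eq_bigr => k _; rewrite mulr_sumr.
apply: (le_trans (ler_sum _ (fun m _ => ler_sum _ (fun k _ => ler_sum _ (fun l _ => key m k l))))).
set S1 := \sum_k \sum_l `|wedge x p y k l|; set S2 := \sum_k \sum_l `|wedge x q y k l|.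
have -> : \sum_m \sum_k \sum_l (`|wedge x p y k l| + `|wedge x q y m l| + `|wedge x q y m k|)
    = d%:R * S1 + d%:R * S2 + d%:R * S2.
  transitivity (\sum_(m < d) (S1 + d%:R * \sum_l `|wedge x q y m l| + d%:R * \sum_k `|wedge x q y m k|)).
    apply: eq_bigr => m _; under eq_bigr do rewrite !big_split /=.
    rewrite !big_split /= sumr_const card_ord mulr_natl; congr (_ + _ + _).
    rewrite -sumrMnl; apply: eq_bigr => k _.
    by rewrite sumr_const card_ord.
  by rewrite !big_split /= -!mulr_sumr sumr_const card_ord mulr_natl.
by rewrite le_eqVlt; apply/orP; left; apply/eqP; ring.
Qed.

Lemma measurable_crd (k : 'I_d) dT (T : measurableType dT) (f : T -> pt) :
  measurable_fun [set: T] f -> measurable_fun [set: T] (fun w => crd (f w) k).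
Proof. by move=> mf; exact: (measurableT_comp (measurable_tnth k) mf). Qed.

Section measurability.
Context dT (T : measurableType dT) (f g h : T -> pt).
Hypotheses (mf : measurable_fun [set: T] f) (mg : measurable_fun [set: T] g)
  (mh : measurable_fun [set: T] h).

Lemma measurable_manhattan : measurable_fun [set: T] (fun w => manhattan (f w) (g w)).
Proof.
apply: measurable_sum => k; apply: (@measurableT_comp _ _ _ _ _ _ (@Num.norm R R)) => //.
by apply: measurable_funB; exact: measurable_crd.
Qed.

Lemma measurable_euclidean : measurable_fun [set: T] (fun w => euclidean (f w) (g w)).
Proof.
apply: (@measurableT_comp _ _ _ _ _ _ (@Num.sqrt R)).
  by apply: continuous_measurable_fun; exact: sqrt_continuous.
apply: measurable_sum => k; apply: measurable_funX.
by apply: measurable_funB; exact: measurable_crd.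
Qed.

Lemma measurable_wedge k l :
  measurable_fun [set: T] (fun w => wedge (f w) (g w) (h w) k l).
Proof.
by apply: measurable_funB; apply: measurable_funM; apply: measurable_funB;
  exact: measurable_crd.
Qed.

Lemma measurable_area : measurable_fun [set: T] (fun w => area (f w) (g w) (h w)).
Proof.
apply: measurable_sum => k; apply: measurable_sum => l.
apply: (@measurableT_comp _ _ _ _ _ _ (@Num.norm R R)) => //.
exact: measurable_wedge.
Qed.

End measurability.

End points.

Section hyperbola.
Context (R : realType) (d : nat).
Local Notation pt := (Rpoint R d).
Local Notation lam := (@unif_cube R d).
Local Notation rl := (measurableTypeR R).
Local Notation leb := (@lebesgue_measure R).
Implicit Types (p q x y : pt) (k l : 'I_d).

Lemma ler_norm_add_sign (u v o : R) : o <= `|u| -> o <= `|v| ->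
  (0 <= u) = (0 <= v) -> 2 * o <= `|u + v|.
Proof.
have [u0|u0] := leP 0 u; have [v0|v0] := leP 0 v => // ou ov _.
  by rewrite (ger0_norm u0) in ou; rewrite (ger0_norm v0) in ov; rewrite ger0_norm; lra.
by rewrite (ltr0_norm u0) in ou; rewrite (ltr0_norm v0) in ov; rewrite ltr0_norm; lra.
Qed.

(* In the coordinates (s, t) = (x_k, x_l), the set A lies in a strip of width
   eta along a line on which the squared distance to q is a quadratic function
   of s with derivative 2 * wedge / (p_l - q_l). *)
Lemma annulus_strip_le0 (A : set pt) p q k l (zeta eta om : R) :
  measurable A -> k != l -> 0 <= zeta -> 0 <= eta -> 0 < om ->
  crd p l - crd q l != 0 ->
  (forall x x', A x -> A x' ->
    `|\sum_j (crd x j - crd q j) ^+ 2 - \sum_j (crd x' j - crd q j) ^+ 2| <= zeta) ->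
  (forall x x', A x -> A x' ->
    `|\sum_j crd x j * (crd p j - crd q j) - \sum_j crd x' j * (crd p j - crd q j)| <= eta) ->
  (forall x, A x -> om <= `|wedge x p q k l|) ->
  (lam A <= (4 * zeta * eta / om)%:E)%E.
Proof.
move=> mA kl zeta0 eta0 om0 Q0 Hzeta Heta Hom.
set P := crd p k - crd q k; set Q := crd p l - crd q l in Q0 *.
have nQ0 : 0 < `|Q| by rewrite normr_gt0.
(* [c] bounds the spread of [s] on a line within one sign class of the wedge. The factor [|Q|]
   cancels against the strip width [eta / |Q|]. *)
pose c := zeta * `|Q| / (2 * om).
have c0 : 0 <= c by rewrite !mulr_ge0// invr_ge0 mulr_ge0// ltW.
have -> : 4 * zeta * eta / om = 2 * (eta / `|Q|) * (4 * c).
  rewrite /c; field; rewrite !gt_eqF//.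
apply: (cube_slice2 (k := k) (l := l)) => //.
  by apply: mulr_ge0; apply: mulr_ge0 => //; exact: divr_ge0.
move=> z _.
set S := [set _ | _].
have mS : measurable S by exact: measurable_slice2.
(* The lines [t + (P / Q) * s = const] are those on which the inner product with [p - q] is
   constant. *)
apply: (unif_shear_le (mu := P / Q)) => //.
- by rewrite mulr_ge0 ?invr_ge0.
- by rewrite mulr_ge0.
- move=> [s t] [s' t'] Sst Sst' /=.
  have := Heta _ _ Sst Sst'; rewrite /= !(sum_tupd2 (fun j u => u * (crd p j - crd q j)))//.
  rewrite -/P -/Q ler_pdivlMr// -normrM; congr (_ <= _); congr (`|_|).
  by field.
- move=> t; set S1 := [set s | _].
  have mS1 : measurable S1.
    have mf : measurable_fun [set: rl] (fun s : rl => (s, (t - P / Q * s)%R) : rl * rl).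
      apply/measurable_fun_pairP; split; first exact: measurable_id.
      apply: measurable_funB => //; apply: measurable_funM => //; exact: measurable_id.
    by have := mf measurableT _ mS; rewrite setTI.
  pose X s := tupd (tupd z k s) l (t - P / Q * s) : pt.
  pose w s := wedge (X s) p q k l.
  have wE s : w s = (s - crd q k) * Q - (t - P / Q * s - crd q l) * P.
    by rewrite /w /wedge /X !crd_tupd !eqxx (negbTE kl).
  apply: (lebesgue_two_diam_le (b := fun s => 0 <= w s)) => //.
  move=> s s' S1s S1s' ws.
  have om1 := Hom _ S1s; have om2 := Hom _ S1s'; rewrite -[wedge _ _ _ _ _]/(w s) in om1.
  rewrite -[wedge _ _ _ _ _]/(w s') in om2.
  have := Hzeta _ _ S1s S1s'; rewrite /= !(sum_tupd2 (fun j u => (u - crd q j) ^+ 2))//.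
  set rest := \sum_(j | _) _.
  have -> : (s - crd q k) ^+ 2 + ((t - P / Q * s - crd q l) ^+ 2 + rest) -
    ((s' - crd q k) ^+ 2 + ((t - P / Q * s' - crd q l) ^+ 2 + rest)) =
    (s - s') * (w s + w s') / Q by rewrite !wE; field.
  rewrite normrM normfV ler_pdivrMr// normrM => h.
  have {ws} w2 : 2 * om <= `|w s + w s'|.
    exact: ler_norm_add_sign.
  rewrite /c ler_pdivlMr ?mulr_gt0//; apply: le_trans h.
  by rewrite ler_wpM2l.
Qed.

(** A nonzero wedge forces [k != l] and a nonzero coordinate of [p - q] among the two; exchanging
    [k] and [l] changes only its sign. *)
Lemma annulus_strip_le (A : set pt) p q k l (zeta eta om : R) :
  measurable A -> 0 <= zeta -> 0 <= eta -> 0 < om ->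
  (forall x x', A x -> A x' ->
    `|\sum_j (crd x j - crd q j) ^+ 2 - \sum_j (crd x' j - crd q j) ^+ 2| <= zeta) ->
  (forall x x', A x -> A x' ->
    `|\sum_j crd x j * (crd p j - crd q j) - \sum_j crd x' j * (crd p j - crd q j)| <= eta) ->
  (forall x, A x -> om <= `|wedge x p q k l|) ->
  (lam A <= (4 * zeta * eta / om)%:E)%E.
Proof.
move=> mA zeta0 eta0 om0 Hzeta Heta Hom.
have rhs0 : 0 <= 4 * zeta * eta / om by rewrite !mulr_ge0 ?invr_ge0 ?(ltW om0).
have empty : (forall x, A x -> wedge x p q k l = 0) -> (lam A <= (4 * zeta * eta / om)%:E)%E.
  move=> h; rewrite (_ : A = set0) ?measure0 ?lee_fin// -subset0 => x Ax.
  by have := Hom _ Ax; rewrite h// normr0 leNgt om0.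
have [kl|kl] := eqVneq k l.
  by apply: empty => x _; rewrite /wedge kl; ring.
have [Q0|Q0] := eqVneq (crd p l - crd q l) 0; last exact: (annulus_strip_le0 mA kl zeta0 eta0 om0 Q0).
have [P0|P0] := eqVneq (crd p k - crd q k) 0.
  by apply: empty => x _; rewrite /wedge P0 Q0; ring.
rewrite eq_sym in kl; apply: (annulus_strip_le0 mA kl zeta0 eta0 om0 P0 Hzeta Heta) => x Ax.
have -> : wedge x p q l k = - wedge x p q k l by rewrite /wedge; ring.
by rewrite normrN; exact: Hom.
Qed.

(** On an annulus of width [eps] around [q] both distances are known up to [O(eps)]. So [|x - q|^2]
    varies by [O(radius * eps)], the inner product with [p - q] by [O(eps)], and some wedge is at
    least [radius * w / d^2]. The radius cancels: each annulus has measure [O(eps^2 / w)], and there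
    are [d / eps] of them. *)
Lemma hyperbola_le p q (N : nat) (s0 w : R) (A : set pt) (eps := 4^-1 ^+ N : R) :
  (0 < d)%N -> unit_cube p -> unit_cube q -> 0 < w <= 1 -> measurable A ->
  (forall x, A x -> [/\ unit_cube x, s0 <= euclidean p x - euclidean x q <= s0 + eps &
                       euclidean x q * w <= area x p q]) ->
  (lam A <= (110 * d%:R ^+ 6 * eps / w)%:E)%E.
Proof.
move=> d0 cp cq /andP[w0 w1] mA HA.
have eps0 : 0 < eps by rewrite exprn_gt0// invr_gt0.
have eps1 : eps <= 1 by rewrite exprn_ile1// ?invr_ge0// invf_le1// ler1n.
have D1 : 1 <= d%:R :> R by rewrite ler1n.
have D0 : 0 < d%:R :> R by rewrite ltr0n.
pose M := (d * 4 ^ N)%N.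
have epsM : M%:R * eps = d%:R.
  by rewrite /M /eps natrM natrX -mulrA -exprMn divff ?expr1n ?mulr1// pnatr_eq0.
pose B (j : option ('I_M * ('I_d * 'I_d))) : set pt :=
  if j is Some (i, (k, l)) then A `&` [set x | i.+1%:R * eps <= euclidean x q] `&`
     [set x | euclidean x q <= i.+2%:R * eps] `&`
     [set x | i.+1%:R * eps * w / d%:R ^+ 2 <= `|wedge x p q k l|]
  else A `&` [set x | euclidean x q <= eps].
have meuc := measurable_euclidean (@measurable_id _ pt setT) (@measurable_cst _ _ pt pt setT q).
have mB j : measurable (B j).
  case: j => [[i [k l]]|] /=; last first.
    by apply: measurableI => //; apply: measurable_le_set => //; exact: measurable_cst.
  apply: measurableI; first apply: measurableI; first apply: measurableI => //.
  - by apply: measurable_le_set => //; exact: measurable_cst.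
  - by apply: measurable_le_set => //; exact: measurable_cst.
  - apply: measurable_le_set; first exact: measurable_cst.
    apply: (@measurableT_comp _ _ _ _ _ _ (@Num.norm R R)) => //.
    by apply: measurable_wedge; [exact: measurable_id|exact: measurable_cst|exact: measurable_cst].
have cover x : A x -> exists j, B j x.
  move=> Ax; have [cx _ ar] := HA _ Ax.
  have [le|gt] := leP (euclidean x q) eps; first by exists None.
  pose i := Num.trunc (euclidean x q / eps).
  have /andP[i1 i2] : i%:R <= euclidean x q / eps < i.+1%:R.
    by apply: truncn_itv; rewrite mulr_ge0 ?euclidean_ge0// invr_ge0 ltW.
  rewrite ler_pdivlMr// in i1; rewrite ltr_pdivrMr// in i2.
  have i0 : (0 < i)%N.
    rewrite lt0n; apply/eqP => i0; move: i2; rewrite i0 mul1r ltNge.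
    by rewrite ltW.
  have [iM|iM] := ltnP i.-1 M; last first.
    have := euclidean_cube cx cq; rewrite -epsM leNgt => /negP; case.
    apply: lt_le_trans i1; rewrite ltr_pM2r// ltr_nat.
    by rewrite -(prednK i0) ltnS.
  have ile : 0 < i%:R * eps * w by rewrite !mulr_gt0// ltr0n.
  have [k [l kl]] : exists k l, i%:R * eps * w / d%:R ^+ 2 <= `|wedge x p q k l|.
    by apply: area_attained => //; apply: le_trans ar; rewrite ler_wpM2r// ltW.
  exists (Some (Ordinal iM, (k, l))); rewrite /= prednK//; split => //; split => //.
  exact: ltW.
(* In the innermost ball the wedge has no useful lower bound, but a slab in one coordinate already
   has measure [O(eps)]. *)
have Bnone : (lam (B None) <= (8 * d%:R ^+ 3 * eps / w)%:E)%E.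
  apply: (@le_trans _ _ (2 * (2 * eps))%:E).
    apply: (unif_cube_diam (k := Ordinal d0)) => //; first by rewrite mulr_ge0// ltW.
    move=> z s s' [_ h1] [_ h2].
    have := le_trans (crd_le_euclidean _ _ (Ordinal d0)) h1.
    have := le_trans (crd_le_euclidean _ _ (Ordinal d0)) h2.
    by rewrite !crd_tupd eqxx !ler_norml; lra.
  rewrite lee_fin ler_pdivlMr//.
  have : eps * w <= eps by rewrite ler_piMr// ltW.
  have : eps <= d%:R ^+ 3 * eps by rewrite ler_peMl ?(ltW eps0)// exprn_ege1.
  lra.
have Bsome i kl : (lam (B (Some (i, kl))) <= (96 * d%:R ^+ 3 * eps ^+ 2 / w)%:E)%E.
  case: kl => k l.
  have I1 : 1 <= i.+1%:R :> R by rewrite ler1n.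
  have I2 : i.+2%:R = i.+1%:R + 1 :> R by rewrite -[i.+2]addn1 natrD.
  have om0 : 0 < i.+1%:R * eps * w / d%:R ^+ 2.
    by rewrite !mulr_gt0 ?invr_gt0 ?exprn_gt0// ltr0n.
  apply: (le_trans (@annulus_strip_le (B (Some (i, (k, l)))) p q k l
    (4 * i.+1%:R * eps ^+ 2) (6 * d%:R * eps) _ (mB _) _ _ om0 _ _ _)).
  - by rewrite !mulr_ge0// ?exprn_ge0// ltW.
  - by rewrite !mulr_ge0// ltW.
  - move=> x x' [[[Ax h1] h2] _] [[[Ax' h1'] h2'] _].
    rewrite -!sqr_euclidean.
    move: h1 h2 h1' h2'; rewrite /= I2.
    set u := euclidean x q; set v := euclidean x' q; set a := i.+1%:R * eps.
    have a1 : eps <= a by rewrite /a ler_peMl// ltW.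
    have -> : 4 * i.+1%:R * eps ^+ 2 = eps * (4 * a) by rewrite /a; ring.
    move=> h1 h2 h1' h2'.
    have h : `|u - v| <= eps by rewrite ler_norml; rewrite mulrDl mul1r -/a in h2 h2'; lra.
    rewrite subr_sqr normrM; apply: ler_pM => //.
    rewrite ger0_norm; last by lra.
    rewrite mulrDl mul1r -/a in h2 h2'; lra.
  - move=> x x' [[[Ax h1] h2] _] [[[Ax' h1'] h2'] _].
    have [cx dx _] := HA _ Ax; have [cx' dx' _] := HA _ Ax'.
    (* Polarization: the inner product with [p - q] is determined by the two squared distances, up
       to a constant. *)
    have E y : 2 * \sum_j crd y j * (crd p j - crd q j) =
      euclidean y q ^+ 2 - euclidean p y ^+ 2 + (\sum_j (crd p j ^+ 2 - crd q j ^+ 2)).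
      rewrite !sqr_euclidean -sumrB -big_split mulr_sumr; apply: eq_bigr => j _ /=.
      ring.
    rewrite -(ler_pM2l (_ : 0 < 2))// -{1}(@ger0_norm _ 2)// -normrM mulrBr !E.
    have eD y : unit_cube y -> 0 <= euclidean y q <= d%:R /\ 0 <= euclidean p y <= d%:R.
      by move=> cy; rewrite !euclidean_ge0 !euclidean_cube.
    have [] := eD _ cx; have [] := eD _ cx'.
    move: h1 h2 h1' h2' dx dx'; rewrite /= I2 !mulrDl !mul1r.
    set u := euclidean x q; set v := euclidean x' q; set a := i.+1%:R * eps.
    set u' := euclidean p x; set v' := euclidean p x'.
    move=> h1 h2 h1' h2' dx dx' /andP[v0 vD] /andP[v'0 v'D] /andP[u0 uD] /andP[u'0 u'D].
    have hu : `|u - v| <= eps by rewrite ler_norml; lra.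
    have hu' : `|u' - v'| <= 2 * eps by rewrite ler_norml; lra.
    have hs (b c e : R) : 0 <= b <= d%:R -> 0 <= c <= d%:R -> `|b - c| <= e ->
        `|b ^+ 2 - c ^+ 2| <= 2 * d%:R * e.
      move=> /andP[? ?] /andP[? ?] ?.
      rewrite subr_sqr normrM mulrC; apply: ler_pM => //.
      by rewrite ger0_norm; lra.
    set t := \sum_j _.
    have -> : u ^+ 2 - u' ^+ 2 + t - (v ^+ 2 - v' ^+ 2 + t) = (u ^+ 2 - v ^+ 2) - (u' ^+ 2 - v' ^+ 2) by ring.
    have := hs u v eps; have := hs u' v' (2 * eps).
    rewrite u0 uD v0 vD u'0 u'D v'0 v'D hu hu' => /(_ isT isT isT) k1 /(_ isT isT isT) k2.
    apply: (le_trans (ler_normB _ _)); apply: (le_trans (lerD k2 k1)).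
    have := mulr_ge0 (ltW D0) (ltW eps0); lra.
  - by move=> x [_].
  rewrite lee_fin le_eqVlt; apply/orP; left; apply/eqP; field.
  by rewrite !gt_eqF// ltr0n.
apply: (le_trans (measure_fin_union_le lam mA mB cover)).
rewrite (bigD1 None)//=.
apply: (@le_trans _ _ ((8 * d%:R ^+ 3 * eps / w)%:E +
   \sum_(j : option ('I_M * ('I_d * 'I_d)) | j != None) (96 * d%:R ^+ 3 * eps ^+ 2 / w)%:E)%E).
  by apply: leeD => //; apply: lee_sum => -[[i kl]|] //.
rewrite sumEFin sumr_const cardC1 card_option !card_prod !card_ord /= -EFinD lee_fin.
rewrite -[X in _ + X <= _]mulr_natl (natrM _ M) (natrM _ d d).
have -> : M%:R * (d%:R * d%:R) * (96 * d%:R ^+ 3 * eps ^+ 2 / w) =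
   96 * d%:R ^+ 6 * eps / w.
  have h (m D : R) : m * eps = D ->
      m * (D * D) * (96 * D ^+ 3 * eps ^+ 2 / w) = 96 * D ^+ 6 * eps / w.
    by move=> <-; ring.
  exact: h.
rewrite -mulrDl ler_pM2r ?invr_gt0// -mulrDl ler_pM2r//.
have : d%:R ^+ 3 <= d%:R ^+ 6 :> R by rewrite ler_weXn2l.
have : 0 <= d%:R ^+ 6 :> R by rewrite exprn_ge0// ltW.
lra.
Qed.

End hyperbola.

Section product_slices.
Local Open Scope ereal_scope.
Context (R : realType) (d : measure_display) (T : measurableType d).
Variable lam : probability T R.

Lemma product_slice_le (S : set (T * T)) (Y : set T) (eta : R) :
  (0 <= eta)%R -> measurable S -> measurable Y ->
  (forall y x, S (y, x) -> Y y) ->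
  (forall y, Y y -> lam [set x | S (y, x)] <= eta%:E) ->
  (lam \x lam) S <= eta%:E * lam Y.
Proof.
move=> eta0 mS mY SY le; rewrite /product_measure1 /=.
apply: (@le_trans _ _ (\int[lam]_y (eta%:E * (\1_Y y)%:E))); last first.
  rewrite ge0_integralZl//; last exact/measurable_EFinP/measurable_indic.
  by rewrite integral_indic// setIT.
apply: ge0_le_integral => //.
- exact: measurable_fun_xsection.
- by apply: measurable_funeM; exact/measurable_EFinP/measurable_indic.
- move=> y _; rewrite /= indicE.
  have -> : xsection S y = [set x | S (y, x)].
    by apply/seteqP; split => x; rewrite /xsection /= inE.
  case: (boolP (y \in Y)); rewrite (inE, notin_setE) => Yy.
    by rewrite mule1; exact: le.
  by rewrite mule0 (_ : mkset _ = set0) ?measure0// -subset0 => x /SY.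
Qed.

Lemma product_swap (S : set (T * T)) : measurable S ->
  (lam \x lam) S = (lam \x lam) [set p | S (p.2, p.1)].
Proof.
move=> mS; rewrite (product_measure_unique (m' := lam \x^ lam))//; last first.
  by move=> A B mA mB; exact: product_measure2E.
Qed.

End product_slices.

(** * One or two redrawn points with two fixed points *)

Section pivots.
Context (R : realType) (d : nat).
Hypothesis hd : (2 <= d)%N.
Local Notation pt := (Rpoint R d).
Local Notation lam := (@unif_cube R d).
Implicit Types (p q x y : pt) (k l : 'I_d).

Let D0 : 0 < d%:R :> R. Proof. by rewrite ltr0n; case: (d) hd. Qed.
Let D1 : 1 <= d%:R :> R. Proof. by rewrite ler1n; case: (d) hd. Qed.

Lemma other_coordinate (k : 'I_d) : exists l : 'I_d, l != k.
Proof.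
have [d0 d1] : (0 < d)%N /\ (1 < d)%N by split=> //; apply: leq_trans hd.
have [->|k0] := eqVneq k (Ordinal d0); first by exists (Ordinal d1).
by exists (Ordinal d0); rewrite eq_sym.
Qed.

Let mid := @measurable_id _ pt setT.
Let mcst (q : pt) := @measurable_cst _ _ pt pt setT q.

Lemma measurable_strip p q (c : R) : measurable [set y | area y p q <= c].
Proof.
apply: measurable_le_set; last exact: measurable_cst.
exact: (measurable_area mid (mcst p) (mcst q)).
Qed.

(** Some coordinate [m] carries at least the fraction [1 / d] of [manhattan p q]. In any other
    coordinate [l] of [y], the wedge of [m] and [l] is affine with slope of absolute value
    [|p_m - q_m|]. *)
Lemma strip_le p q (c : R) : 0 < manhattan p q -> 0 <= c ->
  (lam [set y | (area y p q <= c)%R] <= (4 * d%:R * c / manhattan p q)%:E)%E.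
Proof.
move=> r0 c0; have [m hm] := manhattan_attained r0.
have [l lm] := other_coordinate m.
have -> : 4 * d%:R * c / manhattan p q = 2 * (2 * c * d%:R / manhattan p q) by ring.
apply: (unif_cube_diam (k := l)).
- by rewrite !mulr_ge0 ?invr_ge0 ?(ltW r0).
- exact: measurable_strip.
move=> z s s' /= h1 h2.
have := le_trans (wedge_le_area _ _ _ m l) h1.
have := le_trans (wedge_le_area _ _ _ m l) h2.
rewrite /wedge !crd_tupd eqxx [m == l]eq_sym (negbTE lm).
set a := _ * (crd p l - crd q l); set P := crd p m - crd q m => h3 h4.
have : `|(s - s') * P| <= 2 * c.
  by move: h3 h4; rewrite !ler_norml; lra.
rewrite normrM => h; rewrite ler_pdivlMr//.
have : `|s - s'| * (manhattan p q / d%:R) <= 2 * c.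
  by apply: le_trans h; rewrite ler_wpM2l.
by rewrite mulrA ler_pdivrMr.
Qed.

Lemma measurable_ball q (rho : R) : measurable [set y | manhattan y q <= rho].
Proof.
apply: measurable_le_set; last exact: measurable_cst.
exact: (measurable_manhattan mid (mcst q)).
Qed.

(** Two coordinates give the exponent 2, which later cancels the two factors [1 / rho] of a pair of
    slice bounds. *)
Lemma ball_le q (rho : R) : 0 <= rho ->
  (lam [set y | (manhattan y q <= rho)%R] <= (16 * rho ^+ 2)%:E)%E.
Proof.
move=> rho0.
have d0 : (0 < d)%N by apply: leq_trans hd.
pose k := Ordinal d0; have [l lk] := other_coordinate k.
pose B := [set y : pt | `|crd y l - crd q l| <= rho].
have mB : measurable B.
  apply: measurable_le_set; last exact: measurable_cst.
  apply: (@measurableT_comp _ _ _ _ _ _ (@Num.norm R R)) => //.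
  by apply: measurable_funB; [exact: (measurable_crd l mid)|exact: measurable_cst].
have crdle (y : pt) : manhattan y q <= rho -> forall j, `|crd y j - crd q j| <= rho.
  by move=> + j; apply: le_trans; rewrite manhattanE (bigD1 j)//= lerDl sumr_ge0.
have Ble : (lam B <= (4 * rho)%:E)%E.
  have -> : 4 * rho = 2 * (2 * rho) by ring.
  apply: (unif_cube_diam (k := l)) => //; first by rewrite mulr_ge0.
  by move=> z s s'; rewrite /B /= !crd_tupd eqxx !ler_norml; lra.
apply: (@le_trans _ _ ((4 * rho)%:E * lam B)%E).
  apply: (cube_slice1 (k := k)) => //.
  - by rewrite mulr_ge0.
  - exact: measurable_ball.
  - by move=> z x /= /crdle /(_ l); rewrite /B /= crd_tupd (negbTE lk).
  - move=> z _ _; have -> : 4 * rho = 2 * (2 * rho) by ring.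
    apply: unif_diam_le.
    + exact: (measurable_slice z k (measurable_ball q rho)).
    + by rewrite mulr_ge0.
    + move=> s s' /= /crdle /(_ k) + /crdle /(_ k).
      by rewrite !crd_tupd eqxx !ler_norml; lra.
have -> : 16 * rho ^+ 2 = 4 * rho * (4 * rho) by ring.
rewrite [leRHS]EFinM; apply: lee_wpmul2l => //.
by rewrite lee_fin mulr_ge0.
Qed.

Section at_scale.
Variable N : nat.
Let eps : R := 4^-1 ^+ N.
Let eps0 : 0 < eps. Proof. by rewrite exprn_gt0// invr_gt0. Qed.

(** The threshold [w = 2^-N], the square root of [eps], balances flat triangles, of measure
    [O(w / r)] by [strip_le], against the others, of measure [O(eps / w)] by [hyperbola_le]. *)
Lemma single_pivot_le p q (s0 : R) (A : set pt) : unit_cube p -> unit_cube q ->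
  0 < manhattan p q -> measurable A ->
  (forall x, A x -> unit_cube x /\ s0 <= euclidean p x - euclidean x q <= s0 + eps) ->
  (lam A <= (114 * d%:R ^+ 8 * 2^-1 ^+ N / manhattan p q)%:E)%E.
Proof.
move=> cp cq r0 mA HA; set w : R := 2^-1 ^+ N; set r := manhattan p q in r0 *.
have w0 : 0 < w by rewrite exprn_gt0// invr_gt0.
have w1 : w <= 1 by rewrite exprn_ile1// ?invr_ge0// invf_le1// ler1n.
have rD : r <= d%:R by exact: manhattan_cube.
have epsE : eps = w * w by rewrite /eps /w -exprMn -invfM -natrM.
pose B := [set x : pt | area x p q <= w].
have mB : measurable B := measurable_strip p q w.
have mC : measurable (A `&` [set x | w <= area x p q]).
  apply: measurableI => //; apply: measurable_le_set; first exact: measurable_cst.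
  exact: (measurable_area mid (mcst p) (mcst q)).
apply: (@le_trans _ _ (lam (B `|` (A `&` [set x | (w <= area x p q)%R])))).
  apply: le_measure; rewrite ?inE//; first exact: measurableU.
  move=> x Ax; have [h|h] := leP (area x p q) w; [by left|right; split => //].
  exact: ltW.
apply: (le_trans (measureU2 _ mB mC)).
have C_le : (lam (A `&` [set x | (w <= area x p q)%R]) <= (110 * d%:R ^+ 6 * eps / (w / d%:R))%:E)%E.
  apply: (hyperbola_le (p := p) (q := q) (s0 := s0)) => //.
  - by apply: leq_trans hd.
  - by rewrite divr_gt0//= ler_pdivrMr// mul1r (le_trans w1).
  - move=> x [Ax wx]; have [cx hx] := HA _ Ax; split=> //.
    apply: le_trans wx; rewrite mulrCA -[leRHS]mulr1 ler_wpM2l ?(ltW w0)//.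
    by rewrite ler_pdivrMr// mul1r euclidean_cube.
apply: (le_trans (leeD (strip_le r0 (ltW w0)) C_le)).
rewrite -/r -EFinD lee_fin epsE.
have -> : 110 * d%:R ^+ 6 * (w * w) / (w / d%:R) = 110 * d%:R ^+ 7 * r * (w / r).
  by field; rewrite !gt_eqF.
have -> : 4 * d%:R * w / r = 4 * d%:R * (w / r) by ring.
have -> : 114 * d%:R ^+ 8 * w / r = 114 * d%:R ^+ 8 * (w / r) by ring.
rewrite -mulrDl ler_pM2r ?divr_gt0//.
have h1 : d%:R <= d%:R ^+ 8 :> R by rewrite -{1}[d%:R]expr1 ler_weXn2l.
have h2 : d%:R ^+ 7 * r <= d%:R ^+ 8 by rewrite [leRHS]exprSr ler_wpM2l// exprn_ge0// ltW.
rewrite -mulrA; lra.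
Qed.

Lemma area_cube x p q : unit_cube x -> unit_cube p -> unit_cube q ->
  area x p q <= 2 * d%:R ^+ 2.
Proof.
move=> cx cp cq; apply: (@le_trans _ _ (\sum_(k < d) \sum_(l < d) 2)).
  apply: ler_sum => k _; apply: ler_sum => l _.
  rewrite /wedge (le_trans (ler_normB _ _))// !normrM.
  have -> : 2 = 1 * 1 + 1 * 1 :> R by ring.
  by apply: lerD; apply: ler_pM => //; exact: crd_cube.
by rewrite !sumr_const card_ord -mulrnA -[leLHS]mulr_natr natrM expr2.
Qed.

(* By strip_le, the dyadic layer of y with area y p q of order w has measure
   O(w / manhattan p q), which compensates the factor 1 / w. *)
Lemma layers_le p q (S : set (pt * pt)) (C : R) : unit_cube p -> unit_cube q ->
  0 < manhattan p q -> 0 <= C -> measurable S ->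
  (forall y x, S (y, x) -> unit_cube y) ->
  (forall y w, unit_cube y -> 0 < w -> w <= area y p q ->
     (lam [set x | S (y, x)] <= (C * eps / w)%:E)%E) ->
  ((lam \x lam)%E S <=
    (32 * d%:R ^+ 2 * (C + 1) * N.+1%:R * eps / manhattan p q)%:E)%E.
Proof.
move=> cp cq r0 C0 mS cS le; set r := manhattan p q in r0 *.
(* Areas in the cube are at most [2 * d^2], and [2 ^ J.+1 * eps = 2 * (2 ^ d) ^ 2] exceeds this. *)
pose J := (2 * N + 2 * d)%N.
pose Y (j : option 'I_J.+1) : set pt :=
  if j is Some j then [set y | 2 ^+ j * eps <= area y p q] `&`
      [set y | area y p q <= 2 ^+ j.+1 * eps] `&` @unit_cube R d
  else [set y | area y p q <= eps] `&` @unit_cube R d.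
have marea := measurable_area mid (mcst p) (mcst q).
have mY j : measurable (Y j).
  case: j => [j|] /=; last first.
    by apply: measurableI; [exact: measurable_strip|exact: measurable_unit_cube].
  apply: measurableI; last exact: measurable_unit_cube.
  apply: measurableI; last exact: measurable_strip.
  by apply: measurable_le_set => //; exact: measurable_cst.
have mSY j : measurable (S `&` (Y j `*` setT)).
  by apply: measurableI => //; exact: measurableX.
have cover u : S u -> exists j, (S `&` (Y j `*` setT)) u.
  case: u => y x Syx; have cy := cS _ _ Syx.
  have [h|h] := leP (area y p q) eps; first by exists None.
  have top : area y p q < 2 ^+ J.+1 * eps.
    apply: (@le_lt_trans _ _ (2 * d%:R ^+ 2)); first exact: area_cube.
    rewrite [2 ^+ J.+1]exprS -mulrA ltr_pM2l//.
    have -> : 2 ^+ J * eps = (2 ^+ d) ^+ 2.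
      rewrite /J exprD [2 ^+ (2 * N)]exprM -mulrA [_ * eps]mulrC mulrA /eps -exprMn.
      have -> : 2 ^+ 2 * 4^-1 = 1 :> R by rewrite -natrX divff.
      by rewrite expr1n mul1r mulnC exprM.
    by rewrite ltrXn2r// -natrX ltr_nat ltn_expl.
  pose Q j := (area y p q < 2 ^+ j.+1 * eps).
  have exQ : exists j, Q j by exists J.
  case: (ex_minnP exQ) => j Qj jmin.
  have jJ : (j < J.+1)%N by rewrite ltnS jmin.
  exists (Some (Ordinal jJ)); split => //; split => //=; split => //; split => /=; last exact: ltW.
  rewrite leNgt; apply/negP => h'; case: j Qj jmin jJ h' => [|j] Qj jmin jJ /= h'.
    by move: h'; rewrite expr0 mul1r ltNge ltW.
  by have := jmin j h'; rewrite ltnn.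
have none_le : ((lam \x lam)%E (S `&` (Y None `*` setT)) <= (8 * d%:R * (C + 1) * eps / r)%:E)%E.
  apply: (@le_trans _ _ (1%:E * lam (Y None))%E).
    apply: product_slice_le => //; first by move=> y x [_ []].
    move=> y _; apply: probability_le1.
    have := @measurable_xsection _ _ _ _ (S `&` (Y None `*` setT)) y (mSY None).
    by congr measurable; apply/seteqP; split => x; rewrite /xsection /= inE.
  rewrite mul1e; apply: (@le_trans _ _ (4 * d%:R * eps / r)%:E).
    apply: le_trans (strip_le r0 (ltW eps0)).
    apply: le_measure; rewrite ?inE//; first exact: measurable_strip.
    by move=> y [].
  rewrite lee_fin ler_pM2r ?invr_gt0// ler_pM2r//.
  have := mulr_ge0 (ltW D0) C0; move: D0; lra.
have some_le (j : 'I_J.+1) : ((lam \x lam)%E (S `&` (Y (Some j) `*` setT)) <= (8 * d%:R * (C + 1) * eps / r)%:E)%E.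
  have e0 : 0 < 2 ^+ j * eps by rewrite mulr_gt0// exprn_gt0.
  apply: (@le_trans _ _ ((C * eps / (2 ^+ j * eps))%:E * lam (Y (Some j)))%E).
    apply: product_slice_le => //.
    - by rewrite !mulr_ge0// ?invr_ge0 ltW.
    - by move=> y x [_ []].
    - move=> y [[h1 h2] cy]; apply: le_trans (le _ _ cy e0 h1).
      apply: le_measure; rewrite ?inE//; last by move=> x [].
      + have := @measurable_xsection _ _ _ _ (S `&` (Y (Some j) `*` setT)) y (mSY _).
        by congr measurable; apply/seteqP; split => x; rewrite /xsection /= inE.
      + have := @measurable_xsection _ _ _ _ S y mS.
        by congr measurable; apply/seteqP; split => x; rewrite /xsection /= inE.
  have Yle : (lam (Y (Some j)) <= (4 * d%:R * (2 ^+ j.+1 * eps) / r)%:E)%E.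
    apply: (@le_trans _ _ (lam [set y | (area y p q <= 2 ^+ j.+1 * eps)%R])).
      apply: le_measure; rewrite ?inE//; first exact: measurable_strip.
      by move=> y [[]].
    by apply: strip_le => //; rewrite mulr_ge0// ltW// exprn_gt0.
  apply: (@le_trans _ _ ((C * eps / (2 ^+ j * eps))%:E * (4 * d%:R * (2 ^+ j.+1 * eps) / r)%:E)%E).
    by rewrite lee_wpmul2l// lee_fin !mulr_ge0// ?invr_ge0 ltW.
  rewrite -EFinM lee_fin exprS.
  have -> : C * eps / (2 ^+ j * eps) * (4 * d%:R * (2 * 2 ^+ j * eps) / r) =
      8 * d%:R * C * eps / r.
    by field; rewrite !gt_eqF// exprn_gt0.
  rewrite ler_pM2r ?invr_gt0// ler_pM2r//.
  by rewrite ler_pM2l ?mulr_gt0// lerDl.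
apply: (le_trans (@measure_fin_union_le_cst _ _ _ _ _ (fun j => S `&` (Y j `*` setT)) _ _ mS mSY cover _)).
  by case=> [j|]; [exact: some_le|exact: none_le].
rewrite lee_fin card_option card_ord.
have -> : 32 * d%:R ^+ 2 * (C + 1) * N.+1%:R * eps / r =
  (4 * d%:R * N.+1%:R) * (8 * d%:R * (C + 1) * eps / r) by ring.
apply: ler_wpM2r.
  by rewrite !mulr_ge0 ?invr_ge0 ?addr_ge0// ltW.
have : (J.+2 <= 4 * d * N.+1)%N.
  by have := leq_mul hd (leqnn N); rewrite /J; move: hd; lia.
by rewrite -(ler_nat R) !natrM.
Qed.

Let unif_slice y (A : set (pt * pt)) : measurable A -> measurable [set x | A (y, x)].
Proof.
move=> mA; have := @measurable_xsection _ _ _ _ A y mA.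
by congr measurable; apply/seteqP; split => x; rewrite /xsection /= inE.
Qed.

(** The constant [110 * d^6] of [hyperbola_le] times [6 * d^2], the larger of the two losses in
    [diagonal_half] and [edge_half]. *)
Definition half_const : R := 660 * d%:R ^+ 8.

Let half_const_ge0 : 0 <= half_const.
Proof. exact: mulr_ge0 (ler0n _ _) (exprn_ge0 _ (ltW D0)). Qed.

(* By symmetry it suffices to treat the configurations in which, of the two
   triangles compared in the last hypothesis, the pivot x sees the larger one. *)
Let diagonal_half p q (s0 : R) (S : set (pt * pt)) : unit_cube p -> unit_cube q ->
  0 < manhattan p q -> measurable S ->
  (forall y x, S (y, x) -> [/\ unit_cube x, unit_cube y,
     s0 <= euclidean p x - euclidean q x + euclidean q y - euclidean p y <= s0 + eps &
     area y p q <= area x p q]) ->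
  ((lam \x lam)%E S <= (32 * d%:R ^+ 2 * (half_const + 1) *
     N.+1%:R * eps / manhattan p q)%:E)%E.
Proof.
move=> cp cq r0 mS HS; apply: (layers_le cp cq r0 half_const_ge0 mS).
- by move=> y x /HS[].
move=> y w cy w0 wle.
have wD : w <= 2 * d%:R ^+ 2 by rewrite (le_trans wle)// area_cube.
have D2 : 0 < 2 * d%:R ^+ 2 :> R by rewrite mulr_gt0// exprn_gt0.
apply: (@le_trans _ _ (110 * d%:R ^+ 6 * eps / (w / (2 * d%:R ^+ 2)))%:E); last first.
  rewrite invf_div mulrA lee_fin ler_pM2r ?invr_gt0// mulrAC ler_pM2r//.
  have -> : 110 * d%:R ^+ 6 * (2 * d%:R ^+ 2) = 220 * d%:R ^+ 8 :> R by ring.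
  by rewrite /half_const ler_pM2r ?exprn_gt0// ler_nat.
apply: (hyperbola_le (p := p) (q := q) (s0 := s0 - euclidean q y + euclidean p y)) => //.
- by apply: leq_trans hd.
- by rewrite divr_gt0//= ler_pdivrMr// mul1r.
- exact: unif_slice.
move=> x Sx; have [cx _ hx ar] := HS _ _ Sx; split=> //.
  by rewrite (euclidean_sym x q); move: hx; rewrite -/eps; lra.
apply: le_trans ar; apply: le_trans wle.
rewrite mulrCA -[leRHS]mulr1 ler_wpM2l ?(ltW w0)// ler_pdivrMr// mul1r.
apply: (le_trans (euclidean_cube cx cq)).
have : d%:R <= d%:R ^+ 2 :> R by rewrite -{1}[d%:R]expr1 ler_weXn2l.
by move: D2; lra.
Qed.

(** Here the foci are [p] and [y], so the triangle [x, p, y] must be bounded below, while the layers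
    control [y, p, q]. [area_le] links them: with [area x q y <= area x p y] it gives [manhattan x y
    * area p q y <= 3 * d * area x p y]. *)
Let edge_half p q (s0 : R) (S : set (pt * pt)) : unit_cube p -> unit_cube q ->
  0 < manhattan p q -> measurable S ->
  (forall y x, S (y, x) -> [/\ unit_cube x, unit_cube y,
     s0 <= euclidean p x + euclidean q y - euclidean x y <= s0 + eps &
     area x q y <= area x p y]) ->
  ((lam \x lam)%E S <= (32 * d%:R ^+ 2 * (half_const + 1) *
     N.+1%:R * eps / manhattan p q)%:E)%E.
Proof.
move=> cp cq r0 mS HS; apply: (layers_le cp cq r0 half_const_ge0 mS).
- by move=> y x /HS[].
move=> y w cy w0 wle.
have wD : w <= 2 * d%:R ^+ 2 by rewrite (le_trans wle)// area_cube.
have D2 : 0 < 6 * d%:R ^+ 2 :> R by rewrite mulr_gt0// exprn_gt0.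
apply: (@le_trans _ _ (110 * d%:R ^+ 6 * eps / (w / (6 * d%:R ^+ 2)))%:E); last first.
  rewrite invf_div mulrA lee_fin ler_pM2r ?invr_gt0// mulrAC ler_pM2r//.
  have -> : 110 * d%:R ^+ 6 * (6 * d%:R ^+ 2) = half_const by rewrite /half_const; ring.
  exact: lexx.
apply: (hyperbola_le (p := p) (q := y) (s0 := s0 - euclidean q y)) => //.
- by apply: leq_trans hd.
- by rewrite divr_gt0//= ler_pdivrMr// mul1r; move: wD D2; lra.
- exact: unif_slice.
move=> x Sx; have [cx _ hx ar] := HS _ _ Sx; split=> //.
  by move: hx; rewrite -/eps; lra.
have h := area_le cp cq cx cy.
have h3 : manhattan x y * area p q y <= 3 * d%:R * area x p y.
  apply: (le_trans h); rewrite [leRHS]mulrAC mulrC ler_pM2r//.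
  by move: ar; lra.
have D3 : 0 < 3 * d%:R :> R by rewrite mulr_gt0.
have h4 : euclidean x y * w <= 3 * d%:R * area x p y.
  apply: le_trans h3; apply: ler_pM => //; rewrite ?euclidean_ge0 ?(ltW w0)//.
    exact: euclidean_le_manhattan.
  by rewrite -area_rot.
have h5 : euclidean x y * (w / (3 * d%:R)) <= area x p y.
  by rewrite mulrA ler_pdivrMr// [leRHS]mulrC.
apply: le_trans h5; rewrite ler_wpM2l ?euclidean_ge0// ler_wpM2l ?(ltW w0)//.
rewrite lef_pV2 ?posrE//.
have : d%:R <= d%:R ^+ 2 :> R by rewrite -{1}[d%:R]expr1 ler_weXn2l.
by move: (ltW D0); lra.
Qed.

Let measurable_area_pair (f g h : pt * pt -> pt) (f' g' h' : pt * pt -> pt) :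
  measurable_fun [set: pt * pt] f -> measurable_fun [set: pt * pt] g ->
  measurable_fun [set: pt * pt] h -> measurable_fun [set: pt * pt] f' ->
  measurable_fun [set: pt * pt] g' -> measurable_fun [set: pt * pt] h' ->
  measurable [set u | area (f u) (g u) (h u) <= area (f' u) (g' u) (h' u)].
Proof.
by move=> mf mg mh mf' mg' mh'; apply: measurable_le_set; exact: measurable_area.
Qed.

Let measurable_swap (S : set (pt * pt)) : measurable S ->
  measurable [set u : pt * pt | S (u.2, u.1)].
Proof.
move=> mS; have mf : measurable_fun [set: pt * pt] (fun u : pt * pt => (u.2, u.1)).
  by apply/measurable_fun_pairP; split; [exact: measurable_snd|exact: measurable_fst].
by have := mf measurableT _ mS; rewrite setTI.
Qed.

Definition pair_const : R := 64 * d%:R ^+ 2 * (half_const + 1).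

Let pair_constE (r : R) : pair_const * N.+1%:R * eps / r =
  32 * d%:R ^+ 2 * (half_const + 1) * N.+1%:R * eps / r +
  32 * d%:R ^+ 2 * (half_const + 1) * N.+1%:R * eps / r.
Proof. by rewrite /pair_const; ring. Qed.

Let split_le (S A : set (pt * pt)) (c : R) : measurable S -> measurable A ->
  ((lam \x lam)%E (S `&` A) <= c%:E)%E -> ((lam \x lam)%E (S `&` ~` A) <= c%:E)%E ->
  ((lam \x lam)%E S <= (c + c)%:E)%E.
Proof.
move=> mS mA h1 h2.
have mC : measurable (S `&` ~` A) by apply: measurableI => //; exact: measurableC.
have -> : S = (S `&` A) `|` (S `&` ~` A) by rewrite -setIUr setUv setIT.
apply: (le_trans (measureU2 _ (measurableI _ _ mS mA) mC)).
by rewrite EFinD leeD.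
Qed.

(** A gain is an alternating sum around a 4-cycle. The redrawn vertices are opposite in this cycle
    here and adjacent in [edge_le]. *)
Lemma diagonal_le p q (s0 : R) (S : set (pt * pt)) : unit_cube p -> unit_cube q ->
  0 < manhattan p q -> measurable S ->
  (forall x y, S (x, y) -> [/\ unit_cube x, unit_cube y &
     s0 <= euclidean p x - euclidean q x + euclidean q y - euclidean p y <= s0 + eps]) ->
  ((lam \x lam)%E S <= (pair_const * N.+1%:R * eps / manhattan p q)%:E)%E.
Proof.
move=> cp cq r0 mS HS; rewrite pair_constE.
apply: (@split_le S [set u | area u.2 p q <= area u.1 p q]) => //.
- exact: measurable_area_pair.
- rewrite product_swap; last by apply: measurableI => //; exact: measurable_area_pair.
  apply: (diagonal_half (s0 := s0)) => //.
    by apply: measurable_swap; apply: measurableI => //; exact: measurable_area_pair.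
  by move=> y x [/= /HS[? ? ?] ?].
- rewrite manhattan_sym; apply: (diagonal_half (s0 := s0)) => //.
  + by rewrite manhattan_sym.
  + by apply: measurableI => //; apply: measurableC; exact: measurable_area_pair.
  + move=> x y [/= /HS[? ? ?] /negP]; rewrite -ltNge => ar; split=> //.
      by lra.
    have E z : area z q p = area z p q by rewrite area_rot area_swap -area_rot.
    by rewrite !E ltW.
Qed.

Lemma edge_le p q (s0 : R) (S : set (pt * pt)) : unit_cube p -> unit_cube q ->
  0 < manhattan p q -> measurable S ->
  (forall x y, S (x, y) -> [/\ unit_cube x, unit_cube y &
     s0 <= euclidean p x + euclidean q y - euclidean x y <= s0 + eps]) ->
  ((lam \x lam)%E S <= (pair_const * N.+1%:R * eps / manhattan p q)%:E)%E.
Proof.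
move=> cp cq r0 mS HS; rewrite pair_constE.
apply: (@split_le S [set u | area u.1 q u.2 <= area u.1 p u.2]) => //.
- exact: measurable_area_pair.
- rewrite product_swap; last by apply: measurableI => //; exact: measurable_area_pair.
  apply: (edge_half (s0 := s0)) => //.
    by apply: measurable_swap; apply: measurableI => //; exact: measurable_area_pair.
  by move=> y x [/= /HS[? ? ?] ?].
- rewrite manhattan_sym; apply: (edge_half (s0 := s0)) => //.
  + by rewrite manhattan_sym.
  + by apply: measurableI => //; apply: measurableC; exact: measurable_area_pair.
  + move=> x y [/= /HS[? ? ?] /negP]; rewrite -ltNge => ar; split=> //.
      by rewrite (euclidean_sym y x); lra.
    have E z : area y z x = area x z y by rewrite area_rot area_swap.
    by rewrite !E ltW.
Qed.

End at_scale.
End pivots.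

(** A multirule, so that one [rewrite] decides all comparisons between the named vertices. *)
Lemma uniq4_neq (T : eqType) (a b c e : T) : uniq [:: a; b; c; e] ->
  (((a == b) = false) *
   ((a == c) = false) *
   ((a == e) = false) *
   ((b == a) = false) *
   ((b == c) = false) *
   ((b == e) = false) *
   ((c == a) = false) *
   ((c == b) = false) *
   ((c == e) = false) *
   ((e == a) = false) *
   ((e == b) = false) *
   ((e == c) = false))%type.
Proof.
by move=> u; repeat split; apply/negbTE; apply: contraTN u => /eqP ->;
  rewrite /= !inE !eqxx /= ?orbT /= ?andbF.
Qed.

Lemma uniq5_neq (T : eqType) (a b c e f : T) : uniq [:: a; b; c; e; f] ->
  (((a == b) = false) *
   ((a == c) = false) *
   ((a == e) = false) *
   ((a == f) = false) *
   ((b == a) = false) *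
   ((b == c) = false) *
   ((b == e) = false) *
   ((b == f) = false) *
   ((c == a) = false) *
   ((c == b) = false) *
   ((c == e) = false) *
   ((c == f) = false) *
   ((e == a) = false) *
   ((e == b) = false) *
   ((e == c) = false) *
   ((e == f) = false) *
   ((f == a) = false) *
   ((f == b) = false) *
   ((f == c) = false) *
   ((f == e) = false))%type.
Proof.
by move=> u; repeat split; apply/negbTE; apply: contraTN u => /eqP ->;
  rewrite /= !inE !eqxx /= ?orbT /= ?andbF.
Qed.

Lemma uniq6_neq (T : eqType) (a b c e f g : T) : uniq [:: a; b; c; e; f; g] ->
  (((a == b) = false) *
   ((a == c) = false) *
   ((a == e) = false) *
   ((a == f) = false) *
   ((a == g) = false) *
   ((b == a) = false) *
   ((b == c) = false) *
   ((b == e) = false) *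
   ((b == f) = false) *
   ((b == g) = false) *
   ((c == a) = false) *
   ((c == b) = false) *
   ((c == e) = false) *
   ((c == f) = false) *
   ((c == g) = false) *
   ((e == a) = false) *
   ((e == b) = false) *
   ((e == c) = false) *
   ((e == f) = false) *
   ((e == g) = false) *
   ((f == a) = false) *
   ((f == b) = false) *
   ((f == c) = false) *
   ((f == e) = false) *
   ((f == g) = false) *
   ((g == a) = false) *
   ((g == b) = false) *
   ((g == c) = false) *
   ((g == e) = false) *
   ((g == f) = false))%type.
Proof.
by move=> u; repeat split; apply/negbTE; apply: contraTN u => /eqP ->;
  rewrite /= !inE !eqxx /= ?orbT /= ?andbF.
Qed.

(** * Linked pairs in Euclidean configurations *)

Section euclidean_events.
Local Open Scope ereal_scope.
Context (R : realType) (d n : nat) (phi : R).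
Hypotheses (hd : (2 <= d)%N) (phi_ge1 : (1 <= phi)%R).
Local Notation pt := (Rpoint R d).
Local Notation cfg := (n.-tuple pt).
Local Notation lam := (@unif_cube R d).
Local Notation cube := (@unit_cube R d).
Variables (M : probability cfg R) (m : 'I_n -> probability pt R).
Hypothesis M_box : forall B, (forall i, measurable (B i)) ->
  M (tuple_box B) = \prod_(i < n) m i (B i).
Hypothesis dom : forall i A, measurable A -> m i A <= phi%:E * lam A.
Hypothesis m_cube : forall i, m i (~` cube) = 0.
Variable N : nat.
Let eps : R := 4^-1 ^+ N.
Let eps0 : (0 < eps)%R. Proof. by rewrite exprn_gt0// invr_gt0. Qed.
Let phi0 : (0 <= phi)%R. Proof. exact: le_trans phi_ge1. Qed.

Definition cubes : set cfg := tuple_box (fun=> cube).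

Lemma measurable_cubes : measurable cubes.
Proof. by apply: measurable_box => i; exact: measurable_unit_cube. Qed.

Let cubesC : M (~` cubes) = 0.
Proof.
move: m_cube => mc; have mC := @measurable_unit_cube R d.
rewrite probability_setC; last exact: measurable_cubes.
rewrite M_box// big1 ?subee// => i _.
by rewrite -[X in m i X]setCK probability_setC ?mc ?sube0//; exact: measurableC.
Qed.

Definition eucl (z : cfg) (i j : 'I_n) : R := euclidean (tnth z i) (tnth z j).
Definition manh (z : cfg) (i j : 'I_n) : R := manhattan (tnth z i) (tnth z j).

Let pair_bound (rho : R) : R := pair_const R d * N.+1%:R * eps / rho.

Let pc0 : (0 <= pair_const R d)%R.
Proof.
rewrite /pair_const; apply: mulr_ge0; first by rewrite mulr_ge0// exprn_ge0.
by apply: addr_ge0 => //; apply: mulr_ge0 (ler0n _ _) (exprn_ge0 _ (ler0n _ _)).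
Qed.

Let pair_bound_ge0 rho : (0 < rho)%R -> (0 <= pair_bound rho)%R.
Proof.
move=> rho0; rewrite /pair_bound; apply: divr_ge0 (ltW rho0).
by apply: mulr_ge0 (ltW eps0); apply: mulr_ge0.
Qed.

Let pair_bound_le rho r : (0 < rho)%R -> (rho <= r)%R ->
  (pair_const R d * N.+1%:R * eps / r <= pair_bound rho)%R.
Proof.
move=> rho0 rr; rewrite /pair_bound; apply: ler_wpM2l.
  by apply: mulr_ge0 (ltW eps0); apply: mulr_ge0.
by rewrite lef_pV2// posrE (lt_le_trans rho0).
Qed.

Let edge_step (a c b e : 'I_n) (A B : set cfg) (s : cfg -> R) (rho : R) :
  measurable A -> measurable B -> (0 < rho)%R ->
  (forall z x y, A (tupd (tupd z b x) e y) -> B z) ->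
  (forall z, B z -> (rho <= manh z a c)%R) ->
  (forall z x y, A (tupd (tupd z b x) e y) -> [/\ cube x, cube y &
    (s z <= euclidean (tnth z a) x + euclidean (tnth z c) y - euclidean x y <= s z + eps)%R]) ->
  M A <= (phi ^+ 2 * pair_bound rho)%:E * M B.
Proof.
move=> mA mB rho0 AB Brho HA.
apply: (slice2_le phi0 M_box dom (pair_bound_ge0 rho0) measurable_cubes mA mB cubesC AB).
move=> z Qz Bz; have r := Brho _ Bz.
apply: (@le_trans _ _ (pair_const R d * N.+1%:R * eps / manh z a c)%:E); last first.
  by rewrite lee_fin; exact: pair_bound_le.
apply: (edge_le hd (s0 := s z)).
- exact: Qz.
- exact: Qz.
- exact: lt_le_trans r.
- exact: measurable_slice2.
- by move=> x y; exact: HA.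
Qed.

Let diagonal_step (a c b e : 'I_n) (A B : set cfg) (s : cfg -> R) (rho : R) :
  measurable A -> measurable B -> (0 < rho)%R ->
  (forall z x y, A (tupd (tupd z b x) e y) -> B z) ->
  (forall z, B z -> (rho <= manh z a c)%R) ->
  (forall z x y, A (tupd (tupd z b x) e y) -> [/\ cube x, cube y &
    (s z <= euclidean (tnth z a) x - euclidean (tnth z c) x + euclidean (tnth z c) y
       - euclidean (tnth z a) y <= s z + eps)%R]) ->
  M A <= (phi ^+ 2 * pair_bound rho)%:E * M B.
Proof.
move=> mA mB rho0 AB Brho HA.
apply: (slice2_le phi0 M_box dom (pair_bound_ge0 rho0) measurable_cubes mA mB cubesC AB).
move=> z Qz Bz; have r := Brho _ Bz.
apply: (@le_trans _ _ (pair_const R d * N.+1%:R * eps / manh z a c)%:E); last first.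
  by rewrite lee_fin; exact: pair_bound_le.
apply: (diagonal_le hd (s0 := s z)).
- exact: Qz.
- exact: Qz.
- exact: lt_le_trans r.
- exact: measurable_slice2.
- by move=> x y; exact: HA.
Qed.

Definition pivot_const : R := 114 * d%:R ^+ 8.

Let pivot_const_ge0 : (0 <= pivot_const)%R.
Proof. exact: mulr_ge0 (ler0n _ _) (exprn_ge0 _ (ler0n _ _)). Qed.

Let pivot_step (a c b : 'I_n) (A B : set cfg) (s : cfg -> R) (rho : R) :
  measurable A -> measurable B -> (0 < rho)%R ->
  (forall z x, A (tupd z b x) -> B z) ->
  (forall z, B z -> (rho <= manh z a c)%R) ->
  (forall z x, A (tupd z b x) -> cube x /\
    (s z <= euclidean (tnth z a) x - euclidean x (tnth z c) <= s z + eps)%R) ->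
  M A <= (phi * (pivot_const * 2^-1 ^+ N / rho))%:E * M B.
Proof.
move=> mA mB rho0 AB Brho HA.
have b0 : (0 <= pivot_const * 2^-1 ^+ N)%R.
  by apply: mulr_ge0 => //; rewrite exprn_ge0// invr_ge0.
apply: (slice1_le phi0 M_box dom _ measurable_cubes mA mB cubesC AB).
  exact: divr_ge0 b0 (ltW rho0).
move=> z Qz Bz; have r := Brho _ Bz.
apply: (@le_trans _ _ (pivot_const * 2^-1 ^+ N / manh z a c)%:E); last first.
  by rewrite lee_fin ler_wpM2l// lef_pV2// posrE (lt_le_trans rho0).
apply: (single_pivot_le hd (s0 := s z)).
- exact: Qz.
- exact: Qz.
- exact: lt_le_trans r.
- exact: measurable_slice.
- by move=> x; exact: HA.
Qed.

Let mtnth (i : 'I_n) : measurable_fun [set: cfg] (fun z => tnth z i).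
Proof. exact: measurable_tnth. Qed.

Let mball i j (rho : R) : measurable [set z | (manh z i j <= rho)%R].
Proof.
apply: measurable_le_set; last exact: measurable_cst.
exact: (measurable_manhattan (mtnth i) (mtnth j)).
Qed.

Let mball_ge i j (rho : R) : measurable [set z | (rho <= manh z i j)%R].
Proof.
apply: measurable_le_set; first exact: measurable_cst.
exact: (measurable_manhattan (mtnth i) (mtnth j)).
Qed.

Let near_le i j (rho : R) : i != j -> (0 <= rho)%R ->
  M [set z | (manh z i j <= rho)%R] <= (phi * (16 * rho ^+ 2))%:E.
Proof.
move=> ij rho0.
have e0 : (0 <= 16 * rho ^+ 2)%R by rewrite mulr_ge0// exprn_ge0.
have := slice1_le (i := i) (B := setT) phi0 M_box dom e0 measurable_cubes
  (mball i j rho) measurableT cubesC.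
rewrite probability_setT mule1; apply => // z _ _.
have := ball_le hd (tnth z j) rho0; congr (lam _ <= _).
apply/seteqP; split => x; rewrite /manh /= !tnth_tupd eqxx eq_sym (negbTE ij)//.
Qed.

(** Two slice bounds around the fixed points [i], [j] cost [G / rho^2] at distance about [rho], and
    that distance has probability [O(phi * rho^2)] by [near_le]. Hence all layers contribute alike,
    and their number is linear in [N]. Below distance [eps] the estimate [near_le] suffices
    alone. *)
Let dyadic_le i j (A : set cfg) (G : R) : i != j -> measurable A -> A `<=` cubes ->
  (0 <= G)%R ->
  (forall rho, (0 < rho)%R ->
    M (A `&` ([set z | (manh z i j <= 2 * rho)%R] `&` [set z | (rho <= manh z i j)%R])) <=
    (G / rho ^+ 2)%:E * M [set z | (manh z i j <= 2 * rho)%R]) ->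
  M A <= ((2 * N + d + 2)%:R * (phi * (64 * G + 16 * eps ^+ 2)))%:E.
Proof.
move=> ij mA AQ G0 HG.
pose J := (2 * N + d)%N.
pose L (rho : R) := [set z | (manh z i j <= 2 * rho)%R] `&` [set z | (rho <= manh z i j)%R].
pose B (k : option 'I_J.+1) := if k is Some k then A `&` L (2 ^+ k * eps)%R
  else A `&` [set z | (manh z i j <= eps)%R].
have mB k : measurable (B k).
  by case: k => [k|] /=; repeat apply: measurableI.
have eps2 : (0 <= 16 * eps ^+ 2)%R by rewrite mulr_ge0// exprn_ge0// ltW.
have G64 : (0 <= 64 * G)%R by rewrite mulr_ge0.
have cover z : A z -> exists k, B k z.
  move=> Az; have Qz := AQ _ Az.
  have [h|h] := leP (manh z i j) eps; first by exists None.
  have top : (manh z i j <= 2 ^+ J.+1 * eps)%R.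
    apply: (@le_trans _ _ d%:R); first exact: manhattan_cube.
    have -> : (2 ^+ J.+1 * eps = 2 ^+ d.+1 :> R)%R.
      rewrite /J -addnS exprD exprM /eps mulrAC -exprMn.
      by rewrite -natrX mulfV// expr1n mul1r.
    by rewrite -natrX ler_nat ltnW// ltnW// ltn_expl.
  pose Q k := (manh z i j <= 2 ^+ k.+1 * eps)%R.
  have exQ : exists k, Q k by exists J.
  case: (ex_minnP exQ) => k Qk kmin.
  have kJ : (k < J.+1)%N by rewrite ltnS kmin.
  exists (Some (Ordinal kJ)); split => //; split => /=; first by rewrite mulrA -exprS.
  rewrite leNgt; apply/negP => h'; case: k Qk kmin kJ h' => [|k] Qk kmin kJ h'.
    by move: h'; rewrite expr0 mul1r ltNge ltW.
  by have := kmin k (ltW h'); rewrite ltnn.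
have B_le k : M (B k) <= (phi * (64 * G + 16 * eps ^+ 2))%:E.
  case: k => [k|].
    have r0 : (0 < 2 ^+ k * eps)%R by rewrite mulr_gt0// exprn_gt0.
    apply: (le_trans (HG _ r0)).
    have r20 : (0 <= 2 * (2 ^+ k * eps))%R by rewrite mulr_ge0// ltW.
    have g0 : 0%R <= (G / (2 ^+ k * eps) ^+ 2)%:E.
      by rewrite lee_fin divr_ge0// exprn_ge0// ltW.
    apply: (le_trans (lee_wpmul2l g0 (near_le ij r20))).
    rewrite -EFinM lee_fin.
    have -> : (G / (2 ^+ k * eps) ^+ 2 * (phi * (16 * (2 * (2 ^+ k * eps)) ^+ 2)) = phi * (64 * G))%R.
      by field; rewrite !gt_eqF// exprn_gt0.
    by rewrite ler_wpM2l// lerDl.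
  apply: (@le_trans _ _ (M [set z | (manh z i j <= eps)%R])).
    by apply: le_measure; rewrite ?inE//; move=> z [].
  apply: (le_trans (near_le ij (ltW eps0))).
  by rewrite lee_fin ler_wpM2l// lerDr.
apply: (le_trans (measure_fin_union_le_cst mA mB cover B_le)).
by rewrite lee_fin card_option card_ord /J addn2.
Qed.

(** [small_change] as a measurable event; distinctness of the indices does not depend on the
    configuration and is kept apart. *)
Definition short_change (a b c e : 'I_n) : set cfg :=
  [set z | (0 < gain (eucl z) a b c e)%R] `&` [set z | (gain (eucl z) a b c e <= eps)%R].

Lemma measurable_gain a b c e :
  measurable_fun [set: cfg] (fun z => gain (eucl z) a b c e).
Proof.
have h i j : measurable_fun [set: cfg] (fun z => eucl z i j).
  exact: (measurable_euclidean (mtnth i) (mtnth j)).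
by repeat (apply: measurable_funB || apply: measurable_funD).
Qed.

Lemma measurable_short_change a b c e : measurable (short_change a b c e).
Proof.
apply: measurableI.
  by apply: measurable_lt_set; [exact: measurable_cst|exact: measurable_gain].
by apply: measurable_le_set; [exact: measurable_gain|exact: measurable_cst].
Qed.

Let incube (i : 'I_n) : set cfg := [set z | cube (tnth z i)].

Let measurable_incube i : measurable (incube i).
Proof. by have := mtnth i measurableT (@measurable_unit_cube R d); rewrite setTI. Qed.

Let short2 (b e : 'I_n) (A B : set cfg) : measurable A -> measurable B ->
  measurable (A `&` (incube b `&` incube e) `&` B).
Proof. by move=> mA mB; apply: measurableI => //; apply: measurableI => //; exact: measurableI. Qed.

Let ring_of i j rho := [set z | (manh z i j <= 2 * rho)%R] `&` [set z | (rho <= manh z i j)%R].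

Let measurable_ring i j rho : measurable (ring_of i j rho).
Proof. exact: measurableI. Qed.

Let ring_le i j rho (A U : set cfg) (x y : R) : measurable A -> measurable U ->
  (0 <= x)%R -> (0 <= y)%R ->
  A `&` ring_of i j rho `<=` U -> M U <= x%:E * (y%:E * M (ring_of i j rho)) ->
  M (A `&` ring_of i j rho) <= (x * y)%:E * M [set z | (manh z i j <= 2 * rho)%R].
Proof.
move=> mA mU x0 y0 AU MU.
apply: (@le_trans _ _ (M U)); first by apply: le_measure; rewrite ?inE//; exact: measurableI.
apply: (le_trans MU); rewrite muleA -EFinM lee_wpmul2l ?lee_fin ?mulr_ge0//.
by apply: le_measure; rewrite ?inE//; move=> z [].
Qed.

(** Six vertices: [b], [e] occur only in the first change and [f], [g] only in the second. Both
    slices have the fixed points [a] and [c]. *)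
Lemma type0_le a b c e f g : uniq [:: a; b; c; e; f; g] ->
  M (short_change a b c e `&` short_change a c f g `&` cubes) <=
  ((2 * N + d + 2)%:R * (phi * (64 * (phi ^+ 2 * (pair_const R d * N.+1%:R * eps)) ^+ 2
     + 16 * eps ^+ 2)))%:E.
Proof.
move=> u; have ne := uniq6_neq u.
have ac : a != c by rewrite ne.
have mA : measurable (short_change a b c e `&` short_change a c f g `&` cubes).
  by apply: measurableI; [apply: measurableI; exact: measurable_short_change|exact: measurable_cubes].
apply: (dyadic_le ac) => //.
  exact: sqr_ge0.
move=> rho rho0; rewrite -/(ring_of a c rho).
(* Only the points still to be redrawn are required to lie in the cube: [cubes] would also constrain
   those already replaced, and the event left after a slice must not depend on them. *)
pose V := short_change a c f g `&` (incube f `&` incube g) `&` ring_of a c rho.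
pose U := short_change a b c e `&` (incube b `&` incube e) `&` V.
have mV : measurable V by apply: short2 => //; exact: measurable_short_change.
have mU : measurable U by apply: short2 => //; exact: measurable_short_change.
have step1 : M U <= (phi ^+ 2 * pair_bound rho)%:E * M V.
  apply: (edge_step (a := a) (c := c) (b := b) (e := e) (s := fun z => eucl z a c)) => //.
  - move=> z x y [_]; rewrite /V /ring_of /short_change /incube /manh /gain /eucl /=.
    by rewrite !tnth_tupd !ne.
  - by move=> z [_ []].
  - move=> z x y [[+ +] _]; rewrite /short_change /incube /gain /eucl /= !tnth_tupd !eqxx !ne.
    by move=> [g0 g1] [cx cy]; split=> //; move: g0 g1; lra.
have step2 : M V <= (phi ^+ 2 * pair_bound rho)%:E * M (ring_of a c rho).
  apply: (edge_step (a := a) (c := c) (b := f) (e := g) (s := fun z => (eucl z a c - eps)%R)) => //.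
  - by move=> z x y [_]; rewrite /ring_of /manh /= !tnth_tupd !ne.
  - by move=> z [].
  - move=> z x y [[+ +] _]; rewrite /short_change /incube /gain /eucl /= !tnth_tupd !eqxx !ne.
    by move=> [g0 g1] [cx cy]; split=> //; move: g0 g1; lra.
have b0 : (0 <= phi ^+ 2 * pair_bound rho)%R.
  by rewrite mulr_ge0 ?exprn_ge0 ?pair_bound_ge0.
have -> : ((phi ^+ 2 * (pair_const R d * N.+1%:R * eps)) ^+ 2 / rho ^+ 2 =
    (phi ^+ 2 * pair_bound rho) * (phi ^+ 2 * pair_bound rho))%R.
  by rewrite /pair_bound; field; rewrite gt_eqF.
apply: (ring_le mA mU b0 b0).
  move=> z [[[k1 k2] Qz] k3].
  exact: (conj (conj k1 (conj (Qz b) (Qz e))) (conj (conj k2 (conj (Qz f) (Qz g))) k3)).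
apply: (le_trans step1); apply: lee_wpmul2l; first by rewrite lee_fin.
exact: step2.
Qed.

(** With five vertices one of the two pair bounds, of order [eps], becomes the single-point bound of
    order [2^-N]; their product is of order [8^-N] instead of [16^-N]. *)
Let type1_rhs := ((2 * N + d + 2)%:R * (phi * (64 * (phi ^+ 3 *
     (pair_const R d * N.+1%:R * eps) * (pivot_const * 2^-1 ^+ N)) + 16 * eps ^+ 2)))%:E.

Let type1_G_ge0 : (0 <= phi ^+ 3 * (pair_const R d * N.+1%:R * eps) * (pivot_const * 2^-1 ^+ N))%R.
Proof.
have e1 : (0 <= 2^-1 ^+ N :> R)%R by rewrite exprn_ge0// invr_ge0.
apply: mulr_ge0 (mulr_ge0 pivot_const_ge0 e1); apply: mulr_ge0.
  exact: exprn_ge0.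
by apply: mulr_ge0 (ltW eps0); apply: mulr_ge0.
Qed.

Let type1_combine i j rho (A U V : set cfg) : (0 < rho)%R ->
  measurable A -> measurable U -> A `&` ring_of i j rho `<=` U ->
  M U <= (phi * (pivot_const * 2^-1 ^+ N / rho))%:E * M V ->
  M V <= (phi ^+ 2 * pair_bound rho)%:E * M (ring_of i j rho) ->
  M (A `&` ring_of i j rho) <=
   ((phi ^+ 3 * (pair_const R d * N.+1%:R * eps) * (pivot_const * 2^-1 ^+ N)) / rho ^+ 2)%:E *
   M [set z | (manh z i j <= 2 * rho)%R].
Proof.
move=> rho0 mA mU AU step1 step2.
have b0 : (0 <= phi ^+ 2 * pair_bound rho)%R.
  by rewrite mulr_ge0 ?exprn_ge0 ?pair_bound_ge0.
have c0 : (0 <= phi * (pivot_const * 2^-1 ^+ N / rho))%R.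
  apply: mulr_ge0 => //; apply: divr_ge0 (ltW rho0); apply: mulr_ge0 => //.
have -> : ((phi ^+ 3 * (pair_const R d * N.+1%:R * eps) * (pivot_const * 2^-1 ^+ N)) / rho ^+ 2 =
    (phi * (pivot_const * 2^-1 ^+ N / rho)) * (phi ^+ 2 * pair_bound rho))%R.
  rewrite /pair_bound; move: (2^-1 ^+ N)%R pivot_const (pair_const R d) => t u v.
  by field; rewrite gt_eqF.
apply: (ring_le mA mU c0 b0 AU).
apply: (le_trans step1); apply: lee_wpmul2l; first by rewrite lee_fin.
exact: step2.
Qed.

(** [x] occurs only in the second change, as a single pivot with foci [b] and [c]. In the first
    change [a] and [e] are opposite with the same fixed points, hence [diagonal_step]. *)
Lemma type1a_le a b c e x : uniq [:: a; b; c; e; x] ->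
  M (short_change a b c e `&` short_change a c b x `&` cubes) <= type1_rhs.
Proof.
move=> u; have ne := uniq5_neq u.
have bc : b != c by rewrite ne.
have mA : measurable (short_change a b c e `&` short_change a c b x `&` cubes).
  by apply: measurableI; [apply: measurableI; exact: measurable_short_change|exact: measurable_cubes].
apply: (dyadic_le bc) => //.
move=> rho rho0; rewrite -/(ring_of b c rho).
pose V := short_change a b c e `&` (incube a `&` incube e) `&` ring_of b c rho.
pose U := short_change a c b x `&` (incube x `&` incube x) `&` V.
have mV : measurable V by apply: short2 => //; exact: measurable_short_change.
have mU : measurable U by apply: short2 => //; exact: measurable_short_change.
apply: (type1_combine (U := U) (V := V)) => //.
- move=> z [[[k1 k2] Qz] k3].
  exact: (conj (conj k2 (conj (Qz x) (Qz x))) (conj (conj k1 (conj (Qz a) (Qz e))) k3)).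
- apply: (pivot_step (a := b) (c := c) (b := x) (s := fun z => (eucl z a b - eucl z a c)%R)) => //.
  + move=> z y [_]; rewrite /V /ring_of /short_change /incube /manh /gain /eucl /=.
    by rewrite !tnth_tupd !ne.
  + by move=> z [_ []].
  + move=> z y [[+ +] _]; rewrite /short_change /incube /gain /eucl /= !tnth_tupd !eqxx !ne.
    move=> [g0 g1] [cx _]; split=> //; move: g0 g1.
    by rewrite (euclidean_sym y); lra.
- apply: (diagonal_step (a := b) (c := c) (b := a) (e := e) (s := fun=> 0%R)) => //.
  + by move=> z y y' [_]; rewrite /ring_of /manh /= !tnth_tupd !ne.
  + by move=> z [].
  + move=> z y y' [[+ +] _]; rewrite /short_change /incube /gain /eucl /= !tnth_tupd !eqxx !ne.
    move=> [g0 g1] [cx cy]; split=> //; move: g0 g1.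
    by rewrite (euclidean_sym y (tnth z b)) (euclidean_sym y (tnth z c)); lra.
Qed.

(** Now the foci of the pivot [x] are [a] and [b], and [c], [e] are adjacent in the first change,
    hence [edge_step]. *)
Lemma type1b_le a b c e x : uniq [:: a; b; c; e; x] ->
  M (short_change a b c e `&` short_change a c x b `&` cubes) <= type1_rhs.
Proof.
move=> u; have ne := uniq5_neq u.
have ab : a != b by rewrite ne.
have mA : measurable (short_change a b c e `&` short_change a c x b `&` cubes).
  by apply: measurableI; [apply: measurableI; exact: measurable_short_change|exact: measurable_cubes].
apply: (dyadic_le ab) => //.
move=> rho rho0; rewrite -/(ring_of a b rho).
pose V := short_change a b c e `&` (incube c `&` incube e) `&` ring_of a b rho.
pose U := short_change a c x b `&` (incube x `&` incube x) `&` V.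
have mV : measurable V by apply: short2 => //; exact: measurable_short_change.
have mU : measurable U by apply: short2 => //; exact: measurable_short_change.
apply: (type1_combine (U := U) (V := V)) => //.
- move=> z [[[k1 k2] Qz] k3].
  exact: (conj (conj k2 (conj (Qz x) (Qz x))) (conj (conj k1 (conj (Qz c) (Qz e))) k3)).
- apply: (pivot_step (a := b) (c := a) (b := x) (s := fun z => (eucl z c b - eucl z a c)%R)) => //.
  + move=> z y [_]; rewrite /V /ring_of /short_change /incube /manh /gain /eucl /=.
    by rewrite !tnth_tupd !ne.
  + by move=> z [_ []] ? ?; rewrite /manh manhattan_sym.
  + move=> z y [[+ +] _]; rewrite /short_change /incube /gain /eucl /= !tnth_tupd !eqxx !ne.
    move=> [g0 g1] [cx _]; split=> //; move: g0 g1.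
    by rewrite (euclidean_sym y (tnth z b)) (euclidean_sym y (tnth z a)); lra.
- apply: (edge_step (a := a) (c := b) (b := c) (e := e) (s := fun z => (eucl z a b - eps)%R)) => //.
  + by move=> z y y' [_]; rewrite /ring_of /manh /= !tnth_tupd !ne.
  + by move=> z [].
  + move=> z y y' [[+ +] _]; rewrite /short_change /incube /gain /eucl /= !tnth_tupd !eqxx !ne.
    by move=> [g0 g1] [cx cy]; split=> //; move: g0 g1; lra.
Qed.

Let D0 : (0 <= d%:R :> R)%R. Proof. exact: ler0n. Qed.

(** Sum of one six-vertex family, with [64 * pair_const^2 + 16], and two five-vertex families, each
    with [64 * pair_const * pivot_const + 16]. *)
Definition euclidean_const : R :=
  (d%:R + 2) * (64 * pair_const R d ^+ 2 + 128 * pair_const R d * pivot_const + 48).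

Lemma euclidean_const_ge0 : (0 <= euclidean_const)%R.
Proof.
apply: mulr_ge0; first exact: addr_ge0.
apply: addr_ge0 => //; apply: addr_ge0.
  exact: mulr_ge0 (ler0n _ 64) (sqr_ge0 _).
by apply: mulr_ge0 pivot_const_ge0; exact: mulr_ge0 (ler0n _ 128) pc0.
Qed.

Let layers_count : ((2 * N + d + 2)%:R <= (d%:R + 2) * N.+1%:R :> R)%R.
Proof.
have -> : (d%:R + 2 = (d + 2)%:R :> R)%R by rewrite natrD.
by rewrite -natrM ler_nat; have := leq_mul hd (leqnn N); lia.
Qed.

Let N1 : (1 <= N.+1%:R :> R)%R. Proof. by rewrite ler1n. Qed.

Let type0_simpl (c : R) : (0 <= c)%R -> ((2 * N + d + 2)%:R * (phi * (64 * (phi ^+ 2 * (c * N.+1%:R * eps)) ^+ 2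
     + 16 * eps ^+ 2)) <= (d%:R + 2) * (64 * c ^+ 2 + 16) * (phi ^+ 5 * N.+1%:R ^+ 3 * eps ^+ 2))%R.
Proof.
move=> c0; move: layers_count N1; move: (N.+1%:R : R)%R => u lu u1.
have u0 : (0 <= u)%R by apply: le_trans u1.
have e2 : (0 <= eps ^+ 2)%R by rewrite exprn_ge0// ltW.
have ph5 : (phi <= phi ^+ 5 * u ^+ 2)%R.
  apply: (@le_trans _ _ (phi ^+ 5)%R); first by rewrite -{1}[phi]expr1 ler_weXn2l.
  by rewrite ler_peMr ?exprn_ge0// exprn_ege1.
apply: (@le_trans _ _ ((d%:R + 2) * u * (phi ^+ 5 * u ^+ 2 * eps ^+ 2 * (64 * c ^+ 2 + 16)))%R); last first.
  by rewrite le_eqVlt; apply/orP; left; apply/eqP; ring.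
apply: ler_pM => //.
  by apply: mulr_ge0 => //; apply: addr_ge0; apply: mulr_ge0 => //; exact: sqr_ge0.
have -> : (phi * (64 * (phi ^+ 2 * (c * u * eps)) ^+ 2 + 16 * eps ^+ 2) =
  phi ^+ 5 * u ^+ 2 * eps ^+ 2 * (64 * c ^+ 2) + phi * (16 * eps ^+ 2))%R by ring.
rewrite [leRHS]mulrDr lerD2l -[leRHS]mulrA [(eps ^+ 2 * 16)%R]mulrC.
by rewrite ler_wpM2r// mulr_ge0.
Qed.

Let type1_simpl (c v : R) : (0 <= c)%R -> (0 <= v)%R ->
  ((2 * N + d + 2)%:R * (phi * (64 * (phi ^+ 3 * (c * N.+1%:R * eps) * (v * 2^-1 ^+ N))
     + 16 * eps ^+ 2)) <= (d%:R + 2) * (64 * c * v + 16) * (phi ^+ 4 * N.+1%:R ^+ 2 * 8^-1 ^+ N))%R.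
Proof.
move=> c0 v0; move: layers_count N1; move: (N.+1%:R : R)%R => u lu u1.
have u0 : (0 <= u)%R by apply: le_trans u1.
have e8 : (eps * 2^-1 ^+ N = 8^-1 ^+ N)%R by rewrite /eps -exprMn -invfM -natrM.
have t0 : (0 <= 8^-1 ^+ N :> R)%R by rewrite exprn_ge0// invr_ge0.
have e2 : (eps ^+ 2 <= 8^-1 ^+ N)%R.
  rewrite -e8 expr2 ler_wpM2l// ?(ltW eps0)// /eps lerXn2r// ?nnegrE ?invr_ge0//.
  by rewrite lef_pV2 ?posrE// ler_nat.
have ph4 : (phi <= phi ^+ 4 * u)%R.
  apply: (@le_trans _ _ (phi ^+ 4)%R); first by rewrite -{1}[phi]expr1 ler_weXn2l.
  by rewrite ler_peMr ?exprn_ge0.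
apply: (@le_trans _ _ ((d%:R + 2) * u * (phi ^+ 4 * u * 8^-1 ^+ N * (64 * c * v + 16)))%R); last first.
  by rewrite le_eqVlt; apply/orP; left; apply/eqP; move: (8^-1 ^+ N)%R => t; ring.
apply: ler_pM => //.
  apply: mulr_ge0 => //; apply: addr_ge0; last by rewrite mulr_ge0 ?sqr_ge0.
  apply: mulr_ge0 => //; apply: mulr_ge0; last by rewrite mulr_ge0 ?exprn_ge0 ?invr_ge0.
  by rewrite mulr_ge0 ?exprn_ge0// mulr_ge0 ?(ltW eps0)// mulr_ge0.
rewrite -e8 in e2; rewrite -e8; move: (2^-1 ^+ N)%R e2 => t e2.
have -> : (phi * (64 * (phi ^+ 3 * (c * u * eps) * (v * t)) + 16 * eps ^+ 2) =
  phi ^+ 4 * u * (eps * t) * (64 * c * v) + phi * (16 * eps ^+ 2))%R by ring.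
rewrite [leRHS]mulrDr lerD2l -[leRHS]mulrA [(eps * t * 16)%R]mulrC.
apply: ler_pM => //; first by rewrite mulr_ge0 ?sqr_ge0.
by rewrite ler_wpM2l.
Qed.

Lemma euclidean_linked_le : exists A : set cfg,
  [/\ measurable A,
      [set z | linked_small_changes (eucl z) eps] `&` cubes `<=` A &
  M A <= (euclidean_const * N.+1%:R ^+ 2 * (n%:R ^+ 5 * phi ^+ 4 * 8^-1 ^+ N +
            n%:R ^+ 6 * phi ^+ 5 * N.+1%:R * 16^-1 ^+ N))%:E].
Proof.
pose I6 : finType := ('I_n * 'I_n * 'I_n * 'I_n * 'I_n * 'I_n)%type.
pose I5 : finType := (bool * ('I_n * 'I_n * 'I_n * 'I_n * 'I_n))%type.
pose B6 (t : I6) : set cfg := let: (a, b, c, e, f, g) := t in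
  if uniq [:: a; b; c; e; f; g] then short_change a b c e `&` short_change a c f g `&` cubes
  else set0.
pose B5 (t : I5) : set cfg := let: (s, (a, b, c, e, x)) := t in
  if uniq [:: a; b; c; e; x] then
    (if s then short_change a b c e `&` short_change a c b x `&` cubes
     else short_change a b c e `&` short_change a c x b `&` cubes)
  else set0.
have mB (a b c e a' b' c' e' : 'I_n) :
    measurable (short_change a b c e `&` short_change a' b' c' e' `&` cubes).
  by apply: measurableI; [apply: measurableI; exact: measurable_short_change|exact: measurable_cubes].
have mB6 t : measurable (B6 t).
  by case: t => [[[[[a b] c] e] f] g] /=; case: ifP.
have mB5 t : measurable (B5 t).
  by case: t => s [[[[a b] c] e] f] /=; case: ifP => //; case: ifP.
pose K6 : R := ((d%:R + 2) * (64 * pair_const R d ^+ 2 + 16) * (phi ^+ 5 * N.+1%:R ^+ 3 * eps ^+ 2))%R.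
pose K5 : R := ((d%:R + 2) * (64 * pair_const R d * pivot_const + 16) * (phi ^+ 4 * N.+1%:R ^+ 2 * 8^-1 ^+ N))%R.
have d20 : (0 <= d%:R + 2 :> R)%R by rewrite addr_ge0.
have t80 : (0 <= 8^-1 ^+ N :> R)%R by rewrite exprn_ge0// invr_ge0.
have p6 : (0 <= 64 * pair_const R d ^+ 2 + 16)%R by rewrite addr_ge0// mulr_ge0// sqr_ge0.
have p5 : (0 <= 64 * pair_const R d * pivot_const + 16)%R.
  by apply: addr_ge0 => //; apply: mulr_ge0 => //; rewrite mulr_ge0.
have q6 : (0 <= phi ^+ 5 * N.+1%:R ^+ 3 * eps ^+ 2)%R.
  by rewrite mulr_ge0 ?sqr_ge0// mulr_ge0// exprn_ge0.
have q5 : (0 <= phi ^+ 4 * N.+1%:R ^+ 2 * 8^-1 ^+ N)%R.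
  by rewrite mulr_ge0// mulr_ge0// exprn_ge0.
have K60 : (0 <= K6)%R by apply: mulr_ge0 => //; exact: mulr_ge0.
have K50 : (0 <= K5)%R by apply: mulr_ge0 => //; exact: mulr_ge0.
have B6le t : M (B6 t) <= K6%:E.
  case: t => [[[[[a b] c] e] f] g] /=; case: ifP => [u|_]; last by rewrite measure0 lee_fin.
  by apply: (le_trans (type0_le u)); rewrite lee_fin; exact: type0_simpl.
have B5le t : M (B5 t) <= K5%:E.
  case: t => s [[[[a b] c] e] f] /=; case: ifP => [u|_]; last by rewrite measure0 lee_fin.
  have h : type1_rhs <= K5%:E by rewrite lee_fin; exact: type1_simpl.
  by case: s; [exact: le_trans (type1a_le u) h|exact: le_trans (type1b_le u) h].
pose B (t : I6 + I5) := match t with inl t => B6 t | inr t => B5 t end.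
have mBt t : measurable (B t) by case: t => t; [exact: mB6|exact: mB5].
have mA : measurable (\bigcup_t B t).
  by apply: fin_bigcup_measurable => // t _; exact: mBt.
have cover z : (\bigcup_t B t) z -> exists t, B t z by move=> [t _ ?]; exists t.
exists (\bigcup_t B t); split=> // [z|].
  suff : [set z | linked_small_changes (eucl z) eps] z /\ cubes z -> exists t, B t z.
    by move=> h /h[t Bt]; exists t.
  move=> [[a [b [c [e [f [g [j1 j2 n1 n2]]]]]]] Qz].
  have gturn i j k l : gain (eucl z) j i l k = gain (eucl z) i j k l.
    by rewrite /gain /eucl (euclidean_sym (tnth z j)) (euclidean_sym (tnth z l)); ring.
  have gflip i j k l : gain (eucl z) k l i j = gain (eucl z) i j k l.
    by rewrite /gain /eucl (euclidean_sym (tnth z k) (tnth z i)) (euclidean_sym (tnth z l) (tnth z j)); ring.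
  have sh i j k l : small_change (eucl z) eps i j k l -> short_change i j k l z.
    by rewrite /small_change => /andP[_ /andP[g0 g1]]; split.
  have sht i j k l : small_change (eucl z) eps i j k l -> short_change j i l k z.
    rewrite /small_change => /andP[_ /andP[g0 g1]].
    by split; rewrite /= gturn.
  have shf i j k l : small_change (eucl z) eps i j k l -> short_change k l i j z.
    rewrite /small_change => /andP[_ /andP[g0 g1]].
    by split; rewrite /= gflip.
  have u1 : uniq [:: a; b; c; e] by move: j1 => /andP[].
  have u2 : uniq [:: a; c; f; g] by move: j2 => /andP[].
  have u1' : uniq [:: c; e; a; b] by rewrite -(rot_uniq 2).
  have grow (s : seq 'I_n) x : uniq s -> x \notin s -> uniq (rcons s x).
    by move=> us xs; rewrite rcons_uniq xs us.
  have ne := uniq4_neq u2.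
  (* At most one of [f], [g] lies in [{b, e}]. A coincidence with [e] is reduced to one with [b] by
     flipping the first change and turning the second, which exchanges [a] with [c] and [b] with
     [e]. *)
  have [fb|fb] := eqVneq f b.
    have ge : g != e by apply/eqP => ge; apply: n1.
    exists (inr (true, (a, b, c, e, g))) => /=.
    rewrite ifT; first by split=> //; split; [exact: sh|rewrite -fb; exact: sh].
    by apply: (grow [:: a; b; c; e]) => //; rewrite !inE -fb !ne (negbTE ge).
  have [fe|fe] := eqVneq f e.
    have gb : g != b by apply/eqP => gb; apply: n2.
    exists (inr (false, (c, e, a, b, g))) => /=.
    rewrite ifT; first by split=> //; split; [exact: shf|rewrite -fe; exact: sht].
    by apply: (grow [:: c; e; a; b]) => //; rewrite !inE -fe !ne (negbTE gb).
  have [gb|gb] := eqVneq g b.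
    exists (inr (false, (a, b, c, e, f))) => /=.
    rewrite ifT; first by split=> //; split; [exact: sh|rewrite -gb; exact: sh].
    by apply: (grow [:: a; b; c; e]) => //; rewrite !inE !ne (negbTE fb) (negbTE fe).
  have [ge|ge] := eqVneq g e.
    exists (inr (true, (c, e, a, b, f))) => /=.
    rewrite ifT; first by split=> //; split; [exact: shf|rewrite -ge; exact: sht].
    by apply: (grow [:: c; e; a; b]) => //; rewrite !inE !ne (negbTE fb) (negbTE fe).
  exists (inl (a, b, c, e, f, g)) => /=.
  rewrite ifT; first by split=> //; split; exact: sh.
  apply: (grow [:: a; b; c; e; f]).
    by apply: (grow [:: a; b; c; e]) => //; rewrite !inE !ne (negbTE fb) (negbTE fe).
  by rewrite !inE !ne (negbTE gb) (negbTE ge).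
apply: (le_trans (measure_fin_union_le M mA mBt cover)).
rewrite big_sumType /=.
apply: (@le_trans _ _ (\sum_(t : I6) K6%:E + \sum_(t : I5) K5%:E)).
  by apply: leeD; apply: lee_sum.
rewrite !sumEFin !sumr_const !card_prod card_bool !card_ord -EFinD lee_fin.
have E6 : (K6 *+ (n * n * n * n * n * n) = (d%:R + 2) * (64 * pair_const R d ^+ 2 + 16) *
    (N.+1%:R ^+ 2 * (n%:R ^+ 6 * phi ^+ 5 * N.+1%:R * 16^-1 ^+ N)))%R.
  have -> : (16^-1 ^+ N = eps ^+ 2 :> R)%R.
    by rewrite /eps -exprM mulnC exprM [(4^-1 ^+ 2)%R]expr2 -invfM -natrM.
  rewrite -[LHS]mulr_natr !natrM /K6; move: (pair_const R d) (N.+1%:R : R)%R => u v; ring.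
have E5 : (K5 *+ (2 * (n * n * n * n * n)) = (d%:R + 2) * (128 * pair_const R d * pivot_const + 32) *
    (N.+1%:R ^+ 2 * (n%:R ^+ 5 * phi ^+ 4 * 8^-1 ^+ N)))%R.
  rewrite -[LHS]mulr_natr !natrM /K5.
  move: (pair_const R d) pivot_const (N.+1%:R : R)%R (8^-1 ^+ N)%R => u v w t; ring.
rewrite E6 E5 /euclidean_const.
set X6 := (_ ^+ 2 * (n%:R ^+ 6 * _ * _ * _))%R; set X5 := (_ ^+ 2 * (n%:R ^+ 5 * _ * _))%R.
have X60 : (0 <= X6)%R.
  apply: mulr_ge0; first exact: sqr_ge0.
  apply: mulr_ge0; last by rewrite exprn_ge0// invr_ge0.
  by apply: mulr_ge0 => //; apply: mulr_ge0; exact: exprn_ge0.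
have X50 : (0 <= X5)%R.
  apply: mulr_ge0; first exact: sqr_ge0.
  by apply: mulr_ge0 => //; apply: mulr_ge0; exact: exprn_ge0.
rewrite -[leRHS]mulrA [(N.+1%:R ^+ 2 * (_ + _))%R]mulrDr -/X5 -/X6 mulrDr addrC.
have a0 : (0 <= 64 * pair_const R d ^+ 2)%R by rewrite mulr_ge0// sqr_ge0.
have b0 : (0 <= 128 * pair_const R d * pivot_const)%R by apply: mulr_ge0 => //; exact: mulr_ge0.
apply: lerD; apply: ler_wpM2r => //; apply: ler_wpM2l => //.
  by rewrite -!addrA [leRHS]addrCA lerD2l; move: a0; lra.
by rewrite -!addrA lerD2l; move: b0; lra.
Qed.

End euclidean_events.

(** * Linked pairs in Manhattan configurations *)

Section linear_forms.
Context (R : realType) (d : nat).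
Local Notation pt := (Rpoint R d).
Local Notation lam := (@unif_cube R d).
Local Notation unifxunif := (@unif R \x @unif R)%E.

(** One coordinate of each of two independent points is redrawn; Fubini moves the remaining
    coordinates of the second point outside. *)
Lemma product_coordinates_le (k l : 'I_d) (S : set (pt * pt)) (eta : R) :
  measurable S ->
  (forall x y, (unifxunif [set p | S (tupd x k p.1, tupd y l p.2)] <= eta%:E)%E) ->
  ((lam \x lam)%E S <= eta%:E)%E.
Proof.
move=> mS le.
have box := @unif_cube_box R d.
have mux (x : pt) : measurable_fun setT (fun q : measurableTypeR R * pt * measurableTypeR R =>
    (tupd x k q.1.1, tupd q.1.2 l q.2)).
  apply: measurable_fun_pair.
    apply: (measurableT_comp (measurable_tupd1 x k)).
    exact: (measurableT_comp measurable_fst).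
  apply: (measurableT_comp (measurable_tupd _ l) (f := fun p => tupd p.1 l p.2)
    (g := fun q : measurableTypeR R * pt * measurableTypeR R => (q.1.2, q.2))).
  apply: measurable_fun_pair; last exact: measurable_snd.
  exact: (measurableT_comp measurable_snd).
pose W x := [set q : measurableTypeR R * pt * measurableTypeR R |
  S (tupd x k q.1.1, tupd q.1.2 l q.2)].
have mW x : measurable (W x) by rewrite -[W x]setTI; exact: mux.
have mh x : measurable_fun setT (fun q : measurableTypeR R * pt => @unif R (xsection (W x) q)).
  exact: measurable_fun_xsection.
have mf : measurable_fun setT (fun x => lam (xsection S x)).
  exact: measurable_fun_xsection.
rewrite /product_measure1 /= (resample_integral (M := lam) (m := fun=> @unif R) box k mf)//.
apply: (@le_trans _ _ (\int[lam]_x eta%:E)%E); last first.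
  by rewrite integral_cst//= probability_setT mule1.
apply: ge0_le_integral => //.
- by move=> x _; exact: integral_ge0.
- apply: (measurable_fun_fubini_tonelli_F (fun p : pt * measurableTypeR R => lam (xsection S (tupd p.1 k p.2)))) => //.
  exact: (measurableT_comp mf (measurable_tupd _ k)).
move=> x _.
under eq_integral => s _.
  rewrite (resampleE (M := lam) (m := fun=> @unif R) box l); last exact: measurable_xsection.
  over.
rewrite (_ : (fun s => _) = fun s => \int[lam]_y @unif R (xsection (W x) (s, y)))%E; last first.
  apply/funext => s; apply: eq_integral => y _; congr (unif _).
rewrite (@fubini_tonelli _ _ _ _ _ (@unif R) lam (fun q => @unif R (xsection (W x) q)))//=.
apply: (@le_trans _ _ (\int[lam]_y eta%:E)%E); last first.
  by rewrite integral_cst//= probability_setT mule1.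
apply: ge0_le_integral => //.
- by move=> y _; exact: integral_ge0.
- exact: (measurable_fun_fubini_tonelli_G (fun q => @unif R (xsection (W x) q))).
move=> y _; apply: le_trans (le x y); rewrite /product_measure1 /= le_eqVlt.
apply/orP; left; apply/eqP; apply: eq_integral => s _; congr (@unif R _).
Qed.

(** [S] lies in a parallelogram of area [eps^2 / |det|]. The first form fixes the shear parameter
    [t + (a / b) * s], and on such a line the second form has slope [-det / b]. *)
Lemma unif_two_forms_le (S : set (measurableTypeR R * measurableTypeR R))
    (a b c e u v eps : R) : measurable S -> 0 <= eps -> b != 0 ->
  1 <= `|a * e - b * c| ->
  (forall s t, S (s, t) -> 0 <= a * s + b * t - u <= eps) ->
  (forall s t, S (s, t) -> 0 <= c * s + e * t - v <= eps) ->
  (unifxunif S <= (4 * eps ^+ 2)%:E)%E.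
Proof.
move=> mS eps0 b0 det1 h1 h2.
have nb : 0 < `|b| by rewrite normr_gt0.
have -> : 4 * eps ^+ 2 = 2 * (eps / `|b|) * (2 * (`|b| * eps)) by field; rewrite gt_eqF.
apply: (@unif_shear_le R S (a / b)) => //.
- by rewrite divr_ge0.
- by rewrite mulr_ge0// mulr_ge0.
- move=> [s t] [s' t'] /h1 q /h1 q' /=.
  have -> : t + a / b * s - (t' + a / b * s') =
     ((a * s + b * t - u) - (a * s' + b * t' - u)) / b by field.
  rewrite normrM normfV ler_wpM2r ?invr_ge0// ler_norml.
  by move: q q' => /andP[? ?] /andP[? ?]; lra.
move=> t; apply: lebesgue_diam_le.
- rewrite -[X in measurable X]setTI.
  have mg : measurable_fun setT (fun s : measurableTypeR R => (s, (t - a / b * s : measurableTypeR R))).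
    apply: measurable_fun_pair => //.
    by apply: measurable_funB; [exact: measurable_cst|exact: measurable_funM].
  exact: mg.
- by rewrite mulr_ge0.
move=> s s' /h2 q /h2 q'.
rewrite distrC in det1.
have D0 : b * c - a * e != 0 by rewrite -normr_gt0 (lt_le_trans _ det1).
have -> : s - s' = b / (b * c - a * e) * ((c * s + e * (t - a / b * s) - v) -
   (c * s' + e * (t - a / b * s') - v)).
  by field; rewrite b0 D0.
rewrite normrM normrM normfV -mulrA ler_wpM2l//.
apply: (@le_trans _ _ (1 * eps)); last by rewrite mul1r.
apply: ler_pM => //.
  by rewrite invf_le1// (lt_le_trans _ det1).
by rewrite ler_norml; move: q q' => /andP[? ?] /andP[? ?]; lra.
Qed.

Definition lin n (c : 'I_n -> 'I_d -> R) (z : n.-tuple pt) : R :=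
  \sum_(i < n) \sum_(k < d) c i k * crd (tnth z i) k.

Lemma measurable_lin n c : measurable_fun setT (@lin n c).
Proof.
apply: measurable_sum => i; apply: measurable_sum => k; apply: measurable_funM => //.
apply: (measurableT_comp (f := fun x : pt => crd x k) (g := fun z : n.-tuple pt => tnth z i)).
  exact: measurable_tnth.
exact: measurable_tnth.
Qed.

Definition set_crd n (z : n.-tuple pt) (p : 'I_n) (k : 'I_d) (s : R) : n.-tuple pt :=
  tupd z p (tupd (tnth z p) k s).

Lemma crd_set_crd n (z : n.-tuple pt) p k s i l :
  crd (tnth (set_crd z p k s) i) l =
  if (i == p) && (l == k) then s else crd (tnth z i) l.
Proof.
rewrite /set_crd tnth_tupd; case: eqVneq => [->|//] /=; exact: crd_tupd.
Qed.

Lemma config_ext n (z z' : n.-tuple pt) :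
  (forall i k, crd (tnth z i) k = crd (tnth z' i) k) -> z = z'.
Proof. by move=> h; apply: eq_from_tnth => i; apply: eq_from_tnth => k; exact: h. Qed.

Lemma set_crd_tupd n (z : n.-tuple pt) p k l x s t :
  set_crd (set_crd (tupd z p x) p k s) p l t = tupd z p (tupd (tupd x k s) l t).
Proof.
apply: config_ext => i e; rewrite !crd_set_crd !tnth_tupd.
by case: eqP => //= _; rewrite !crd_tupd.
Qed.

Lemma set_crd_tupd2 n (z : n.-tuple pt) p k q l x y s t : p != q ->
  set_crd (set_crd (tupd (tupd z p x) q y) p k s) q l t =
  tupd (tupd z p (tupd x k s)) q (tupd y l t).
Proof.
move=> pq; apply: config_ext => i e; rewrite !crd_set_crd !tnth_tupd.
case: (eqVneq i q) => [->|_] /=; first by rewrite [q == p]eq_sym (negbTE pq) /= crd_tupd.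
by case: eqP => //= _; rewrite crd_tupd.
Qed.

Lemma lin_set_crd n c (z : n.-tuple pt) p k s :
  lin c (set_crd z p k s) = lin c z + c p k * (s - crd (tnth z p) k).
Proof.
rewrite /lin (bigD1 p)//= [in RHS](bigD1 p)//= (bigD1 k)//= [in RHS](bigD1 k)//=.
rewrite crd_set_crd !eqxx /=.
under eq_bigr => l lk do rewrite crd_set_crd (negbTE lk) andbF.
under [X in _ + X = _]eq_bigr => i ip.
  under eq_bigr => l _ do rewrite crd_set_crd (negbTE ip).
  over.
ring.
Qed.

End linear_forms.

Section two_forms.
Local Open Scope ereal_scope.
Context (R : realType) (d n : nat) (phi : R).
Hypothesis (phi_ge1 : (1 <= phi)%R).
Local Notation pt := (Rpoint R d).
Local Notation cfg := (n.-tuple pt).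
Local Notation lam := (@unif_cube R d).
Variables (M : probability cfg R) (m : 'I_n -> probability pt R).
Hypothesis M_box : forall B, (forall i, measurable (B i)) ->
  M (tuple_box B) = \prod_(i < n) m i (B i).
Hypothesis dom : forall i A, measurable A -> m i A <= phi%:E * lam A.

Let phi0 : (0 <= phi)%R. Proof. exact: le_trans phi_ge1. Qed.

(** The two coordinates of a nonzero minor are redrawn. If [c1 q l] vanishes, the minor reduces to
    the other product, so exchanging the roles makes the pivot coefficient nonzero. *)
Lemma two_forms_le (c1 c2 : 'I_n -> 'I_d -> R) p k q l (A : set cfg) (eps : R) :
  measurable A -> (0 <= eps)%R -> (1 <= `|c1 p k * c2 q l - c1 q l * c2 p k|)%R ->
  (forall z, A z -> (0 <= lin c1 z <= eps)%R /\ (0 <= lin c2 z <= eps)%R) ->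
  M A <= (4 * phi ^+ 2 * eps ^+ 2)%:E.
Proof.
move=> mA eps0 det1 hA.
wlog nz : p k q l det1 / c1 q l != 0%R.
  move=> wl; have [z|] := eqVneq (c1 q l) 0%R; last exact: (wl p k q l det1).
  apply: (wl q l p k); first by rewrite distrC.
  by apply: contraTneq det1 => z'; rewrite z z' !mul0r subrr normr0 -ltNge.
have e40 : (0 <= 4 * eps ^+ 2)%R by rewrite mulr_ge0// exprn_ge0.
have key w (S : set (measurableTypeR R * measurableTypeR R)) : measurable S ->
    (forall r, S r -> A (set_crd (set_crd w p k r.1) q l r.2)) -> (p, k) != (q, l) ->
    (@unif R \x @unif R)%E S <= (4 * eps ^+ 2)%:E.
  move=> mS SA pq.
  have ev c s t : lin c (set_crd (set_crd w p k s) q l t) =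
     (c p k * s + c q l * t - (c p k * crd (tnth w p) k + c q l * crd (tnth w q) l - lin c w))%R.
    rewrite !lin_set_crd crd_set_crd ifF; first by ring.
    by apply/negbTE; move: pq; rewrite xpair_eqE [q == p]eq_sym [l == k]eq_sym.
  apply: (unif_two_forms_le mS eps0 nz det1).
  - by move=> s t /SA/hA[h _]; move: h; rewrite ev; exact.
  - by move=> s t /SA/hA[_ h]; move: h; rewrite ev; exact.
have mT := @measurableT _ cfg.
have Q0 : M (~` setT) = 0 by rewrite setCT measure0.
(* Both coordinates may belong to one point. Then the density bound enters only once, and
   [phi <= phi ^ 2]. *)
have [pq|pq] := eqVneq p q.
  have kl : (p, k) != (q, l).
    apply: contraTneq det1 => -[-> ->]; by rewrite subrr normr0 -ltNge.
  have := slice1_le (i := p) phi0 M_box dom e40 mT mA mT Q0.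
  rewrite probability_setT mule1 => le1.
  apply: (@le_trans _ _ (phi * (4 * eps ^+ 2))%:E).
    apply: le1 => // z _ _; apply: (cube_slice2 (k := k) (l := l)) => //.
      exact: measurable_slice.
    move=> x _; apply: (key (tupd z p x)) => //.
      by apply: measurable_slice2; exact: measurable_slice.
    by move=> r /=; rewrite -pq set_crd_tupd.
  rewrite lee_fin mulrCA mulrA ler_wpM2r ?sqr_ge0// ler_wpM2l//.
  by rewrite -{1}[phi]expr1 ler_weXn2l.
have pqkl : (p, k) != (q, l) by rewrite xpair_eqE (negbTE pq).
have -> : (4 * phi ^+ 2 * eps ^+ 2 = phi ^+ 2 * (4 * eps ^+ 2))%R by ring.
rewrite -[leRHS]mule1 -(probability_setT M).
apply: (slice2_le (i := p) (j := q) phi0 M_box dom e40 mT mA mT Q0) => // z _ _.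
apply: (product_coordinates_le (k := k) (l := l)); first exact: measurable_slice2.
move=> x y; apply: (key (tupd (tupd z p x) q y)) => //; last first.
  by move=> r /=; rewrite set_crd_tupd2.
rewrite -[X in measurable X]setTI.
apply: (@measurable_fun_pair _ _ _ _ _ _ (fun r : measurableTypeR R * measurableTypeR R => tupd x k r.1)
  (fun r => tupd y l r.2)) => //.
- exact: (measurableT_comp (measurable_tupd1 x k)).
- exact: (measurableT_comp (measurable_tupd1 y l)).
- exact: measurable_slice2.
Qed.

End two_forms.

Section parallel_gains.
Context (R : realType) (V : finType) (u : V -> R) (s : V -> V -> bool) (lambda : R).

Let S x y : R := (-1) ^+ s x y.
Hypothesis S_ge0 : forall x y, 0 <= S x y * (u x - u y).
Let coef i x y : R := S x y * ((i == x)%:R - (i == y)%:R).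

Let sgnP x y : S x y = 1 \/ S x y = -1.
Proof. by rewrite /S; case: (s x y); [right|left]. Qed.

Let scale0 (c x : R) : 0 < c -> c * x = 0 -> x = 0.
Proof. by move=> c0 /eqP; rewrite mulf_eq0 gt_eqF//= => /eqP. Qed.

(* One coordinate of two linked gains whose linear forms are proportional: then
   the coordinate contributes nothing positive to the first gain. *)
Lemma parallel_gain_le0 a b c e f g : 0 < lambda ->
  uniq [:: a; b; c; e] -> uniq [:: a; c; f; g] ->
  ~ (f = b /\ g = e) -> ~ (f = e /\ g = b) ->
  (forall i, gain (coef i) a c f g = lambda * gain (coef i) a b c e) ->
  gain (fun x y => S x y * (u x - u y)) a b c e <= 0.
Proof.
move=> l0 u1 u2 n1 n2 H.
have l1 : 0 < 1 + lambda by rewrite addr_gt0.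
have grow (t : seq V) x : uniq t -> x \notin t -> uniq (rcons t x).
  by move=> us xs; rewrite rcons_uniq xs us.
have ne := uniq4_neq u2.
have [fb|fb] := eqVneq f b.
  subst f; have ge : g != e by apply/eqP => ge; apply: n1.
  have /uniq5_neq nn : uniq [:: a; b; c; e; g].
    by apply: (grow [:: a; b; c; e]) => //; rewrite !inE !ne (negbTE ge).
  (* [e] is absent from the second change, so its coefficient in the first vanishes. At [a] the two
     changes have opposite coefficients, so a positive ratio forces both to be 0. *)
  move: (H a) (H b) (H e) (S_ge0 a b).
  rewrite /gain /coef !eqxx !nn /= {H ne nn n1 n2 grow u1 u2} => Ha Hb He h.
  have Ee : S c e = S b e.
    by apply/eqP; rewrite -subr_eq0; apply/eqP/(scale0 l0); lra.
  have Ea : S a c = S a b.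
    by apply/eqP; rewrite -subr_eq0; apply/eqP/(scale0 l1); lra.
  rewrite Ee Ea; move: Hb h; rewrite {Ha He Ee Ea}.
  by case: (sgnP a b) => ->; case: (sgnP b e) => ->;
    case: (sgnP b g) => ->; lra.
have [fe|fe] := eqVneq f e.
  subst f; have gb : g != b by apply/eqP => gb; apply: n2.
  have /uniq5_neq nn : uniq [:: a; b; c; e; g].
    by apply: (grow [:: a; b; c; e]) => //; rewrite !inE !ne (negbTE gb).
  move: (H b) (H e) (S_ge0 a c) (S_ge0 a e) (S_ge0 c e).
  rewrite /gain /coef !eqxx !nn /= {H ne nn n1 n2 grow u1 u2} => Hb He hac.
  have -> : S a b = - S b e.
    by apply/eqP; rewrite -addr_eq0; apply/eqP/(scale0 l0); lra.
  move: He hac.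
  by case: (sgnP c e) => ->; case: (sgnP b e) => ->; case: (sgnP a c) => ->; try lra;
    case: (sgnP e g) => ->; case: (sgnP a e) => ->; lra.
have [gb|gb] := eqVneq g b.
  subst g.
  have /uniq5_neq nn : uniq [:: a; b; c; e; f].
    by apply: (grow [:: a; b; c; e]) => //; rewrite !inE !ne (negbTE fe).
  move: (H b) (H e) (S_ge0 a c) (S_ge0 a b) (S_ge0 c b).
  rewrite /gain /coef !eqxx !nn /= {H ne nn n1 n2 grow u1 u2} => Hb He hac.
  have -> : S c e = S b e.
    by apply/eqP; rewrite -subr_eq0; apply/eqP/(scale0 l0); lra.
  move: Hb hac.
  by case: (sgnP b e) => ->; case: (sgnP a b) => ->; case: (sgnP a c) => ->; try lra;
   case: (sgnP f b) => ->; case: (sgnP c b) => ->; lra.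
have [ge|ge] := eqVneq g e.
  subst g.
  have /uniq5_neq nn : uniq [:: a; b; c; e; f].
    by apply: (grow [:: a; b; c; e]) => //; rewrite !inE !ne (negbTE fb).
  move: (H b) (H c) (H e).
  rewrite /gain /coef !eqxx !nn /= {H ne nn n1 n2 grow u1 u2} => Hb Hc.
  have -> : S a b = - S b e.
    by apply/eqP; rewrite -addr_eq0; apply/eqP/(scale0 l0); lra.
  have -> : S c e = - S a c.
    by apply/eqP; rewrite -addr_eq0; apply/eqP/(scale0 l1); lra.
  by case: (sgnP b e) => ->; case: (sgnP a c) => ->; case: (sgnP f e) => ->; lra.
have /uniq6_neq nn : uniq [:: a; b; c; e; f; g].
  apply: (grow [:: a; b; c; e; f]).
    by apply: (grow [:: a; b; c; e]) => //; rewrite !inE !ne (negbTE fb) (negbTE fe).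
  by rewrite !inE !ne (negbTE gb) (negbTE ge).
(* [b] and [e] occur in the first change only, so their coefficients there vanish. *)
move: (H b) (H e) (S_ge0 a c).
rewrite /gain /coef !eqxx !nn /= {H ne nn n1 n2 grow u1 u2} => Hb He.
have -> : S a b = - S b e.
  by apply/eqP; rewrite -addr_eq0; apply/eqP/(scale0 l0); lra.
have -> : S c e = S b e.
  by apply/eqP; rewrite -subr_eq0; apply/eqP/(scale0 l0); lra.
by case: (sgnP a c) => ->; case: (sgnP b e) => ->; lra.
Qed.
End parallel_gains.

Section manhattan_events.
Local Open Scope ereal_scope.
Context (R : realType) (d n : nat) (phi : R).
Hypothesis (phi_ge1 : (1 <= phi)%R).
Local Notation pt := (Rpoint R d).
Local Notation cfg := (n.-tuple pt).
Local Notation lam := (@unif_cube R d).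
Local Notation signs := {ffun 'I_d -> bool}.
Variables (M : probability cfg R) (m : 'I_n -> probability pt R).
Hypothesis M_box : forall B, (forall i, measurable (B i)) ->
  M (tuple_box B) = \prod_(i < n) m i (B i).
Hypothesis dom : forall i A, measurable A -> m i A <= phi%:E * lam A.

(** The sign vector is a free parameter, not read off from the configuration: a gain becomes a fixed
    linear form, and the actual signs are covered by a union bound. *)
Let ecoef (t : signs) (x y i : 'I_n) (k : 'I_d) : R :=
  ((-1) ^+ t k * ((i == x)%:R - (i == y)%:R))%R.

Let gcoef (t0 t1 t2 t3 : signs) (a b c e i : 'I_n) (k : 'I_d) : R :=
  (ecoef t0 a b i k + ecoef t1 c e i k - ecoef t2 a c i k - ecoef t3 b e i k)%R.

Let gcoef_int t0 t1 t2 t3 a b c e i k : gcoef t0 t1 t2 t3 a b c e i k \is a Num.int.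
Proof. by rewrite /gcoef /ecoef !(rpredB, rpredD, rpredM, rpred_sign, rpred_nat). Qed.

Let sum_delta (x : 'I_n) (f : 'I_n -> R) : (\sum_i (i == x)%:R * f i = f x)%R.
Proof.
rewrite (bigD1 x)//= eqxx mul1r big1 ?addr0// => i /negbTE ->; exact: mul0r.
Qed.

Let lin_ecoef t x y (z : cfg) :
  (lin (ecoef t x y) z = \sum_k (-1) ^+ t k * (crd (tnth z x) k - crd (tnth z y) k))%R.
Proof.
rewrite /lin exchange_big; apply: eq_bigr => k _.
under eq_bigr => i _ do rewrite /ecoef -mulrA mulrBl.
by rewrite -mulr_sumr sumrB !sum_delta.
Qed.

Let lin_gcoef t0 t1 t2 t3 a b c e (z : cfg) :
  (lin (gcoef t0 t1 t2 t3 a b c e) z =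
   lin (ecoef t0 a b) z + lin (ecoef t1 c e) z - lin (ecoef t2 a c) z - lin (ecoef t3 b e) z)%R.
Proof.
rewrite /lin -!big_split/= -!sumrB; apply: eq_bigr => i _.
rewrite -!big_split/= -!sumrB; apply: eq_bigr => k _; rewrite /gcoef; ring.
Qed.

Let sg (z : cfg) i j : signs := [ffun k => (crd (tnth z i) k < crd (tnth z j) k)%R].

Let sgE (z : cfg) i j k : ((-1) ^+ sg z i j k * (crd (tnth z i) k - crd (tnth z j) k) =
  `|crd (tnth z i) k - crd (tnth z j) k|)%R.
Proof.
rewrite ffunE; case: ltP => h; rewrite ?expr1 ?expr0 ?mulN1r ?mul1r.
  by rewrite ltr0_norm// subr_lt0.
by rewrite ger0_norm// subr_ge0.
Qed.

Let lin_sg (z : cfg) i j : lin (ecoef (sg z i j) i j) z = manh z i j.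
Proof. by rewrite lin_ecoef; apply: eq_bigr => k _; rewrite sgE. Qed.

Let tcoef z a b c e := gcoef (sg z a b) (sg z c e) (sg z a c) (sg z b e) a b c e.

Let lin_tcoef z a b c e : lin (tcoef z a b c e) z = gain (manh z) a b c e.
Proof. by rewrite lin_gcoef !lin_sg. Qed.

Let minor_exists z a b c e f g :
  uniq [:: a; b; c; e] -> uniq [:: a; c; f; g] ->
  ~ (f = b /\ g = e) -> ~ (f = e /\ g = b) ->
  (0 < gain (manh z) a b c e)%R -> (0 < gain (manh z) a c f g)%R ->
  exists p k q l, (tcoef z a b c e p k * tcoef z a c f g q l -
    tcoef z a b c e q l * tcoef z a c f g p k != 0)%R.
Proof.
move=> u1 u2 n1 n2 g1 g2; apply: contrapT => nex.
have prop p k q l : (tcoef z a b c e p k * tcoef z a c f g q l =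
    tcoef z a b c e q l * tcoef z a c f g p k)%R.
  apply/eqP; rewrite -subr_eq0; apply: contrapT => /negP h; apply: nex.
  by exists p, k, q, l.
move: g1 g2; rewrite -!lin_tcoef => g1 g2.
have [p [k nz]] : exists p k, tcoef z a b c e p k != 0%R.
  apply: contrapT => nz; move: g1; rewrite /lin big1 ?ltxx// => i _; rewrite big1// => j _.
  have -> : tcoef z a b c e i j = 0%R; last by rewrite mul0r.
  by apply/eqP; apply: contrapT => /negP h; apply: nz; exists i, j.
pose r : R := (tcoef z a c f g p k / tcoef z a b c e p k)%R.
have rE q l : tcoef z a c f g q l = (r * tcoef z a b c e q l)%R.
  by rewrite /r mulrAC [X in (X / _)%R]mulrC -prop mulrC mulKf.
(* The ratio of the two forms equals the ratio of the two gains, which are both positive. *)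
have r0 : (0 < r)%R.
  move: g2; have -> : lin (tcoef z a c f g) z = (r * lin (tcoef z a b c e) z)%R.
    rewrite /lin mulr_sumr; apply: eq_bigr => i _; rewrite mulr_sumr; apply: eq_bigr => j _.
    by rewrite rE mulrA.
  by rewrite pmulr_lgt0.
move: g1; rewrite ltNge => /negP; apply.
rewrite lin_gcoef !lin_ecoef -!big_split/= -!sumrB; apply: sumr_le0 => l _.
pose s i j := sg z i j l.
have s0 x y : (0 <= (-1) ^+ s x y * (crd (tnth z x) l - crd (tnth z y) l))%R by rewrite sgE.
have := @parallel_gain_le0 R _ (fun i => crd (tnth z i) l) s r s0 a b c e f g r0 u1 u2 n1 n2.
by apply=> i; exact: (rE i l).
Qed.

(** One sign vector for each of the seven edges of a linked pair, the common edge being counted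
    once; the factor 4 is that of [two_forms_le]. *)
Definition manhattan_const : R := (4 * (2 ^+ d) ^+ 7)%R.

Lemma manhattan_linked_le (eps : R) : (0 <= eps)%R -> exists A : set cfg,
  [/\ measurable A, [set z | linked_small_changes (manh z) eps] `<=` A &
  M A <= (manhattan_const * n%:R ^+ 6 * phi ^+ 2 * eps ^+ 2)%:E].
Proof.
move=> eps0.
pose I : finType := (('I_n * 'I_n * 'I_n * 'I_n * 'I_n * 'I_n) *
  (signs * signs * signs * signs * signs * signs * signs))%type.
pose form1 (t : I) := let: ((a, b, c, e, f, g), (ab, ce, ac, be, fg, af, cg)) := t in
  gcoef ab ce ac be a b c e.
pose form2 (t : I) := let: ((a, b, c, e, f, g), (ab, ce, ac, be, fg, af, cg)) := t in
  gcoef ac fg af cg a c f g.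
have int1 t i j : form1 t i j \is a Num.int.
  by move: t => [[[[[[a b] c] e] f] g] [[[[[[ab ce] ac] be] fg] af] cg]]; exact: gcoef_int.
have int2 t i j : form2 t i j \is a Num.int.
  by move: t => [[[[[[a b] c] e] f] g] [[[[[[ab ce] ac] be] fg] af] cg]]; exact: gcoef_int.
pose minor (t : I) p k q l := (form1 t p k * form2 t q l - form1 t q l * form2 t p k)%R.
pose B (t : I) : set cfg := if [exists p, exists k, exists q, exists l, minor t p k q l != 0%R]
  then ([set z | (0 <= lin (form1 t) z)%R] `&` [set z | (lin (form1 t) z <= eps)%R]) `&`
       ([set z | (0 <= lin (form2 t) z)%R] `&` [set z | (lin (form2 t) z <= eps)%R])
  else set0.
have mB t : measurable (B t).
  rewrite /B; case: ifP => // _.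
  apply: measurableI; apply: measurableI; apply: measurable_le_set;
    by [exact: measurable_cst|exact: measurable_lin].
have Ble t : M (B t) <= (4 * phi ^+ 2 * eps ^+ 2)%:E.
  have [h|h] := boolP [exists p, exists k, exists q, exists l, minor t p k q l != 0%R]; last first.
    by rewrite /B (negbTE h) measure0 lee_fin mulr_ge0 ?sqr_ge0// mulr_ge0 ?sqr_ge0.
  have mBt := mB t.
  move: h => /[dup] h /existsP[p /existsP[k /existsP[q /existsP[l nz]]]].
  apply: (two_forms_le phi_ge1 M_box dom (c1 := form1 t) (c2 := form2 t) (p := p) (k := k) (q := q) (l := l)) => //.
    (* The coefficients are integers, so a nonzero minor has absolute value at least 1. *)
    apply: norm_intr_ge1 => //.
    by rewrite rpredB// rpredM.
  by move=> z; rewrite /B h => -[[/= h1 h2] [h3 h4]]; rewrite h1 h2 h3 h4.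
have mA : measurable (\bigcup_t B t).
  by apply: fin_bigcup_measurable => // t _; exact: mB.
have cover z : (\bigcup_t B t) z -> exists t, B t z by move=> [t _ ?]; exists t.
exists (\bigcup_t B t); split=> // [z|].
  move=> [a [b [c [e [f [g [/andP[u1 /andP[g1 e1]] /andP[u2 /andP[g2 e2]] n1 n2]]]]]]].
  pose t : I := ((a, b, c, e, f, g), (sg z a b, sg z c e, sg z a c, sg z b e, sg z f g, sg z a f, sg z c g)).
  exists t => //; rewrite /B ifT.
    rewrite /= -/(tcoef z a b c e) -/(tcoef z a c f g) !lin_tcoef.
    by split; split => //=; exact: ltW.
  have [p [k [q [l nz]]]] := minor_exists u1 u2 n1 n2 g1 g2.
  by apply/existsP; exists p; apply/existsP; exists k; apply/existsP; exists q; apply/existsP; exists l.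
apply: (le_trans (measure_fin_union_le_cst mA mB cover Ble)).
rewrite lee_fin le_eqVlt; apply/orP; left; apply/eqP.
rewrite !card_prod !card_ord !card_ffun card_bool card_ord !natrM natrX /manhattan_const.
move: (2 ^+ d)%R => u; ring.
Qed.

End manhattan_events.

(** * Tours in the unit cube *)

Section metrics.
Context (R : realType) (d : nat).
Local Notation pt := (Rpoint R d).
Implicit Types (p q r : pt).

Lemma manhattan_triangle p q r : manhattan p r <= manhattan p q + manhattan q r.
Proof.
by rewrite /manhattan -big_split/=; apply: ler_sum => k _; exact: ler_distD.
Qed.

Lemma manhattan_xx p : manhattan p p = 0.
Proof. by rewrite /manhattan big1// => k _; rewrite subrr normr0. Qed.

Lemma euclidean_xx p : euclidean p p = 0.
Proof. by rewrite /euclidean big1 ?sqrtr0// => k _; rewrite subrr expr0n. Qed.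

Lemma euclidean_eq0 p q : euclidean p q = 0 -> p = q.
Proof.
move=> pq0; apply: eq_from_tnth => k; apply/eqP.
by rewrite -subr_eq0 -normr_le0 -pq0; exact: crd_le_euclidean.
Qed.

Lemma euclidean_triangle p q r : euclidean p r <= euclidean p q + euclidean q r.
Proof.
have [/euclidean_eq0 ->|pq] := eqVneq (euclidean p q) 0; first by rewrite euclidean_xx add0r.
have [/euclidean_eq0 ->|qr] := eqVneq (euclidean q r) 0; first by rewrite euclidean_xx addr0.
have U0 : 0 < euclidean p q by rewrite lt_neqAle eq_sym pq euclidean_ge0.
have V0 : 0 < euclidean q r by rewrite lt_neqAle eq_sym qr euclidean_ge0.
rewrite -(ler_pXn2r (n := 2))// ?nnegrE ?addr_ge0 ?euclidean_ge0//.
rewrite sqrrD !sqr_euclidean.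
set U := euclidean p q in U0 *; set V := euclidean q r in V0 *.
(* Cauchy-Schwarz, termwise from [2 * u * v <= (V / U) * u^2 + (U / V) * v^2]; with these weights
   each of the two sums equals [U * V]. *)
have cs : 2 * (\sum_k (crd p k - crd q k) * (crd q k - crd r k)) <= U * V *+ 2.
  have -> : U * V *+ 2 = V / U * \sum_k (crd p k - crd q k) ^+ 2 +
      U / V * \sum_k (crd q k - crd r k) ^+ 2.
    rewrite -!sqr_euclidean -/U -/V mulr2n; congr (_ + _); field; exact: lt0r_neq0.
  rewrite !mulr_sumr -big_split/=; apply: ler_sum => k _.
  set u := (crd p k - _); set v := (crd q k - _).
  rewrite -subr_ge0 (_ : _ - _ = U * V * (u / U - v / V) ^+ 2).
    by apply: mulr_ge0 (sqr_ge0 _); rewrite mulr_ge0// ltW.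
  by field; rewrite !lt0r_neq0.
apply: (@le_trans _ _ (\sum_k (crd p k - crd q k) ^+ 2 +
    2 * (\sum_k (crd p k - crd q k) * (crd q k - crd r k)) +
    \sum_k (crd q k - crd r k) ^+ 2)); last by rewrite lerD2r lerD2l.
rewrite mulr_sumr -!big_split/= le_eqVlt; apply/orP; left; apply/eqP.
by apply: eq_bigr => k _; ring.
Qed.

End metrics.

Section tour_in_cube.
Context (R : realType) (d n : nat).
Local Notation pt := (Rpoint R d).
Hypothesis hd : (2 <= d)%N.
Variable dist : pt -> pt -> R.
Hypotheses (dist_sym : forall x y, dist x y = dist y x)
  (dist_tri : forall x y z, dist x z <= dist x y + dist y z)
  (dist_xx : forall x, dist x x = 0)
  (dist_manhattan : forall x y, dist x y <= manhattan x y).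
Variable z : 'I_n -> pt.
Hypothesis z_cube : forall i, unit_cube (z i).

(** Each axis needs [2 ^ j + 1] values, as the coordinate 1 is sent to [2 ^ j]. *)
Let cell j (i : 'I_n) : {ffun 'I_d -> 'I_(2 ^ j).+1} :=
  [ffun k => inord (Num.truncn (2 ^+ j * crd (z i) k))].

Let cell_dist j x y : cell j x = cell j y -> dist (z x) (z y) <= d%:R / 2 ^+ j.
Proof.
move=> exy; apply: (le_trans (dist_manhattan _ _)).
have -> : d%:R / 2 ^+ j = \sum_(k < d) (2 ^+ j)^-1 :> R.
  by rewrite sumr_const card_ord mulr_natl.
apply: ler_sum => k _; have /ffunP/(_ k) := exy; rewrite !ffunE => /(congr1 val).
have j0 : 0 < 2 ^+ j :> R by rewrite exprn_gt0.
have bound i : 0 <= 2 ^+ j * crd (z i) k <= 2 ^+ j.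
  have /andP[h0 h1] := z_cube i k.
  by rewrite mulr_ge0 ?(ltW j0)//= ler_piMr// ltW.
have small i : (Num.truncn (2 ^+ j * crd (z i) k) < (2 ^ j).+1)%N.
  rewrite ltnS -(ler_nat R) natrX (le_trans _ (proj2 (andP (bound i))))//.
  by rewrite truncn_le; case/andP: (bound i).
rewrite /= !inordK//.
have /andP[b1 _] := bound x; have /andP[b2 _] := bound y.
move=> e; have /andP[x1 x2] := truncn_itv b1; have /andP[y1 y2] := truncn_itv b2.
have succ (t : nat) : t.+1%:R = t%:R + 1 :> R by rewrite -addn1 natrD.
rewrite e in x1 x2; rewrite (succ (Num.truncn _)) in x2 y2.
rewrite -(ler_pM2l j0) mulfV ?gt_eqF// -[X in X * `|_|]gtr0_norm// -normrM mulrBr.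
by rewrite -/(crd (z x) k) -/(crd (z y) k) ler_norml; lra.
Qed.

Let geometric J : \sum_(j < J.+1) (2 ^+ d.-1) ^+ j <= 2 * (2 ^+ d.-1) ^+ J :> R.
Proof.
have q2 : 2 <= 2 ^+ d.-1 :> R by rewrite -[leLHS]expr1 ler_weXn2l// ?ler1n//; case: d hd => [|[]].
have q0 j : 0 <= (2 ^+ d.-1) ^+ j :> R by rewrite !exprn_ge0.
elim: J => [|J IH]; first by rewrite big_ord1 expr0 mulr1 ler1n.
rewrite big_ord_recr/= mulrDl mul1r lerD2r (le_trans IH)// exprS.
by rewrite ler_wpM2r.
Qed.

Definition tour_const : R := 2 * d%:R * (1 + 4 * (2 ^+ d) ^+ 2).

(** Level [j] has at most [(2^d)^(j+1)] cells, each charged [2 * d / 2^j]. This is geometric in [j]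
    with ratio [2^(d-1) >= 2], so the last level dominates. *)
Lemma insertion_tour_length_le T :
  insertion_tour (fun i j => dist (z i) (z j)) T ->
  tour_length (fun i j => dist (z i) (z j)) T <= tour_const * (n%:R `^ (1 - d%:R^-1)).
Proof.
move=> [iT allT]; have uT := insertion_subtour_uniq iT.
have sT : size T = n.
  by rewrite -(card_uniqP uT) -[RHS]card_ord; apply: eq_card => i; rewrite allT.
have n0 : (0 < n)%N by case: iT => [v|? ? ? v _ _ _]; exact: leq_ltn_trans (ltn_ord v).
have d0 : 0 < d%:R :> R by rewrite ltr0n (leq_trans _ hd).
pose nu : R := n%:R `^ d%:R^-1.
have nR0 : 0 < n%:R :> R by rewrite ltr0n.
have nu0 : 0 < nu by rewrite powR_gt0.
have nud : nu ^+ d = n%:R.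
  by rewrite /nu -powR_mulrn ?powR_ge0// -powRrM mulVf ?gt_eqF// powRr1// ltW.
have wE : n%:R `^ (1 - d%:R^-1) = n%:R / nu.
  rewrite powRD; last by apply/implyP => _; rewrite gt_eqF.
  by rewrite powRr1 ?ltW// powRN.
have wE' : n%:R / nu = nu ^+ d.-1.
  rewrite -nud -[X in nu ^+ X / _]prednK ?exprSr ?mulfK ?gt_eqF//.
  exact: leq_trans hd.
(* The least such [J] makes [2^J] equal to [n^(1/d)] up to a factor 2. Then both the charge of level
   [J] and [n * d / 2^J] are of order [n^(1-1/d)]. *)
have exJ : exists J, (n <= (2 ^ J) ^ d)%N.
  exists n; rewrite (leq_trans (ltnW (ltn_expl n (isT : 1 < 2)%N)))//.
  by rewrite -{1}[(2 ^ n)%N]expn1 leq_pexp2l ?expn_gt0// (leq_trans _ hd).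
case: (ex_minnP exJ) => J nJ Jmin.
have J1 : nu <= 2 ^+ J.
  by rewrite -(ler_pXn2r (n := d)) ?nnegrE ?(ltW nu0) ?exprn_ge0// ?nud -?natrX ?ler_nat// (leq_trans _ hd).
have J2 : 2 ^+ J <= 2 * nu.
  case: J nJ Jmin J1 => [|J] nJ Jmin _.
    rewrite expr0; have n1 : 1 <= n%:R :> R by rewrite ler1n.
    have : 1 <= nu by rewrite -(ler_pXn2r (n := d)) ?nnegrE ?(ltW nu0)// ?expr1n ?nud// (leq_trans _ hd).
    by lra.
  rewrite exprS ler_pM2l// -(ler_pXn2r (n := d)) ?nnegrE ?(ltW nu0) ?exprn_ge0//; last exact: leq_trans hd.
  rewrite nud -!natrX ler_nat ltnW// ltnNge; apply/negP => /Jmin; by rewrite ltnn.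
have := @insertion_subtour_length R _ (fun i j => dist (z i) (z j))
  (fun x y => dist_sym _ _) (fun x y w => dist_tri _ _ _) (fun x => dist_xx _)
  (fun j => {ffun 'I_d -> 'I_(2 ^ j).+1}) cell d%:R J
  (fun x y => le_trans (dist_manhattan _ _) (manhattan_cube (z_cube x) (z_cube y)))
  cell_dist T iT.
move=> /le_trans; apply; rewrite sT wE.
have occ j : 2 * d%:R / 2 ^+ j * #|(cell j @: T)%SET|%:R <=
    2 * d%:R * 2 ^+ d * (2 ^+ d.-1) ^+ j :> R.
  have j0 : 0 < 2 ^+ j :> R by rewrite exprn_gt0.
  apply: (@le_trans _ _ (2 * d%:R / 2 ^+ j * ((2 ^+ d) * (2 ^+ d) ^+ j))).
    apply: ler_wpM2l; first by rewrite divr_ge0 ?mulr_ge0// ltW.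
    apply: (@le_trans _ _ (#|{ffun 'I_d -> 'I_(2 ^ j).+1}|%:R)).
      by rewrite ler_nat max_card.
    rewrite card_ffun !card_ord -exprS -exprM mulnC exprM -!natrX ler_nat leq_exp2r ?(leq_trans _ hd)//.
    by rewrite expnS mul2n -addnn -addn1 leq_add2l expn_gt0.
  have -> : 2 ^+ d = 2 * 2 ^+ d.-1 :> R by rewrite -exprS prednK// (leq_trans _ hd).
  rewrite [X in _ * (_ * X)]exprMn le_eqVlt; apply/orP; left; apply/eqP.
  by move: (2 ^+ d.-1) (2 ^+ j) j0 => a b b0; field; rewrite gt_eqF.
have S_le : \sum_(j < J.+1) 2 * d%:R / 2 ^+ j * #|(cell j @: T)%SET|%:R <=
    4 * d%:R * (2 ^+ d) ^+ 2 * (n%:R / nu).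
  apply: (@le_trans _ _ (\sum_(j < J.+1) 2 * d%:R * 2 ^+ d * (2 ^+ d.-1) ^+ j)).
    by apply: ler_sum => j _; exact: occ.
  rewrite -mulr_sumr (le_trans (ler_wpM2l _ (geometric J)))//.
  rewrite wE'; have : (2 ^+ d.-1) ^+ J <= 2 ^+ d * nu ^+ d.-1.
    rewrite -exprM mulnC exprM (@le_trans _ _ ((2 * nu) ^+ d.-1))//.
      by rewrite lerXn2r ?nnegrE ?exprn_ge0 ?mulr_ge0 ?(ltW nu0).
    rewrite exprMn ler_wpM2r ?exprn_ge0 ?(ltW nu0)// ler_weXn2l ?ler1n//.
    exact: leq_pred.
  move: ((2 ^+ d.-1) ^+ J) (2 ^+ d) (nu ^+ d.-1) (exprn_ge0 d (ler0n R 2)) => a b c b0 h.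
  rewrite (_ : 4 * _ * _ * _ = 2 * d%:R * b * (2 * (b * c))); last by ring.
  by rewrite ler_wpM2l ?mulr_ge0// ler_pM2l.
have n_le : n%:R * (d%:R / 2 ^+ J) <= d%:R * (n%:R / nu).
  rewrite mulrCA ler_wpM2l// ler_wpM2l// lef_pV2// posrE exprn_gt0//.
apply: (le_trans (ler_wpM2l _ (lerD n_le S_le))) => //.
rewrite /tour_const le_eqVlt; apply/orP; left; apply/eqP.
move: (n%:R / nu) (2 ^+ d) => u v; ring.
Qed.

End tour_in_cube.

(** * Expected number of steps *)

Section lower_integral.
Local Open Scope ereal_scope.
Context (R : realType) (dOm : measure_display) (Om : measurableType dOm)
  (P : probability Om R).

(* The integral of a nonnegative function is a supremum over simple functions,
   so it is monotone without any measurability of the smaller function. *)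
Lemma le_integral_majorant (f g : Om -> \bar R) : (forall w, 0 <= g w) ->
  (forall w, f w <= g w) -> \int[P]_w f w <= \int[P]_w g w.
Proof.
move=> g0 fg; rewrite (ge0_integralTE _ g0) /integral !patch_setT.
set sup := ereal_sup _.
apply: (@le_trans _ _ sup).
  rewrite -[leRHS]sube0; apply: leeB => //; apply: ereal_sup_ubound.
  by exists nnsfun0; [exact: funeneg_ge0|exact: sintegral0].
apply: le_ereal_sup => _ [h hf <-]; exists h => // w.
by apply: (le_trans (hf w)); rewrite funeposE ge_max fg g0.
Qed.

Lemma integral_event_series_le (f : Om -> \bar R) (a S : R) (c b : nat -> R)
    (E : nat -> set Om) : (0 <= a)%R -> (forall i, 0 <= c i)%R ->
  (forall i, measurable (E i)) -> (forall i, P (E i) <= (b i)%:E) ->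
  (forall k, \sum_(i < k) c i * b i <= S)%R ->
  (forall w, f w <= a%:E + \sum_(i <oo) (c i)%:E * (\1_(E i) w)%:E) ->
  \int[P]_w f w <= (a + S)%:E.
Proof.
move=> a0 c0 mE Eb bS fle.
have t0 i w : 0 <= (c i)%:E * (\1_(E i) w)%:E by rewrite mule_ge0 ?lee_fin.
have mt i : measurable_fun setT (fun w => (c i)%:E * (\1_(E i) w)%:E).
  by apply: emeasurable_funM; apply/measurable_EFinP.
have s0 w : 0 <= \sum_(i <oo) (c i)%:E * (\1_(E i) w)%:E by exact: nneseries_ge0.
apply: (le_trans (le_integral_majorant _ fle)).
  by move=> w; rewrite adde_ge0// lee_fin.
rewrite ge0_integralD//; last exact: ge0_emeasurable_sum.
rewrite integral_cst//= probability_setT mule1 EFinD leeD2l//.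
rewrite integral_nneseries//.
have term i : \int[P]_w ((c i)%:E * (\1_(E i) w)%:E) = (c i)%:E * P (E i).
  by rewrite ge0_integralZl_EFin//= ?integral_indic ?setIT//; apply/measurable_EFinP.
under eq_eseriesr do rewrite term.
apply: lime_le.
  by apply: is_cvg_nneseries => i _ _; rewrite mule_ge0 ?lee_fin.
apply: nearW => k; apply: (@le_trans _ _ (\sum_(0 <= i < k) (c i * b i)%:E)).
  by apply: lee_sum => i _; rewrite EFinM lee_wpmul2l ?lee_fin.
by rewrite sumEFin big_mkord lee_fin.
Qed.

End lower_integral.

Section steps.
Context (R : realType) (d n : nat).
Local Notation pt := (Rpoint R d).
Local Notation cfg := (n.-tuple pt).
Hypothesis hd : (2 <= d)%N.
Variable dist : pt -> pt -> R.
Hypotheses (dist_sym : forall x y, dist x y = dist y x)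
  (dist_tri : forall x y z, dist x z <= dist x y + dist y z)
  (dist_xx : forall x, dist x x = 0)
  (dist_ge0 : forall x y, 0 <= dist x y)
  (dist_manhattan : forall x y, dist x y <= manhattan x y).
Let vdist (z : cfg) i j := dist (tnth z i) (tnth z j).

Lemma two_opt_steps1 (z : cfg) : (n <= 1)%N -> (two_opt_steps (vdist z) <= 0)%E.
Proof.
move=> n1; apply: ge_ereal_sup => _ [k [T _ run] <-]; case: run => // {T k} T T' k [].
move=> [r [u1 [u2 [v1 [v2 [S1 [S2 [/card_uniqP/= u4 _ _]]]]]]]] _ _.
by have := max_card (mem [:: u1; u2; v1; v2]); rewrite u4 card_ord leqNgt (leq_ltn_trans n1).
Qed.

Let L : R := tour_const R d * (n%:R `^ (1 - d%:R^-1)).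

Lemma tour_const_ge1 : 1 <= tour_const R d.
Proof.
have d2 : 2 <= d%:R :> R by rewrite ler_nat.
have p0 : 0 <= (2 ^+ d) ^+ 2 :> R by rewrite !exprn_ge0.
by rewrite /tour_const; nra.
Qed.

(* The term i accounts for the event that a linked pair of scale N0 + i exists;
   outside the cubes all events hold, which makes the series infinite. *)
Lemma two_opt_steps_series (N0 : nat) (z : cfg) (A : nat -> set cfg) : (0 < n)%N ->
  (forall i, cubes z -> linked_small_changes (vdist z) (4^-1 ^+ (N0 + i)) -> A i z) ->
  (forall i, ~ cubes z -> A i z) ->
  (two_opt_steps (vdist z) <= (n%:R + 3 * L * 4 ^+ N0)%:E +
     \sum_(i <oo) (3 * L * 4 ^+ (N0 + i).+1)%:E * (\1_(A i) z)%:E)%E.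
Proof.
move=> n0 Alink Acube; apply: ge_ereal_sup => _ [k [T iT run] <-].
have L1 : 1 <= L.
  rewrite /L -[leLHS]mulr1; apply: ler_pM => //; first exact: tour_const_ge1.
  apply: (@le_trans _ _ (n%:R `^ 0)); first by rewrite powRr0.
  apply: ler_powR; first by rewrite ler1n.
  by rewrite subr_ge0 invf_le1 ?ler1n ?ltr0n (leq_trans _ hd).
have L0 : 0 <= L by apply: le_trans L1.
have c0 i : 0 <= 3 * L * 4 ^+ (N0 + i).+1 by rewrite !mulr_ge0// exprn_ge0.
pose tm i := ((3 * L * 4 ^+ (N0 + i).+1)%:E * (\1_(A i) z)%:E)%E.
have tm0 i : (0 <= tm i)%E by rewrite mule_ge0 ?lee_fin.
have partial m (r : R) : (r%:E <= (n%:R + 3 * L * 4 ^+ N0)%:E + \sum_(0 <= i < m) tm i)%E ->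
    (r%:E <= (n%:R + 3 * L * 4 ^+ N0)%:E + \sum_(i <oo) tm i)%E.
  by move=> /le_trans; apply; rewrite leeD2l// nneseries_lim_ge.
have a0 : 0 <= n%:R + 3 * L * 4 ^+ N0 by rewrite addr_ge0// !mulr_ge0// exprn_ge0.
have inA i : A i z -> tm i = (3 * L * 4 ^+ (N0 + i).+1)%:E.
  by move=> Az; rewrite /tm indicE mem_set// mule1.
(* Every coefficient of the series is at least 1, so [k] events that hold already pay for [k]
   steps. *)
have big : (forall i, (i < k)%N -> A i z) -> (k%:R%:E <= (n%:R + 3 * L * 4 ^+ N0)%:E + \sum_(i <oo) tm i)%E.
  move=> all; apply: (partial k).
  apply: (@le_trans _ _ (\sum_(0 <= i < k) 1%:E)%E).
    by rewrite sumEFin big_mkord sumr_const card_ord.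
  rewrite -[leLHS]add0e; apply: leeD; first by rewrite lee_fin.
  rewrite !big_mkord; apply: lee_sum => i _; rewrite (inA _ (all _ (ltn_ord i))).
  apply: (@le_trans _ _ (1%R)%:E) => //; rewrite lee_fin.
  have : 1 <= 4 ^+ (N0 + i).+1 :> R by rewrite exprn_ege1// ler1n.
  by move: L1; set t := 4 ^+ _; nra.
have [Qz|nQ] := pselect (cubes z); last by apply: big => i _; exact: Acube.
have [allA|] := pselect (forall i, (i < k)%N -> A i z); first exact: big.
move=> /existsNP[i0 /not_implyP[_ nA]].
have ex : exists i, `[< ~ A i z >] by exists i0; exact/asboolP.
case: (ex_minnP ex) => i /asboolP nAi imin.
have unlinked : ~ linked_small_changes (vdist z) (4^-1 ^+ (N0 + i)).
  by move=> /(Alink _ Qz).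
have uT := insertion_subtour_uniq (proj1 iT).
have sT : size T = n.
  by rewrite -(card_uniqP uT) -[RHS]card_ord; apply: eq_card => v; rewrite (proj2 iT).
have e0 : 0 < 4^-1 ^+ (N0 + i) :> R by rewrite exprn_gt0// invr_gt0.
have len : tour_length (vdist z) T <= L.
  apply: (insertion_tour_length_le hd dist_sym dist_tri dist_xx dist_manhattan (z := tnth z)) => //.
have steps : k%:R <= n%:R + 3 * L * 4 ^+ (N0 + i).
  have := two_opt_run_le (fun x y => dist_sym _ _) (fun x y => dist_ge0 _ _) e0 unlinked uT run.
  rewrite sT addrC -exprVn invrK => /le_trans; apply; rewrite lerD2l ler_wpM2r ?exprn_ge0//.
  by rewrite ler_pM2l.
(* At the first scale [i] without a linked pair the run has at most [n + 3 * L * 4^(N0+i)] steps.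
   For [i = 0] the constant term covers this; otherwise the term of index [i - 1] does, which
   explains the successor in its exponent. *)
case: i nAi imin unlinked e0 steps => [|i] nAi imin _ _ steps.
  by apply: (partial 0%N); rewrite big_nil adde0 lee_fin; rewrite addn0 in steps.
apply: (partial i.+1); rewrite big_nat_recr//= inA; last first.
  apply: contrapT => /asboolP/imin; by rewrite ltnn.
rewrite addeCA -[leLHS]add0e; apply: leeD; first by apply: sume_ge0.
rewrite -EFinD lee_fin (le_trans steps)//; rewrite addnS.
have : 0 <= 3 * L * 4 ^+ N0 by rewrite !mulr_ge0// exprn_ge0.
by move: (3 * L * 4 ^+ (N0 + i).+1) (3 * L * 4 ^+ N0) => u v; lra.
Qed.

End steps.

Section expectation.
Context (R : realType) (d n : nat) (phi : R) (dOm : measure_display)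
  (Om : measurableType dOm) (P : probability Om R) (X : 'I_n -> Om -> Rpoint R d).
Local Notation pt := (Rpoint R d).
Local Notation cfg := (n.-tuple pt).
Hypotheses (hd : (2 <= d)%N) (n0 : (0 < n)%N).
Variable dist : pt -> pt -> R.
Hypotheses (dist_sym : forall x y, dist x y = dist y x)
  (dist_tri : forall x y z, dist x z <= dist x y + dist y z)
  (dist_xx : forall x, dist x x = 0)
  (dist_ge0 : forall x y, 0 <= dist x y)
  (dist_manhattan : forall x y, dist x y <= manhattan x y).
Let vdist (z : cfg) i j := dist (tnth z i) (tnth z j).
Let L : R := tour_const R d * (n%:R `^ (1 - d%:R^-1)).

Lemma expected_stepsE : expected_two_opt_steps dist P X =
  (\int[P]_w two_opt_steps (vdist (config X w)))%E.
Proof.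
apply: eq_integral => w _; congr two_opt_steps.
by apply/funext => i; apply/funext => j; rewrite /vdist !tnth_mktuple.
Qed.

(** Treated separately because [ln n] vanishes at [n = 1], where the Manhattan bound is 0; a
    2-change needs four distinct vertices. *)
Lemma expected_steps1 : (n <= 1)%N -> (expected_two_opt_steps dist P X <= 0)%E.
Proof.
move=> n1; rewrite expected_stepsE; apply: (@le_trans _ _ (\int[P]_w 0)%E).
  by apply: le_integral_majorant => // w; exact: two_opt_steps1.
by rewrite integral0.
Qed.

Lemma expected_steps_le (M : probability cfg R) (N0 : nat) (b : nat -> R) (S : R) :
  perturbed_instance phi P X -> (forall A, M A = P (config X @^-1` A)) ->
  M (~` @cubes R d n) = 0%E ->
  (forall i, exists A : set cfg, [/\ measurable A,
     [set z | linked_small_changes (vdist z) (4^-1 ^+ (N0 + i))] `&` @cubes R d n `<=` A &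
     (M A <= (b i)%:E)%E]) ->
  (forall k, \sum_(i < k) 3 * L * 4 ^+ (N0 + i).+1 * b i <= S) ->
  (expected_two_opt_steps dist P X <= (n%:R + 3 * L * 4 ^+ N0 + S)%:E)%E.
Proof.
move=> pX ME cubesC /choice[A HA] bS.
have mQ := @measurable_cubes R d n.
have mA i : measurable (A i) by have [] := HA i.
have mAQ i : measurable (A i `|` ~` @cubes R d n).
  by apply: measurableU => //; exact: measurableC.
have L0 : 0 <= L by rewrite mulr_ge0 ?powR_ge0// (le_trans _ (tour_const_ge1 R hd)).
rewrite expected_stepsE.
apply: (integral_event_series_le (c := fun i => 3 * L * 4 ^+ (N0 + i).+1) (b := b)
  (E := fun i => config X @^-1` (A i `|` ~` @cubes R d n))).
- by rewrite addr_ge0// !mulr_ge0// exprn_ge0.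
- by move=> i; rewrite !mulr_ge0// exprn_ge0.
- by move=> i; rewrite -[X in measurable X]setTI; exact: (measurable_config pX).
- move=> i; rewrite -ME; apply: (le_trans (measureU2 _ _ _)) => //.
    exact: measurableC.
  by rewrite [X in (_ + X)%E](_ : _ = 0%E) ?adde0//; have [] := HA i.
- exact: bS.
move=> w; have := two_opt_steps_series (N0 := N0) (z := config X w)
  (A := fun i => A i `|` ~` @cubes R d n) hd dist_sym dist_tri dist_xx dist_ge0 dist_manhattan n0.
apply=> i; last by right.
by move=> Qz Lz; left; have [_ sub _] := HA i; apply: sub.
Qed.

End expectation.

(** * Numerical estimates and the choice of the level *)

Section elementary_bounds.
Context (R : realType).

Lemma exists_power (q x : R) : 2 <= q -> 1 <= x -> exists N : nat, x <= q ^+ N <= q * x.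
Proof.
move=> q2 x1; have q0 : 0 < q by apply: lt_le_trans q2.
have ex : exists N, x <= q ^+ N.
  exists (Num.bound x); rewrite (le_trans (ltW (archi_boundP _)))// ?(le_trans _ x1)//.
  apply: (@le_trans _ _ (2 ^+ Num.bound x)); last by rewrite lerXn2r// nnegrE ltW.
  by rewrite -natrX ler_nat ltnW// ltn_expl.
case: (ex_minnP ex) => N xN Nmin; exists N; rewrite xN /=.
case: N xN Nmin => [|N] xN Nmin; first by rewrite expr0; nra.
rewrite exprS ler_pM2l// leNgt; apply/negP => /ltW/Nmin; by rewrite ltnn.
Qed.

Lemma sum_geometric k : \sum_(i < k) 4^-1 ^+ i <= 2 :> R.
Proof.
suff : \sum_(i < k) 4^-1 ^+ i <= 2 - 2 * 4^-1 ^+ k :> R.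
  by move=> /le_trans; apply; rewrite gerBl mulr_ge0// exprn_ge0// invr_ge0.
elim: k => [|k IH]; first by rewrite big_ord0 expr0; lra.
have : 0 <= 4^-1 ^+ k :> R by rewrite exprn_ge0// invr_ge0.
by rewrite big_ord_recr/= exprS; move: IH; lra.
Qed.

(** 12 is the full series, [(1 + x) / (1 - x)^3] at [x = 1/2]; the exact partial sums make the
    induction possible. *)
Lemma sum_square_geometric k : \sum_(i < k) i.+1%:R ^+ 2 * 2^-1 ^+ i <= 12 :> R.
Proof.
have -> : \sum_(i < k) i.+1%:R ^+ 2 * 2^-1 ^+ i =
    12 - (2 * k%:R ^+ 2 + 8 * k%:R + 12) * 2^-1 ^+ k :> R.
  elim: k => [|k IH]; first by rewrite big_ord0 expr0; ring.
  have kS : k.+1%:R = k%:R + 1 :> R by rewrite -addn1 natrD.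
  by rewrite big_ord_recr/= IH kS [2^-1 ^+ k.+1]exprS; move: (2^-1 ^+ k) => t; field.
rewrite gerBl mulr_ge0 ?exprn_ge0 ?invr_ge0//.
Qed.

Lemma succ_pow4_le (N : nat) : (N.+1 ^ 4 <= 256 * 2 ^ N)%N.
Proof.
elim: N => [//|N IH]; have [N6|] := leqP 6 N.
  (* From [N = 6] on, the square grows by a factor of at most [7/5], and [(7/5)^2 = 49/25 < 2]. *)
  have m2 : (5 * N.+2 ^ 2 <= 7 * N.+1 ^ 2)%N by nia.
  have pow4 (a : nat) : (a ^ 4 = a ^ 2 * a ^ 2)%N by rewrite -expnD.
  have := leq_mul m2 m2; rewrite !pow4 in IH *.
  rewrite [(2 ^ N.+1)%N]expnS (mulnACA 5%N) (mulnACA 7%N).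
  by move: (N.+1 ^ 2 * _)%N (N.+2 ^ 2 * _)%N (2 ^ N)%N IH => a b c; lia.
by move: N {IH} => [|[|[|[|[|[|]]]]]].
Qed.

Lemma ln2_ge : 2^-1 <= ln 2 :> R.
Proof.
have := @le_ln1Dx R (- 2^-1); rewrite (_ : 1 + - 2^-1 = 2^-1); last by lra.
rewrite lnV ?posrE// => h; have : - ln 2 <= - 2^-1 :> R by apply: h; lra.
by lra.
Qed.

End elementary_bounds.

Section euclidean_level.
Context (R : realType) (n : nat) (phi : R).
Hypotheses (n1 : (1 < n)%N) (phi1 : 1 <= phi).
Let n0R : 0 < n%:R :> R. Proof. by rewrite ltr0n ltnW. Qed.
Let n1R : 1 <= n%:R :> R. Proof. by rewrite ler1n ltnW. Qed.
Let phi0 : 0 < phi. Proof. exact: lt_le_trans phi1. Qed.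

Lemma ln_size_ge : 2^-1 <= ln n%:R :> R.
Proof.
apply: (le_trans (ln2_ge R)); rewrite ler_ln ?posrE//.
by rewrite ler_nat.
Qed.

Lemma ln_product_ge : 2^-1 <= ln (n%:R * phi).
Proof.
apply: (le_trans ln_size_ge); rewrite ler_ln ?posrE// ?mulr_gt0//.
by rewrite ler_peMr// ltW.
Qed.

(** The cube root of [n^5 * phi^4], to which [2^N0] is comparable. So [4^N0] is of order
    [n^(10/3) * phi^(8/3)], and the factor [n^(1-1/d)] of the tour length completes the exponent
    [4 + 1/3 - 1/d]. *)
Let scale : R := n%:R `^ (5 / 3) * phi `^ (4 / 3).

Let powR3 (x e : R) (m : nat) : 0 < x -> e * 3 = m%:R -> (x `^ e) ^+ 3 = x ^+ m.
Proof. by move=> x0 em; rewrite -powR_mulrn ?powR_ge0// -powRrM em powR_mulrn// ltW. Qed.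

Lemma scale_cube : scale ^+ 3 = n%:R ^+ 5 * phi ^+ 4.
Proof. by rewrite exprMn (@powR3 _ _ 5)// ?(@powR3 _ _ 4)//; field. Qed.

Lemma scale_gt0 : 0 < scale.
Proof. by rewrite mulr_gt0// powR_gt0. Qed.

(* The fourth power turns the claim into integer powers: n ^ 4 phi ^ 4 <= 8 ^ N
   and (N + 1) ^ 4 <= 256 * 2 ^ N. *)
Lemma level_product_le (N : nat) : n%:R ^+ 5 * phi ^+ 4 <= 8 ^+ N ->
  n%:R * phi * N.+1%:R * 2^-1 ^+ N <= 4.
Proof.
move=> h; rewrite -(ler_pXn2r (n := 4)) ?nnegrE//; last first.
  by rewrite !mulr_ge0 ?(ltW phi0)// exprn_ge0// invr_ge0.
rewrite !exprMn.
have N4 : N.+1%:R ^+ 4 <= 256 * 2 ^+ N :> R.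
  by rewrite -!natrX -natrM ler_nat; exact: succ_pow4_le.
have n4 : n%:R ^+ 4 * phi ^+ 4 <= 8 ^+ N.
  apply: le_trans h; rewrite ler_wpM2r ?exprn_ge0 ?(ltW phi0)//.
  by rewrite ler_weXn2l.
have t0 : 0 <= (2^-1 ^+ N) ^+ 4 :> R by rewrite !exprn_ge0// invr_ge0.
apply: (@le_trans _ _ (8 ^+ N * (256 * 2 ^+ N) * (2^-1 ^+ N) ^+ 4)).
  by rewrite ler_wpM2r// ler_pM// mulr_ge0// exprn_ge0// ltW.
have -> : (2^-1 ^+ N) ^+ 4 = (8 ^+ N * 2 ^+ N)^-1 :> R.
  rewrite -exprM mulnC exprM -exprMn exprVn exprVn; congr (_ ^+ N)^-1.
  by rewrite -natrX -natrM.
have p0 : 8 ^+ N * 2 ^+ N != 0 :> R by rewrite mulf_neq0// expf_neq0.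
rewrite (_ : 8 ^+ N * _ * _ = 256 * (8 ^+ N * 2 ^+ N) / (8 ^+ N * 2 ^+ N)); last by ring.
by rewrite mulfK// -natrX.
Qed.

(** By [level_product_le] the [16^-N] part is at most 4 times the [8^-N] part, whence
    [60 = 3 * 4 * 5]. The bound [N0 + i + 1 <= (N0 + 1) * (i + 1)] separates the level from the
    summation index. *)
Lemma euclidean_term_le (N0 i : nat) (Kc L : R) : 0 <= Kc -> 0 <= L ->
  n%:R ^+ 5 * phi ^+ 4 <= 8 ^+ N0 ->
  3 * L * 4 ^+ (N0 + i).+1 * (Kc * (N0 + i).+1%:R ^+ 2 * (n%:R ^+ 5 * phi ^+ 4 * 8^-1 ^+ (N0 + i) +
     n%:R ^+ 6 * phi ^+ 5 * (N0 + i).+1%:R * 16^-1 ^+ (N0 + i))) <=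
  60 * L * Kc * (n%:R ^+ 5 * phi ^+ 4 * 2^-1 ^+ N0) * N0.+1%:R ^+ 2 * (i.+1%:R ^+ 2 * 2^-1 ^+ i).
Proof.
move=> K0 L0 h.
have Nnat : ((N0 + i).+1 <= N0.+1 * i.+1)%N by rewrite mulSn mulnS; lia.
set N := (N0 + i)%N in Nnat *.
have hN : n%:R ^+ 5 * phi ^+ 4 <= 8 ^+ N.
  by apply: (le_trans h); rewrite ler_weXn2l ?ler1n// leq_addr.
have small := level_product_le hN.
set u := n%:R ^+ 5 * phi ^+ 4; have u0 : 0 <= u by rewrite mulr_ge0// exprn_ge0// ltW.
have t0 : 0 <= 2^-1 ^+ N :> R by rewrite exprn_ge0// invr_ge0.
have s0 : 0 < 4 ^+ N :> R by rewrite exprn_gt0.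
have e8 : 8^-1 ^+ N = 2^-1 ^+ N / 4 ^+ N :> R.
  by rewrite -exprVn -exprMn -invfM -natrM.
have e16 : 16^-1 ^+ N = 2^-1 ^+ N * 2^-1 ^+ N / 4 ^+ N :> R.
  by rewrite -exprVn -!exprMn -!invfM -!natrM.
have -> : 3 * L * 4 ^+ N.+1 * (Kc * N.+1%:R ^+ 2 * (u * 8^-1 ^+ N +
     n%:R ^+ 6 * phi ^+ 5 * N.+1%:R * 16^-1 ^+ N)) =
  12 * L * Kc * u * N.+1%:R ^+ 2 * 2^-1 ^+ N * (1 + n%:R * phi * N.+1%:R * 2^-1 ^+ N).
  rewrite e8 e16 exprS /u; move: (4 ^+ N) (2^-1 ^+ N) (N.+1%:R) s0 => s t v s0.
  by field; rewrite gt_eqF.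
have Nle : N.+1%:R ^+ 2 * 2^-1 ^+ N <= N0.+1%:R ^+ 2 * i.+1%:R ^+ 2 * (2^-1 ^+ N0 * 2^-1 ^+ i) :> R.
  rewrite -exprD -/N ler_wpM2r// -exprMn lerXn2r// ?nnegrE// -natrM ler_nat.
  exact: Nnat.
have c0 : 0 <= 12 * L * Kc * u.
  by apply: mulr_ge0 u0; apply: mulr_ge0 K0; exact: mulr_ge0 (ler0n _ 12) L0.
apply: (@le_trans _ _ (12 * L * Kc * u * (N.+1%:R ^+ 2 * 2^-1 ^+ N) * 5)).
  rewrite -[X in X * (1 + _)]mulrA ler_wpM2l//.
    exact: mulr_ge0 c0 (mulr_ge0 (sqr_ge0 _) t0).
  by move: small; lra.
apply: (@le_trans _ _ (12 * L * Kc * u * (N0.+1%:R ^+ 2 * i.+1%:R ^+ 2 * (2^-1 ^+ N0 * 2^-1 ^+ i)) * 5)).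
  by rewrite ler_wpM2r// ler_wpM2l.
rewrite le_eqVlt; apply/orP; left; apply/eqP.
by move: (2^-1 ^+ N0) (2^-1 ^+ i) (N0.+1%:R) (i.+1%:R) => a b c e; ring.
Qed.

Lemma exists_euclidean_level : exists N0 : nat,
  [/\ n%:R ^+ 5 * phi ^+ 4 <= 8 ^+ N0, (4 ^+ N0 <= 4 * scale ^+ 2),
      n%:R ^+ 5 * phi ^+ 4 * 2^-1 ^+ N0 <= scale ^+ 2 &
      N0.+1%:R <= 10 * ln (n%:R * phi)].
Proof.
have x1 : 1 <= n%:R ^+ 5 * phi ^+ 4.
  by rewrite -[leLHS]mulr1 ler_pM// exprn_ege1.
have [N0 /andP[lo hi]] := exists_power (ler_nat R 2 8) x1.
have s0 := scale_gt0; exists N0.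
have sp : 0 <= 2 * scale by rewrite mulr_ge0// ltW.
have p0 : 0 < 2 ^+ N0 :> R by rewrite exprn_gt0.
have e8 : 8 ^+ N0 = (2 ^+ N0) ^+ 3 :> R by rewrite -!natrX -expnM mulnC expnM.
have slo : scale <= 2 ^+ N0.
  by rewrite -(ler_pXn2r (n := 3)) ?nnegrE ?(ltW s0) ?(ltW p0)// scale_cube -e8.
have shi : 2 ^+ N0 <= 2 * scale.
  rewrite -(ler_pXn2r (n := 3)) ?nnegrE ?sp ?(ltW p0)//.
  by rewrite exprMn scale_cube -e8 (_ : 2 ^+ 3 = 8)// -natrX.
split=> //.
- have -> : 4 ^+ N0 = (2 ^+ N0) ^+ 2 :> R by rewrite -!natrX -expnM mulnC expnM.
  have -> : 4 * scale ^+ 2 = (2 * scale) ^+ 2 by ring.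
  by rewrite lerXn2r// nnegrE ?sp ?(ltW p0).
- rewrite -scale_cube exprVn exprSr -mulrA ler_piMr ?sqr_ge0//.
  by rewrite ler_pdivrMr// mul1r.
(* With [ln 2] between [1/2] and 1, the logarithm of [2^N0 <= 2 * scale] gives
   [N0 <= 2 + (10/3) * l]; since [l >= 1/2], this yields [N0 + 1 <= 10 * l]. *)
have l0 := ln_product_ge; set l := ln _ in l0 *.
have lnphi : 0 <= ln phi by rewrite ln_ge0.
have lE : l = ln n%:R + ln phi by rewrite /l lnM// posrE.
have l2 := ln2_ge R.
have : ln (2 ^+ N0) <= ln (2 * scale) by rewrite ler_ln ?posrE// mulr_gt0.
rewrite lnXn// lnM ?posrE// /scale lnM ?posrE ?powR_gt0// !ln_powR.
have l2' : ln 2 <= 1 :> R by have := @le_ln1Dx R 1; rewrite (_ : 1 + 1 = 2)//; apply; lra.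
have -> : N0.+1%:R = N0%:R + 1 :> R by rewrite -addn1 natrD.
rewrite -[ln 2 *+ N0]mulr_natl => hh; have N00 : 0 <= N0%:R :> R by [].
have : N0%:R * 2^-1 <= N0%:R * ln 2 :> R by rewrite ler_wpM2l.
move: (N0%:R) (ln phi) (ln n%:R) (ln 2) N00 lnphi lE l0 l2' hh => N p q t N00 p0' lE l0 l2' hh hn.
by rewrite lE in l0 *; lra.
Qed.

Lemma euclidean_series_le (N0 : nat) (Kc L : R) k : 0 <= Kc -> 0 <= L ->
  n%:R ^+ 5 * phi ^+ 4 <= 8 ^+ N0 ->
  \sum_(i < k) 3 * L * 4 ^+ (N0 + i).+1 * (Kc * (N0 + i).+1%:R ^+ 2 *
     (n%:R ^+ 5 * phi ^+ 4 * 8^-1 ^+ (N0 + i) +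
     n%:R ^+ 6 * phi ^+ 5 * (N0 + i).+1%:R * 16^-1 ^+ (N0 + i))) <=
  720 * L * Kc * (n%:R ^+ 5 * phi ^+ 4 * 2^-1 ^+ N0) * N0.+1%:R ^+ 2.
Proof.
move=> K0 L0 h.
apply: (@le_trans _ _ (\sum_(i < k) 60 * L * Kc * (n%:R ^+ 5 * phi ^+ 4 * 2^-1 ^+ N0) *
    N0.+1%:R ^+ 2 * (i.+1%:R ^+ 2 * 2^-1 ^+ i))).
  by apply: ler_sum => i _; exact: euclidean_term_le.
rewrite -mulr_sumr; set u := n%:R ^+ 5 * _ * _.
have u0 : 0 <= u by rewrite !mulr_ge0 ?exprn_ge0 ?invr_ge0 ?(ltW phi0).
apply: (le_trans (ler_wpM2l _ (sum_square_geometric R k))).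
  apply: mulr_ge0 (sqr_ge0 _); apply: mulr_ge0 u0; apply: mulr_ge0 K0.
  exact: mulr_ge0 (ler0n _ 60) L0.
rewrite le_eqVlt; apply/orP; left; apply/eqP; ring.
Qed.

End euclidean_level.

Section rates.
Context (R : realType) (d n : nat) (phi : R) (dOm : measure_display)
  (Om : measurableType dOm) (P : probability Om R) (X : 'I_n -> Om -> Rpoint R d).
Hypotheses (hd : (2 <= d)%N) (n1 : (1 < n)%N) (phi1 : 1 <= phi)
  (pX : perturbed_instance phi P X).
Let w : R := n%:R `^ (1 - d%:R^-1).
Let n0R : 0 < n%:R :> R. Proof. by rewrite ltr0n ltnW. Qed.
Let n1R : 1 <= n%:R :> R. Proof. by rewrite ler1n ltnW. Qed.
Let phi0 : 0 < phi. Proof. exact: lt_le_trans phi1. Qed.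
Let T0 : 0 <= tour_const R d. Proof. exact: le_trans (tour_const_ge1 R hd). Qed.

Let w1 : 1 <= w.
Proof.
rewrite /w; apply: (@le_trans _ _ (n%:R `^ 0)); first by rewrite powRr0.
apply: ler_powR => //.
by rewrite subr_ge0 invf_le1 ?ler1n ?ltr0n (leq_trans _ hd).
Qed.

Let w_pow (e : R) : w * n%:R `^ e = n%:R `^ (e + 1 - d%:R^-1).
Proof.
by rewrite /w -powRD; [congr (_ `^ _); ring|apply/implyP => _; rewrite gt_eqF].
Qed.

(** The summand 1 pays for [n], 12 comes from [4^N0 <= 4 * x], and 24 from the series, whose
    geometric sum is at most 2. The outer 2 is for [1 <= 2 * ln n]. *)
Definition manhattan_rate : R :=
  2 * (1 + 12 * tour_const R d + 24 * tour_const R d * manhattan_const R d).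

Lemma manhattan_steps_le : (expected_two_opt_steps (@manhattan R d) P X <=
  (manhattan_rate * (n%:R `^ (4 - d%:R^-1) * ln n%:R * phi))%:E)%E.
Proof.
have [M [m [ME M_box dom m_cube]]] := perturbed_law pX.
pose x : R := n%:R ^+ 3 * phi.
have x1 : 1 <= x by rewrite -[leLHS]mulr1 ler_pM// exprn_ege1.
have [N0 /andP[lo hi]] := exists_power (ler_nat R 2 4) x1.
pose L := tour_const R d * w.
have L0 : 0 <= L by rewrite mulr_ge0// (le_trans _ w1).
have K0 : 0 <= manhattan_const R d by rewrite mulr_ge0// exprn_ge0// exprn_ge0.
have e0 i : 0 <= 4^-1 ^+ i :> R by rewrite exprn_ge0// invr_ge0.
have event i : exists A : set (n.-tuple (Rpoint R d)), [/\ measurable A,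
   [set z | linked_small_changes (manh z) (4^-1 ^+ (N0 + i))] `&` @cubes R d n `<=` A &
   (M A <= (manhattan_const R d * n%:R ^+ 6 * phi ^+ 2 * (4^-1 ^+ (N0 + i)) ^+ 2)%:E)%E].
  have [A [mA sub le]] := manhattan_linked_le phi1 M_box dom (e0 (N0 + i)%N).
  by exists A; split => // z [/sub].
have := expected_steps_le hd (ltnW n1) (@manhattan_sym R d) (@manhattan_triangle R d)
  (@manhattan_xx R d) (@manhattan_ge0 R d) (fun x y => lexx _)
  (S := 24 * L * manhattan_const R d * x) pX ME (config_cube_ae M_box m_cube) event.
move=> /(_ _)/le_trans; apply.
  move=> k; have p4 : 0 < 4 ^+ N0 :> R by rewrite exprn_gt0.
  have term (i : 'I_k) : 3 * L * 4 ^+ (N0 + i).+1 * (manhattan_const R d * n%:R ^+ 6 * phi ^+ 2 *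
      (4^-1 ^+ (N0 + i)) ^+ 2) = 12 * L * manhattan_const R d * (x ^+ 2 / 4 ^+ N0) * 4^-1 ^+ i.
    rewrite !exprVn exprS exprD /x; have : 4 ^+ i != 0 :> R by rewrite expf_neq0.
    by move: (4 ^+ i) (4 ^+ N0) p4 => a b b0 a0; field; rewrite a0 gt_eqF.
  rewrite (eq_bigr _ (fun i _ => term i)) -mulr_sumr.
  apply: (@le_trans _ _ (12 * L * manhattan_const R d * x * 2)).
    have cLK : 0 <= 12 * L * manhattan_const R d.
      by apply: mulr_ge0 K0; exact: mulr_ge0 (ler0n _ 12) L0.
    have x0 : 0 <= x by apply: le_trans x1.
    apply: ler_pM.
    - by rewrite mulr_ge0// divr_ge0 ?sqr_ge0// ltW.
    - by rewrite sumr_ge0.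
    - by rewrite ler_wpM2l// ler_pdivrMr// expr2 ler_wpM2l.
    - exact: sum_geometric.
  rewrite le_eqVlt; apply/orP; left; apply/eqP; ring.
rewrite lee_fin -/w /L.
have wx : w * x = n%:R `^ (4 - d%:R^-1) * phi.
  rewrite /x mulrA -powR_mulrn ?ltW// w_pow; congr (_ `^ _ * _); ring.
have lnn := ln_size_ge R n1.
have x_ge_n : n%:R <= x.
  rewrite /x -[leLHS]mulr1; apply: ler_pM => //.
  by rewrite -[leLHS]expr1 ler_weXn2l.
have y_ge : n%:R <= w * x.
  by apply: (le_trans x_ge_n); rewrite ler_peMl// (le_trans _ x1).
rewrite [_ * ln n%:R * phi]mulrAC -wx.
set y := w * x in y_ge *.
have y0 : 0 <= y by rewrite (le_trans _ y_ge)// ltW.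
apply: (@le_trans _ _ (y + 12 * tour_const R d * y + 24 * tour_const R d * manhattan_const R d * y)).
  apply: lerD; last by rewrite /y le_eqVlt; apply/orP; left; apply/eqP; ring.
  apply: lerD => //.
  rewrite (_ : 3 * _ * _ = 3 * tour_const R d * w * 4 ^+ N0); last by ring.
  rewrite (_ : 12 * _ * _ = 3 * tour_const R d * w * (4 * x)); last by rewrite /y; ring.
  by rewrite ler_wpM2l// mulr_ge0 ?(le_trans _ w1)// mulr_ge0.
have C0 : 0 <= 1 + 12 * tour_const R d + 24 * tour_const R d * manhattan_const R d.
  apply: addr_ge0; first by apply: addr_ge0 => //; exact: mulr_ge0 (ler0n _ 12) T0.
  by apply: mulr_ge0 K0; exact: mulr_ge0 (ler0n _ 24) T0.
rewrite /manhattan_rate; move: C0; set C := 1 + _ + _ => C0.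
rewrite (_ : y + _ + _ = C * y * 1); last by rewrite /C; ring.
rewrite (_ : 2 * C * (y * ln n%:R) = C * y * (2 * ln n%:R)); last by ring.
by apply: ler_wpM2l; [exact: mulr_ge0|move: lnn; lra].
Qed.

(** [4 + 48 * tour_const] is [1 + 12 * tour_const] times the 4 of [1 <= 4 * l^2]; the 100 is the
    square of the 10 in [N0 + 1 <= 10 * l]. *)
Definition euclidean_rate : R :=
  4 + 48 * tour_const R d + 720 * tour_const R d * euclidean_const R d * 100.

Lemma euclidean_steps_le : (expected_two_opt_steps (@euclidean R d) P X <=
  (euclidean_rate * (n%:R `^ (4 + 3^-1 - d%:R^-1) * ln (n%:R * phi) ^+ 2 *
            phi `^ (8 / 3)))%:E)%E.
Proof.
have [M [m [ME M_box dom m_cube]]] := perturbed_law pX.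
have [N0 [lo]] := exists_euclidean_level n1 phi1.
set s := (n%:R `^ _ * phi `^ _) => hi4 hi2 hN.
pose L := tour_const R d * w.
have L0 : 0 <= L by rewrite mulr_ge0// (le_trans _ w1).
have K0 := euclidean_const_ge0 R d.
have event i : exists A : set (n.-tuple (Rpoint R d)), [/\ measurable A,
   [set z | linked_small_changes (eucl z) (4^-1 ^+ (N0 + i))] `&` @cubes R d n `<=` A &
   (M A <= (euclidean_const R d * (N0 + i).+1%:R ^+ 2 * (n%:R ^+ 5 * phi ^+ 4 * 8^-1 ^+ (N0 + i) +
            n%:R ^+ 6 * phi ^+ 5 * (N0 + i).+1%:R * 16^-1 ^+ (N0 + i)))%:E)%E].
  exact: (euclidean_linked_le hd phi1 M_box dom m_cube).
have := expected_steps_le hd (ltnW n1) (@euclidean_sym R d) (@euclidean_triangle R d)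
  (@euclidean_xx R d) (@euclidean_ge0 R d) (@euclidean_le_manhattan R d)
  pX ME (config_cube_ae M_box m_cube) event
  (fun k => euclidean_series_le n1 phi1 k K0 L0 lo).
move=> /le_trans; apply; rewrite lee_fin -/w -/L.
have lnp := ln_product_ge n1 phi1; set l := ln _ in lnp hN *.
have s0 : 0 < s by rewrite mulr_gt0// powR_gt0.
have ws : w * s ^+ 2 = n%:R `^ (4 + 3^-1 - d%:R^-1) * phi `^ (8 / 3).
  rewrite /s exprMn mulrA -!powR_mulrn ?powR_ge0// -!powRrM w_pow.
  rewrite (_ : 5 / 3 * 2 + 1 = 4 + 3^-1); last by field.
  by rewrite (_ : 4 / 3 * 2 = 8 / 3); last by field.
have y_ge : n%:R <= w * s ^+ 2.
  rewrite ws -[leLHS]mulr1; apply: ler_pM => //.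
    rewrite -[leLHS]powRr1 ?(ltW n0R)//; apply: ler_powR => //.
    have : d%:R^-1 <= 1 :> R by rewrite invf_le1 ?ler1n ?ltr0n (leq_trans _ hd).
    by move: (d%:R^-1) => t; lra.
  by rewrite -[leLHS](powRr0 phi); apply: ler_powR.
rewrite [_ * l ^+ 2 * _]mulrAC -ws.
set y := w * s ^+ 2 in y_ge *.
have y0 : 0 <= y by rewrite (le_trans _ y_ge)// ltW.
have TK0 : 0 <= 720 * tour_const R d * euclidean_const R d.
  by apply: mulr_ge0 K0; exact: mulr_ge0 (ler0n _ 720) T0.
have w0 : 0 <= w by apply: le_trans w1.
apply: (@le_trans _ _ (y + 12 * tour_const R d * y + 720 * tour_const R d * euclidean_const R d * y * (100 * l ^+ 2))).
  apply: lerD.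
    apply: lerD => //.
    rewrite (_ : 3 * _ * _ = 3 * tour_const R d * w * 4 ^+ N0); last by rewrite /L; ring.
    rewrite (_ : 12 * _ * _ = 3 * tour_const R d * w * (4 * s ^+ 2)); last by rewrite /y; ring.
    by rewrite ler_wpM2l// mulr_ge0// mulr_ge0.
  have u0 : 0 <= n%:R ^+ 5 * phi ^+ 4 * 2^-1 ^+ N0.
    apply: mulr_ge0; last by rewrite exprn_ge0// invr_ge0.
    by apply: mulr_ge0; [exact: exprn_ge0|exact: exprn_ge0 (ltW phi0)].
  move: hi2 u0; move: (n%:R ^+ 5 * phi ^+ 4 * 2^-1 ^+ N0) => u us u0.
  rewrite (_ : 720 * L * _ * u = 720 * tour_const R d * euclidean_const R d * (w * u)); last first.
    by rewrite /L; ring.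
  apply: ler_pM.
  - exact: mulr_ge0 TK0 (mulr_ge0 w0 u0).
  - exact: sqr_ge0.
  - by apply: ler_wpM2l TK0 _ _ _; exact: ler_wpM2l w0 _ _ us.
  - rewrite (_ : 100 * l ^+ 2 = (10 * l) ^+ 2); last by ring.
    have l0 : 0 <= l by apply: le_trans lnp; rewrite invr_ge0.
    apply: (lerXn2r _ _ _ hN); rewrite nnegrE; first exact: ler0n.
    exact: mulr_ge0 (ler0n _ 10) l0.
have l2 : 1 <= 4 * l ^+ 2.
  by move: lnp; move: l hN => t _ ht; nra.
have C0 : 0 <= 1 + 12 * tour_const R d.
  by apply: addr_ge0 => //; exact: mulr_ge0 (ler0n _ 12) T0.
apply: (@le_trans _ _ ((1 + 12 * tour_const R d) * y * (4 * l ^+ 2) +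
   720 * tour_const R d * euclidean_const R d * y * (100 * l ^+ 2))).
  rewrite lerD2r (_ : y + _ = (1 + 12 * tour_const R d) * y * 1); last by ring.
  by apply: ler_wpM2l => //; exact: mulr_ge0.
rewrite le_eqVlt; apply/orP; left; apply/eqP; rewrite /euclidean_rate; ring.
Qed.

End rates.

Lemma euclidean_rate_ge0 (R : realType) d : (2 <= d)%N -> 0 <= euclidean_rate R d.
Proof.
move=> hd; have T0 := le_trans ler01 (tour_const_ge1 R hd).
apply: addr_ge0.
  apply: addr_ge0 => //; exact: mulr_ge0 (ler0n _ 48) T0.
apply: mulr_ge0 (ler0n _ 100); apply: mulr_ge0 (euclidean_const_ge0 R d).
exact: mulr_ge0 (ler0n _ 720) T0.
Qed.

Theorem theorem3 (R : realType) (d : nat) (hd : (2 <= d)%N) :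
  (exists C : R, forall (n : nat) (phi : R) (dOm : measure_display)
      (Om : measurableType dOm) (P : probability Om R)
      (X : 'I_n -> Om -> Rpoint R d),
    (0 < n)%N -> 1 <= phi -> perturbed_instance phi P X ->
    (expected_two_opt_steps (@manhattan R d) P X <=
      (C * (n%:R `^ (4 - d%:R^-1) * ln n%:R * phi))%:E)%E) /\
  (exists C : R, forall (n : nat) (phi : R) (dOm : measure_display)
      (Om : measurableType dOm) (P : probability Om R)
      (X : 'I_n -> Om -> Rpoint R d),
    (0 < n)%N -> 1 <= phi -> perturbed_instance phi P X ->
    (expected_two_opt_steps (@euclidean R d) P X <=
      (C * (n%:R `^ (4 + 3^-1 - d%:R^-1) * ln (n%:R * phi) ^+ 2 *
            phi `^ (8 / 3)))%:E)%E).
Proof.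
split.
- exists (manhattan_rate R d) => n phi dOm Om P X n0 phi1 pX.
  have [n1|n1] := leqP n 1; last exact: manhattan_steps_le.
  apply: (le_trans (expected_steps1 P X _ n1)).
  have -> : n = 1%N by apply/eqP; rewrite eqn_leq n1.
  by rewrite ln1 mulr0 mul0r mulr0.
- exists (euclidean_rate R d) => n phi dOm Om P X n0 phi1 pX.
  have [n1|n1] := leqP n 1; last exact: euclidean_steps_le.
  apply: (le_trans (expected_steps1 P X _ n1)); rewrite lee_fin.
  apply: mulr_ge0; first exact: euclidean_rate_ge0.
  apply: mulr_ge0 (powR_ge0 _ _).
  exact: mulr_ge0 (powR_ge0 _ _) (sqr_ge0 _).
Qed.
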